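(* There is an algorithm which, given a matrix $A\in\mathbb{R}_{\max}^{n\times n}$ with $m$ finite entries, together with the node partition $N_1,\dots,N_r$ obtained from a maximal multi-circuit sequence of $A$ by the procedure described in the context and the associated values $\lambda_{k(1)},\dots,\lambda_{k(r)}$, computes in $O(n(m+n\log n))$ time in total, for all $s=1,\dots,r$, a vector $\bm{d}_s\in\mathbb{R}^{V_s}$ and the matrix $$A'_s=(-\lambda_{k(s)})\otimes \mathrm{diag}(-\bm{d}_s)\otimes A(V_s)\otimes\mathrm{diag}(\bm{d}_s)$$ such that all entries of $A'_s$ are $\le 0$ (that is, visualizations of all the matrices $A(V_1),\dots,A(V_r)$).
   Context: Max-plus algebra: $\mathbb{R}_{\max}=\mathbb{R}\cup\{\varepsilon\}$, $\varepsilon=-\infty$, $a\oplus b=\max(a,b)$, $a\otimes b=a+b$; matrix operations are defined as usual with these operations. $\mathrm{diag}(\bm d)$ has the entries of $\bm d$ on the diagonal and $\varepsilon$ elsewhere. A matrix is finite at an entry if that entry is $\ne\varepsilon$. A square matrix $B=(b_{ij})$ is called visualized if $b_{ij}\le\lambda(B)$ for all $i,j$, where $\lambda(B)$ is the maximum mean weight (weight divided by length) of circuits in $\mathcal{G}(B)$. Here $\lambda(A(V_s))=\lambda_{k(s)}$. Time is the number of elementary operations, arithmetic operations and comparisons on reals counting as unit cost. Graph: for $A=(a_{ij})\in\mathbb{R}_{\max}^{n\times n}$, $\mathcal{G}(A)$ is the weighted digraph with node set $N=\{1,\dots,n\}$, arcs $(i,j)$ whenever $a_{ij}\ne\varepsilon$,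 with weight $a_{ij}$. Paths are node sequences following arcs; length $\ell(\cdot)$ is the number of arcs, weight $w(\cdot)$ the sum of arc weights. A circuit is a closed path; it is elementary if no node is repeated apart from the coinciding start and end. $N(\mathcal{C})$ is the node set of $\mathcal{C}$. A multi-circuit is a (possibly empty) set of pairwise node-disjoint elementary circuits; its length and weight are the sums of those of its circuits (both $0$ for the empty one). Characteristic polynomial: $\chi_A(t)=\det(A\oplus t\otimes I_n)$, where $\det B=\max_{\pi\in S_n}\sum_i b_{i\pi(i)}$ and $I_n$ has $0$ on the diagonal and $\varepsilon$ elsewhere. Its roots are the $r_i$ in its factorization into max-plus linear factors $t\oplus r_i$. Let $\lambda_1>\dots>\lambda_p$ be its distinct finite roots, $\lambda_0=+\infty$, $\lambda_{p+1}=\varepsilon=-\infty$. For $\lambda\in\mathbb{R}$, a multi-circuit $\mathfrak{C}$ is a $\lambda$-maximal multi-circuit ($\lambda$-MMC) if $\chi_A(\lambda)=w(\mathfrak{C})+\lambda(n-\ell(\mathfrak{C}))$. A maximal multi-circuit sequence (MMCS) of $A$ is a sequence $\mathfrak{C}_0=\emptyset,\mathfrak{C}_1,\dots,\mathfrak{C}_p$ of multi-circuits such that for each $k=0,\dots,p$, $\mathfrak{C}_k$ is a $\lambda$-MMC for all real $\lambda$ with $\lambda_{k+1}\le\lambda\le\lambda_k$. Node partition procedure: start with $r=0$, $N_0=U_0=\emptyset$. For $k=1,\dots,p$, and for each circuit $\mathcal{C}\in\mathfrak{C}_k$ (in some order): if $N(\mathcal{C})\cap U_r\ne\emptyset$,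 replace $N_r$ by $N_r\cup(N(\mathcal{C})\setminus U_r)$ and $U_r$ by $U_r\cup N(\mathcal{C})$; otherwise set $N_{r+1}=N(\mathcal{C})$, $U_{r+1}=U_r\cup N(\mathcal{C})$ and increase $r$ by one. At the end add all nodes of $N\setminus U_r$ to $N_r$ and set $U_r=N$. The output is $N_1,\dots,N_r$. The index $k(s)$ is the index $k$ of the multi-circuit $\mathfrak{C}_k$ containing the circuit that initially created $N_s$. Let $V_s=N\setminus(N_1\cup\dots\cup N_{s-1})$, and let $A(V_s)$ be the submatrix of $A$ with rows and columns restricted to $V_s$. *)

(* Defs.v *)
From HB Require Import structures.
From mathcomp Require Import all_boot all_order all_fingroup all_algebra.
From mathcomp Require Import reals constructive_ereal exp.

Set Implicit Arguments.
Unset Strict Implicit.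
Unset Printing Implicit Defensive.

Import Order.TTheory GRing.Theory Num.Theory.
Local Open Scope ring_scope.

(* The max-plus semiring: [None] is the element -oo, [x + y] is the maximum
   and [x * y] the sum of reals.  With this instance the semiring constants
   are [0 = None] and [1 = Some 0], so that the matrix, big operator and
   power notations of the library denote the max-plus operations.            *)
Definition Rmax (R : realType) : Type := option R.

HB.instance Definition _ (R : realType) := Choice.copy (Rmax R) (option R).

Definition mp_add (R : realType) (x y : Rmax R) : Rmax R :=
  match x, y with
  | Some a, Some b => Some (Num.max a b)
  | None, _ => y
  | _, None => x
  end.

Definition mp_mul (R : realType) (x y : Rmax R) : Rmax R :=
  match x, y with
  | Some a, Some b => Some (a + b)
  | _, _ => None
  end.

Fact mp_addA (R : realType) : associative (@mp_add R).
Proof. by case=> [a|] [b|] [c|] //=; rewrite maxA. Qed.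

Fact mp_addC (R : realType) : commutative (@mp_add R).
Proof. by case=> [a|] [b|] //=; rewrite maxC. Qed.

Fact mp_add0 (R : realType) : left_id None (@mp_add R).
Proof. by case. Qed.

HB.instance Definition _ (R : realType) :=
  GRing.isNmodule.Build (Rmax R) (@mp_addA R) (@mp_addC R) (@mp_add0 R).

Fact mp_mulA (R : realType) : associative (@mp_mul R).
Proof. by case=> [a|] [b|] [c|] //=; rewrite addrA. Qed.

Fact mp_mulC (R : realType) : commutative (@mp_mul R).
Proof. by case=> [a|] [b|] //=; rewrite addrC. Qed.

Fact mp_mul1 (R : realType) : left_id (Some 0) (@mp_mul R).
Proof. by case=> [a|] //=; rewrite add0r. Qed.

Fact mp_mulDl (R : realType) : left_distributive (@mp_mul R) (@mp_add R).
Proof. by case=> [a|] [b|] [c|] //=; rewrite addr_maxl. Qed.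

Fact mp_mul0 (R : realType) : left_zero None (@mp_mul R).
Proof. by []. Qed.

HB.instance Definition _ (R : realType) :=
  GRing.Nmodule_isComPzSemiRing.Build (Rmax R)
    (@mp_mulA R) (@mp_mulC R) (@mp_mul1 R) (@mp_mulDl R) (@mp_mul0 R).

Definition to_ereal (R : realType) (x : Rmax R) : \bar R :=
  if x is Some a then a%:E else -oo%E.

Section Graph.
Context {R : realType} {n : nat}.
Implicit Types (A : 'M[Rmax R]_n) (c : seq 'I_n).

(* A circuit (v_0, ..., v_{l-1}, v_0) is represented by the sequence
   [:: v_0; ...; v_{l-1}]; its length is [size c].                           *)
Definition circuit A c : bool :=
  (c != [::]) && path.cycle (fun i j => A i j != 0) c.

Definition elementary_circuit A c : bool := circuit A c && uniq c.

Definition weight A c : Rmax R := \prod_(e <- zip c (rot 1 c)) A e.1 e.2.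

Definition multicircuit A (M : seq (seq 'I_n)) : bool :=
  all (elementary_circuit A) M && uniq (flatten M).

Definition mc_length (M : seq (seq 'I_n)) : nat := \sum_(c <- M) size c.

Definition mc_weight A (M : seq (seq 'I_n)) : Rmax R :=
  \prod_(c <- M) weight A c.

Definition is_max_cycle_mean A (l : R) : Prop :=
  (exists c w, [/\ circuit A c, weight A c = Some w & l = w / (size c)%:R]) /\
  (forall c w, circuit A c -> weight A c = Some w -> w / (size c)%:R <= l).

Definition visualized A : Prop :=
  exists l, is_max_cycle_mean A l /\
            forall i j, (to_ereal (A i j) <= l%:E)%E.

Definition mp_det (B : 'M[Rmax R]_n) : Rmax R :=
  \sum_(s : 'S_n) \prod_(i < n) B i (s i).

Definition char_fun A (t : Rmax R) : Rmax R := mp_det (A + t *: 1%:M).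

(* Equality is between polynomial functions: distinct formal max-plus
   polynomials may define the same function, and only the function factors.  *)
Definition char_roots A (rs : n.-tuple (Rmax R)) : Prop :=
  forall t : Rmax R, char_fun A t = \prod_(r <- rs) (t + r).

Definition distinct_finite_roots (rs : n.-tuple (Rmax R)) (lams : seq R) :
    Prop :=
  sorted (fun x y => y < x) lams /\
  (forall x : R, (x \in lams) = ((Some x : Rmax R) \in (rs : seq (Rmax R)))).

(* lambda_k for 0 <= k <= p + 1, where [lams] lists lambda_1, ..., lambda_p. *)
Definition lam_ext (lams : seq R) (k : nat) : \bar R :=
  if k is j.+1 then
    if (j < size lams)%N then (lams`_j)%:E else -oo%E
  else +oo%E.

Definition is_MMC A (lam : R) (M : seq (seq 'I_n)) : Prop :=
  multicircuit A M /\
  char_fun A (Some lam) =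
    mc_weight A M * (Some lam : Rmax R) ^+ (n - mc_length M).

Definition is_MMCS A (lams : seq R) (Cs : seq (seq (seq 'I_n))) : Prop :=
  [/\ size Cs = (size lams).+1,
      nth [::] Cs 0 = [::],
      (forall k, (k <= size lams)%N -> multicircuit A (nth [::] Cs k)) &
      forall k (lam : R), (k <= size lams)%N ->
        (lam_ext lams k.+1 <= lam%:E <= lam_ext lams k)%E ->
        is_MMC A lam (nth [::] Cs k)].

(* Running state of the node partition: the pairs (N_s, k(s)) in reverse
   order of creation, and the set U_r.  While r = 0 the set N_0, which is
   not part of the output, is not recorded.  The circuits of a multi-circuit
   are processed in the order of the list representing it.                   *)
Definition add_to_last (P : seq ({set 'I_n} * nat)) (S : {set 'I_n}) :=
  if P is (N, k) :: P' then (N :|: S, k) :: P' else [::].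

Definition partition_step (st : seq ({set 'I_n} * nat) * {set 'I_n})
    (kc : nat * seq 'I_n) : seq ({set 'I_n} * nat) * {set 'I_n} :=
  let: (P, U) := st in
  let NC := [set v in kc.2] in
  if NC :&: U != set0 then (add_to_last P (NC :\: U), U :|: NC)
  else ((NC, kc.1) :: P, U :|: NC).

Definition node_partition (Cs : seq (seq (seq 'I_n))) :
    seq ({set 'I_n} * nat) :=
  let circuits :=
    flatten [seq [seq (k, c) | c <- nth [::] Cs k]
            | k <- iota 1 (size Cs).-1] in
  let: (P, U) := foldl partition_step ([::], set0) circuits in
  rev (add_to_last P (~: U)).

(* In what follows indices are shifted by one: [part_set P s] is N_{s+1},
   [part_lam lams P s] is lambda_{k(s+1)}, [part_rest P s] is V_{s+1}.       *)
Definition part_set (P : seq ({set 'I_n} * nat)) (s : nat) : {set 'I_n} :=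
  (nth (set0, 0%N) P s).1.

Definition part_lam (lams : seq R) (P : seq ({set 'I_n} * nat)) (s : nat) : R :=
  lams`_(nth (set0, 0%N) P s).2.-1.

Definition part_rest (P : seq ({set 'I_n} * nat)) (s : nat) : {set 'I_n} :=
  ~: \bigcup_(i < s) part_set P i.

Definition part_index (P : seq ({set 'I_n} * nat)) (v : 'I_n) : nat :=
  find (fun Nk : {set 'I_n} * nat => v \in Nk.1) P.

Definition restrict A (V : {set 'I_n}) : 'M[Rmax R]_#|V| :=
  mxsub enum_val enum_val A.

Definition nb_finite A : nat := #|[set e : 'I_n * 'I_n | A e.1 e.2 != 0]|.

End Graph.

Definition scaled (R : realType) (k : nat) (B : 'M[Rmax R]_k) (lam : R)
    (d : 'rV[R]_k) : 'M[Rmax R]_k :=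
  (Some (- lam) : Rmax R) *:
    (diag_mx (\row_j (Some (- d 0 j) : Rmax R)) *m B
     *m diag_mx (\row_j (Some (d 0 j) : Rmax R))).

(* A real random access machine, presented as a structured language over a
   memory made of finitely many (per program) integer and real arrays of
   unbounded length.  Array names are constants of the program, whereas
   indices are computed.  There is no conversion between integers and reals,
   and no multiplication or division of integers, so that large integers
   cannot be used to perform many operations at unit cost.                   *)
Inductive iexp : Type :=
| IConst of nat
| IGet of nat & iexp          (* array name, index *)
| IAdd of iexp & iexp
| ISub of iexp & iexp.        (* truncated subtraction *)

Inductive rexp : Type :=
| RZero
| ROne
| RGet of nat & iexp
| RAdd of rexp & rexp
| RSub of rexp & rexp
| RMul of rexp & rexp
| RDiv of rexp & rexp.

Inductive bexp : Type :=
| BLeI of iexp & iexp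
| BLeR of rexp & rexp
| BNot of bexp
| BAnd of bexp & bexp.

Inductive cmd : Type :=
| Skip
| ISet of nat & iexp & iexp   (* array name, index, new value *)
| RSet of nat & iexp & rexp
| Seq of cmd & cmd
| If of bexp & cmd & cmd
| While of bexp & cmd.

Record store (R : realType) := Store {
  imem : nat -> nat -> nat;   (* array name, index *)
  rmem : nat -> nat -> R
}.

Definition upd (T : Type) (m : nat -> nat -> T) (a i : nat) (v : T) :
    nat -> nat -> T :=
  fun b j => if (b == a) && (j == i) then v else m b j.

Fixpoint ieval (R : realType) (st : store R) (e : iexp) : nat :=
  match e with
  | IConst k => k
  | IGet a i => imem st a (ieval st i)
  | IAdd e1 e2 => (ieval st e1 + ieval st e2)%N
  | ISub e1 e2 => (ieval st e1 - ieval st e2)%N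
  end.

Fixpoint reval (R : realType) (st : store R) (e : rexp) : R :=
  match e with
  | RZero => 0
  | ROne => 1
  | RGet a i => rmem st a (ieval st i)
  | RAdd e1 e2 => reval st e1 + reval st e2
  | RSub e1 e2 => reval st e1 - reval st e2
  | RMul e1 e2 => reval st e1 * reval st e2
  | RDiv e1 e2 => reval st e1 / reval st e2
  end.

Fixpoint beval (R : realType) (st : store R) (b : bexp) : bool :=
  match b with
  | BLeI e1 e2 => (ieval st e1 <= ieval st e2)%N
  | BLeR e1 e2 => reval st e1 <= reval st e2
  | BNot b1 => ~~ beval st b1
  | BAnd b1 b2 => beval st b1 && beval st b2
  end.

Fixpoint icost (e : iexp) : nat :=
  match e with
  | IConst _ => 1
  | IGet _ i => (icost i).+1
  | IAdd e1 e2 | ISub e1 e2 => (icost e1 + icost e2).+1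
  end.

Fixpoint rcost (e : rexp) : nat :=
  match e with
  | RZero | ROne => 1
  | RGet _ i => (icost i).+1
  | RAdd e1 e2 | RSub e1 e2 | RMul e1 e2 | RDiv e1 e2 =>
      (rcost e1 + rcost e2).+1
  end.

Fixpoint bcost (b : bexp) : nat :=
  match b with
  | BLeI e1 e2 => (icost e1 + icost e2).+1
  | BLeR e1 e2 => (rcost e1 + rcost e2).+1
  | BNot b1 => (bcost b1).+1
  | BAnd b1 b2 => (bcost b1 + bcost b2).+1
  end.

(* [exec p st t st']: started in [st], the program [p] halts in [st'] after
   exactly [t] elementary operations.                                        *)
Inductive exec (R : realType) : cmd -> store R -> nat -> store R -> Prop :=
| ExecSkip st : exec Skip st 1 st
| ExecISet a i e st :
    exec (ISet a i e) st (icost i + icost e).+1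
      (Store (upd (imem st) a (ieval st i) (ieval st e)) (rmem st))
| ExecRSet a i e st :
    exec (RSet a i e) st (icost i + rcost e).+1
      (Store (imem st) (upd (rmem st) a (ieval st i) (reval st e)))
| ExecSeq p q st1 st2 st3 t1 t2 :
    exec p st1 t1 st2 -> exec q st2 t2 st3 ->
    exec (Seq p q) st1 (t1 + t2) st3
| ExecIfTrue b p q st st' t :
    beval st b -> exec p st t st' -> exec (If b p q) st (bcost b + t).+1 st'
| ExecIfFalse b p q st st' t :
    ~~ beval st b -> exec q st t st' -> exec (If b p q) st (bcost b + t).+1 st'
| ExecWhileFalse b p st :
    ~~ beval st b -> exec (While b p) st (bcost b).+1 st
| ExecWhileTrue b p st1 st2 st3 t1 t2 :
    beval st1 b -> exec p st1 t1 st2 -> exec (While b p) st2 t2 st3 ->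
    exec (While b p) st1 (bcost b + t1 + t2).+1 st3.

(* The list of finite entries (row, column, value) of a matrix, the i-th row
   and column being designated by the number [lab i].                        *)
Definition entries (R : realType) (k : nat) (lab : 'I_k -> nat)
    (B : 'M[Rmax R]_k) : seq (nat * nat * R) :=
  [seq (lab e.1, lab e.2, odflt 0 (B e.1 e.2))
  | e <- enum {: 'I_k * 'I_k} & B e.1 e.2 != 0].

(* Input integer arrays:
     0: n, m, r;   1: rows, 2: columns of the finite entries of A;
     3: for each node v, the s such that v lies in N_{s+1}.
   Input real arrays:
     0: values of the finite entries of A;   1: lambda_{k(1)}, ...,
     lambda_{k(r)}.
   All other cells are zero.  The finite entries of A come in the order of
   the list [es].                                                            *)
Definition input_store (R : realType) (n : nat) (es : seq (nat * nat * R))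
    (P : seq ({set 'I_n} * nat)) (lams : seq R) : store R :=
  Store
    (fun a i => match a with
     | 0 => nth 0%N [:: n; size es; size P] i
     | 1 => nth 0%N [seq e.1.1 | e <- es] i
     | 2 => nth 0%N [seq e.1.2 | e <- es] i
     | 3 => nth 0%N [seq part_index P v | v <- enum 'I_n] i
     | _ => 0%N
     end)
    (fun a i => match a with
     | 0 => nth 0 [seq e.2 | e <- es] i
     | 1 => nth 0 [seq part_lam lams P s | s <- iota 0 (size P)] i
     | _ => 0
     end).

(* Output real arrays:
     2: the coordinate of d_{s+1} at node v, stored at index s * n + v;
     3: values of the finite entries of the matrices A'_{s+1}.
   Output integer arrays:
     4, 5: rows and columns of these entries, as nodes of A;
     6, 7: the entries of A'_{s+1} are those stored at the indices q with
           (array 6)[s] <= q < (array 7)[s].                                 *)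
Definition output_vec (R : realType) (n : nat) (st : store R) (s : nat)
    (V : {set 'I_n}) : 'rV[R]_#|V| :=
  \row_j rmem st 2 (s * n + (enum_val j : 'I_n))%N.

Definition output_entries (R : realType) (st : store R) (s : nat) :
    seq (nat * nat * R) :=
  [seq (imem st 4 q, imem st 5 q, rmem st 3 q)
  | q <- index_iota (imem st 6 s) (imem st 7 s)].

(* Main.v *)
Require Import Defs.
From mathcomp Require Import all_boot all_order all_fingroup all_algebra.
From mathcomp Require Import reals constructive_ereal exp.
From mathcomp Require Import zify ring lra.
From mathcomp Require boolp.

Set Implicit Arguments.
Unset Strict Implicit.
Unset Printing Implicit Defensive.

Import Order.TTheory GRing.Theory Num.Theory.
Local Open Scope ring_scope.

(** With the lengths w(i,j) = lambda_k(s) - a_ij on the arcs of A(V_s), the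
    condition A'_s <= 0 says d_j <= d_i + w(i,j) for every arc, that is, d_s is
    a feasible potential.  One exists if and only if no circuit of A(V_s) has a
    mean weight above lambda_k(s).

    This bound, and the fact that it is attained, come from exchanging circuits
    at lambda = lambda_k with k = k(s), where both C_(k-1) and C_k are maximal.
    The nodes of C_(k-1) all lie in N_1, ..., N_(s-1).  So a circuit of A(V_s)
    can be added to C_(k-1), and by maximality its weight minus lambda times its
    length is at most 0 ([excess_disjoint]).  The circuit that created N_s can
    moreover be removed from C_k, so that for it the difference is exactly 0
    ([excess_member]).  [partition_spec] collects what is needed of the node
    partition.

    The sets V_r, ..., V_1 increase and the values lambda_k(r), ...,
    lambda_k(1) do not decrease, so a potential of A(V_(s+1)) remains feasible
    at stage s on the nodes V_(s+1).  The program [visualize] therefore treats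
    s = r, ..., 1 in this order and adds the nodes of N_s one by one.  A new
    node v first receives a value compatible with its incoming arcs.  The other
    values must then be lowered to min(d_j, d_v + dist(v, j)), and this is one
    run of the algorithm of Dijkstra, because the reduced lengths
    w(i,j) + d_i - d_j of the arcs not leaving v are nonnegative; v itself is
    not lowered since no circuit is negative ([dijkstra_relax],
    [dijkstra_extract], [dijkstra_final]).

    Every node is added once, so the time bound O(n (m + n log n)) needs runs in
    O(m + n log n), hence a priority queue whose decrease-key takes constant
    amortized time.  The program uses a hollow heap with one parent per node
    (Hansen, Kaplan, Tarjan, Zwick): lowering the key of an item creates a new
    node for it, which takes over all children of the old node except the two
    of highest rank.  Neither parent pointers nor marks are stored, and a node
    of rank q still has at least 2^(q/2) descendants, the exponent being rounded
    down ([rank_size]).  The amortized costs are paid by credits carried by the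
    program logic of the first part. *)

(** * A program logic with time credits *)

Section Logic.
Local Open Scope nat_scope.
Context {R : realType}.
Implicit Types (st : store R) (c p q : cmd) (k : nat).
Implicit Type (Q : store R -> nat -> Prop).

(** Bounds the cost of every single assignment and test of [visualize], so that
    it suffices to count these steps. *)
Definition step_cost := 64.

(** From [st], the program [c] halts in a store where [Q] holds, spending part of
    the [k] available steps; [Q] receives what is left.  Carrying the credits in
    the assertions makes amortized bounds ordinary loop invariants. *)
Definition wp c Q st k :=
  exists t j st', [/\ exec c st t st', t <= step_cost * j, j <= k & Q st' (k - j)].

Lemma wp_skip Q st k : 0 < k -> Q st (k - 1) -> wp Skip Q st k.
Proof. by move=> k0 Qst; exists 1, 1, st; split=> //; exact: ExecSkip. Qed.

Lemma wp_iset a i e Q st k : (icost i + icost e).+1 <= step_cost -> 0 < k ->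
  Q (Store (upd (imem st) a (ieval st i) (ieval st e)) (rmem st)) (k - 1) ->
  wp (ISet a i e) Q st k.
Proof.
by move=> ce k0 Qst; eexists _, 1, _; split; [exact: ExecISet|rewrite muln1| |].
Qed.

Lemma wp_rset a i e Q st k : (icost i + rcost e).+1 <= step_cost -> 0 < k ->
  Q (Store (imem st) (upd (rmem st) a (ieval st i) (reval st e))) (k - 1) ->
  wp (RSet a i e) Q st k.
Proof.
by move=> ce k0 Qst; eexists _, 1, _; split; [exact: ExecRSet|rewrite muln1| |].
Qed.

Lemma wp_seq p q Q st k : wp p (wp q Q) st k -> wp (Seq p q) Q st k.
Proof.
move=> [t1] [j1] [st1] [e1 l1 k1 [t2] [j2] [st2] [e2 l2 k2 Qst]].
exists (t1 + t2), (j1 + j2), st2; split; [exact: ExecSeq e1 e2|lia|lia|].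
by rewrite subnDA.
Qed.

Lemma wp_if b p q Q st k : (bcost b).+1 <= step_cost -> 0 < k ->
  (beval st b -> wp p Q st (k - 1)) -> (~~ beval st b -> wp q Q st (k - 1)) ->
  wp (If b p q) Q st k.
Proof.
move=> cb k0 Hp Hq; case bst: (beval st b).
  have [t [j [st' [ex tj jk Qst]]]] := Hp bst.
  exists (bcost b + t).+1, j.+1, st'; split; [exact: ExecIfTrue|lia|lia|].
  by rewrite -add1n subnDA.
have [t [j [st' [ex tj jk Qst]]]] := Hq (negbT bst).
exists (bcost b + t).+1, j.+1, st'; split; [exact: ExecIfFalse (negbT bst) ex|lia|lia|].
by rewrite -add1n subnDA.
Qed.

Lemma wp_subS c Q st k j : j < k ->
  (forall k', 0 < k' -> k' - 1 = k - j.+1 -> wp c Q st k') -> wp c Q st (k - j).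
Proof. by move=> jk; apply; lia. Qed.

Lemma wp_skip_sub Q st k j : j < k -> Q st (k - j.+1) -> wp Skip Q st (k - j).
Proof. by move=> jk Qst; apply: wp_subS => // k' k0 E; apply: wp_skip; rewrite ?E. Qed.

Lemma wp_iset_sub a i e Q st k j : (icost i + icost e).+1 <= step_cost -> j < k ->
  Q (Store (upd (imem st) a (ieval st i) (ieval st e)) (rmem st)) (k - j.+1) ->
  wp (ISet a i e) Q st (k - j).
Proof. by move=> ce jk Qst; apply: wp_subS => // k' k0 E; apply: wp_iset; rewrite ?E. Qed.

Lemma wp_rset_sub a i e Q st k j : (icost i + rcost e).+1 <= step_cost -> j < k ->
  Q (Store (imem st) (upd (rmem st) a (ieval st i) (reval st e))) (k - j.+1) ->
  wp (RSet a i e) Q st (k - j).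
Proof. by move=> ce jk Qst; apply: wp_subS => // k' k0 E; apply: wp_rset; rewrite ?E. Qed.

Lemma wp_if_sub b p q Q st k j : (bcost b).+1 <= step_cost -> j < k ->
  (beval st b -> wp p Q st (k - j.+1)) -> (~~ beval st b -> wp q Q st (k - j.+1)) ->
  wp (If b p q) Q st (k - j).
Proof. by move=> cb jk Hp Hq; apply: wp_subS => // k' k0 E; apply: wp_if; rewrite ?E. Qed.

Fixpoint int_writes c : seq nat :=
  match c with
  | ISet a _ _ => [:: a]
  | Seq p q | If _ p q => int_writes p ++ int_writes q
  | While _ p => int_writes p
  | _ => [::]
  end.

Fixpoint real_writes c : seq nat :=
  match c with
  | RSet a _ _ => [:: a]
  | Seq p q | If _ p q => real_writes p ++ real_writes q
  | While _ p => real_writes p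
  | _ => [::]
  end.

(** Arrays that do not occur on the left of an assignment are unchanged.  This
    syntactic fact keeps the loop invariants restricted to the arrays that the
    loop writes. *)
Definition frame c st st' :=
  (forall a, a \notin int_writes c -> imem st' a = imem st a) /\
  (forall a, a \notin real_writes c -> rmem st' a = rmem st a).

Lemma upd_other T (m : nat -> nat -> T) a i v b : b != a -> upd m a i v b = m b.
Proof. by move=> ba; apply: boolp.funext => j; rewrite /upd (negbTE ba). Qed.

Lemma frame_trans c st1 st2 st3 :
  frame c st1 st2 -> frame c st2 st3 -> frame c st1 st3.
Proof.
move=> [i1 r1] [i2 r2]; split=> a ha; first by rewrite i2 ?i1.
by rewrite r2 ?r1.
Qed.

Lemma exec_frame c st t st' : exec c st t st' -> frame c st st'.
Proof.
elim=> {c st t st'} //=.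
- by move=> a i e st; split=> // b; rewrite inE => ba; rewrite /= upd_other.
- by move=> a i e st; split=> // b; rewrite inE => ba; rewrite /= upd_other.
- move=> p q st1 st2 st3 t1 t2 _ [i1 r1] _ [i2 r2].
  by split=> a; rewrite /= mem_cat negb_or => /andP[ap aq]; rewrite ?i2 ?i1 ?r2 ?r1.
- move=> b p q st st' t _ _ [i1 r1].
  by split=> a; rewrite /= mem_cat negb_or => /andP[ap aq]; rewrite ?i1 ?r1.
- move=> b p q st st' t _ _ [i1 r1].
  by split=> a; rewrite /= mem_cat negb_or => /andP[ap aq]; rewrite ?i1 ?r1.
- move=> b p st1 st2 st3 t1 t2 _ _ f1 _ f2.
  exact: frame_trans f1 f2.
Qed.

Lemma wp_frame c Q st k :
  wp c (fun st' k' => frame c st st' -> Q st' k') st k -> wp c Q st k.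
Proof.
move=> [t] [j] [st'] [ex tj jk Qst]; exists t, j, st'; split=> //.
exact: Qst (exec_frame ex).
Qed.

(** Every iteration spends a credit, so the loop halts. *)
Lemma wp_while (I : store R -> nat -> Prop) b c Q st0 k0 :
  (bcost b).+1 <= step_cost -> I st0 k0 ->
  (forall st k, frame c st0 st -> I st k -> beval st b ->
     0 < k /\ wp c I st (k - 1)) ->
  (forall st k, frame c st0 st -> I st k -> ~~ beval st b ->
     0 < k /\ Q st (k - 1)) ->
  wp (While b c) Q st0 k0.
Proof.
move=> cb I0 Ht Hf.
suff H n st k : k < n -> frame c st0 st -> I st k -> wp (While b c) Q st k.
  exact: (H k0.+1).
elim: n st k => // n IHn st k kn fr Ik.
case bst: (beval st b); last first.
  have [k_gt0 Qst] := Hf _ _ fr Ik (negbT bst).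
  exists (bcost b).+1, 1, st; split=> //.
  exact: ExecWhileFalse (negbT bst).
have [k_gt0 [t1 [j1 [st1 [e1 l1 k1 I1]]]]] := Ht _ _ fr Ik bst.
have [||t2 [j2 [st2 [e2 l2 k2 Qst]]]] := IHn st1 (k - 1 - j1) _ _ I1.
- lia.
- exact: frame_trans fr (exec_frame e1).
exists (bcost b + t1 + t2).+1, (j1 + j2).+1, st2; split.
- exact: ExecWhileTrue bst e1 e2.
- lia.
- lia.
- by rewrite -add1n !subnDA.
Qed.

End Logic.

(** * Arrays *)

Definition set_at T (f : nat -> T) i v := fun j => if j == i then v else f j.

Lemma set_at_eq T (f : nat -> T) i v : set_at f i v i = v.
Proof. by rewrite /set_at eqxx. Qed.

Lemma set_at_neq T (f : nat -> T) i v j : j != i -> set_at f i v j = f j.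
Proof. by rewrite /set_at => /negbTE ->. Qed.

Lemma mkseq_set_at T (f : nat -> T) n v :
  mkseq (set_at f n v) n.+1 = rcons (mkseq f n) v.
Proof.
rewrite mkseqS set_at_eq; congr rcons.
by apply/eq_in_map => i; rewrite mem_iota => /andP[_ iN]; rewrite set_at_neq //; lia.
Qed.

Lemma sum_set_at T (g : nat -> T -> nat) B (f : nat -> T) i v : (i < B)%N ->
  (\sum_(j < B) g j (set_at f i v j) + g i (f i) = \sum_(j < B) g j (f j) + g i v)%N.
Proof.
move=> iB; rewrite (bigD1 (Ordinal iB)) //= set_at_eq.
rewrite [in RHS](bigD1 (Ordinal iB)) //=.
rewrite (eq_bigr (fun j : 'I_B => g j (f j))); first lia.
by move=> j ji; rewrite set_at_neq.
Qed.

(** * Hollow heaps *)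

Section HollowHeap.
Local Open Scope nat_scope.
Context {R : realType}.

(** The state of a hollow heap.  [cur v] is the node now representing the item
    [v]; the other nodes of [v] are hollow. *)
Record heap := Heap {
  rank : nat -> nat;
  kid0 : nat -> nat;
  sib : nat -> nat;
  item : nat -> nat;
  cur : nat -> nat;
  key : nat -> R;
  nnodes : nat }.

Implicit Types (h : heap) (al : nat -> bool) (par tb : nat -> nat) (L : seq nat).

(** The children of a node form a list linked by [sib], by decreasing rank. *)
Definition kid h u j := iter j (sib h) (kid0 h u).
(** Full nodes represent their item; the others are hollow. *)
Definition full h x := cur h (item h x) == x.
(** A hollow node keeps the two children of highest rank; the rest of its list
    now belongs to another node, without any pointer having been changed. *)
Definition nkids h u := if full h u then rank h u else minn (rank h u) 2.

(** [al] is the set of nodes still in the forest and [par] their parents; neither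
    is stored by the program.  The children of a node of rank q have the ranks
    q-1, q-2, ..., which determines their positions in the list. *)
Record heap_inv h al par : Prop := HeapInv {
  rank0 : rank h 0 = 0;
  al_nnodes : forall x, al x -> 0 < x <= nnodes h;
  up : forall x, al x -> par x != 0 ->
    [/\ al (par x), rank h x < rank h (par x), (key h (par x) <= key h x)%R,
        rank h (par x) - (rank h x).+1 < nkids h (par x) &
        x = kid h (par x) (rank h (par x) - (rank h x).+1)];
  down : forall u j, al u -> j < nkids h u ->
    [/\ al (kid h u j), par (kid h u j) = u & rank h (kid h u j) = rank h u - j.+1];
  cur_nnodes : forall v, cur h v <= nnodes h;
  item_cur : forall v, cur h v != 0 -> item h (cur h v) = v }.

(** The roots are kept in the list [L], where they are arbitrary, and in the
    table [tb] indexed by ranks, where they are full. *)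
Record root_list h al par L tb : Prop := Roots {
  roots_uniq : uniq L;
  roots_L : forall x, x \in L -> al x /\ par x = 0;
  roots_tb : forall i, tb i != 0 ->
    [/\ al (tb i), par (tb i) = 0, rank h (tb i) = i & full h (tb i)];
  roots_disj : forall x, x \in L -> tb (rank h x) != x;
  roots_all : forall x, al x -> par x = 0 -> x \in L \/ tb (rank h x) = x }.

Lemma nkids_rank h u : nkids h u <= rank h u.
Proof. by rewrite /nkids; case: ifP => // _; exact: geq_minl. Qed.

Lemma nkids_gt1 h u : 1 < rank h u -> 1 < nkids h u.
Proof. by rewrite /nkids; case: ifP => // _ h2; rewrite leq_min h2. Qed.

Inductive desc al par u : nat -> Prop :=
| desc_refl : desc al par u u
| desc_up x : al x -> par x != 0 -> desc al par u (par x) -> desc al par u x.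

Lemma desc_rank h al par u x : heap_inv h al par ->
  desc al par u x -> rank h x <= rank h u.
Proof.
move=> H; elim=> {x} // x ax px _ IH; have [_ lt _ _ _] := up H ax px.
exact: leq_trans (ltnW lt) IH.
Qed.

Lemma desc_inv al par u x : desc al par u x -> x = u \/ desc al par u (par x).
Proof. by case=> [|y _ _ d]; [left|right]. Qed.

(** Both branches meet in [u] only: going up from a common descendant, one child
    would have to be reached from the other one through [u], against the ranks. *)
Lemma desc_disj h al par u a b x : heap_inv h al par ->
  rank h a < rank h u -> rank h b < rank h u -> par a = u -> par b = u -> a != b ->
  desc al par a x -> desc al par b x -> False.
Proof.
move=> H ra rb pa pb ab; elim=> {x} [|x ax px da IH] /desc_inv [] // db.
- by rewrite db eqxx in ab.
- by move: (desc_rank H db); rewrite pa leqNgt rb.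
- by move: (desc_rank H da); rewrite db pb leqNgt ra.
Qed.

Lemma desc_al al par u x : al u -> desc al par u x -> al x.
Proof. by move=> au; case. Qed.

Lemma desc_child al par u a x : al a -> par a = u -> u != 0 ->
  desc al par a x -> desc al par u x.
Proof.
move=> aa pa u0; elim=> {x} [|x ax px _ d]; last exact: desc_up.
by apply: desc_up; rewrite // pa //; exact: desc_refl.
Qed.

(** A node of rank q > 1, even a hollow one, has children of ranks q-1 and q-2;
    their sets of descendants are disjoint, so the sizes grow at least like
    powers of the square root of 2. *)
Lemma rank_size h al par u : heap_inv h al par -> al u ->
  2 ^ (rank h u)./2 <= nnodes h.
Proof.
move=> H au.
have [S [uS sS szS]] : exists S, [/\ uniq S,
    (forall x, x \in S -> desc al par u x) & 2 ^ (rank h u)./2 <= size S].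
  have [n rn] := ubnP (rank h u); elim: n => // n IHn in u au rn *.
  have [r1|r2] := leqP (rank h u) 1.
    exists [:: u]; split=> //; last by case: (rank h u) r1 => [|[]].
    by move=> x; rewrite inE => /eqP ->; exact: desc_refl.
  have k2 := nkids_gt1 r2.
  have [a0 p0 q0] := down H au (ltnW k2); have [a1 p1 q1] := down H au k2.
  set a := kid h u 0 in a0 p0 q0; set b := kid h u 1 in a1 p1 q1.
  have u0 : u != 0 by have /andP[] := al_nnodes H au; rewrite lt0n.
  have [|S0 [U0 D0 Z0]] := IHn a a0; first lia.
  have [|S1 [U1 D1 Z1]] := IHn b a1; first lia.
  exists (S0 ++ S1); split.
  - rewrite cat_uniq U0 U1 andbT /=; apply/hasPn => x x1; apply/negP => x0.
    apply: (@desc_disj h al par u a b x) => //; [lia|lia| |exact: D0|exact: D1].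
    by apply/eqP => ab; rewrite ab in q0; lia.
  - move=> x; rewrite mem_cat => /orP[/D0|/D1]; exact: desc_child.
  - rewrite size_cat.
    have -> : 2 ^ (rank h u)./2 = 2 ^ (rank h u - 2)./2 + 2 ^ (rank h u - 2)./2.
      by rewrite addnn -mul2n -expnS; congr (2 ^ _); lia.
    apply: leq_add; first apply: leq_trans Z0; last apply: leq_trans Z1.
      by rewrite leq_exp2l //; lia.
    by rewrite leq_exp2l //; lia.
apply: leq_trans szS _; rewrite -(size_iota 1 (nnodes h)); apply: uniq_leq_size => //.
move=> x /sS /(desc_al au) /(al_nnodes H); rewrite mem_iota; lia.
Qed.

Lemma rank_bound h al par u : heap_inv h al par -> al u ->
  rank h u <= (nnodes h).*2.
Proof.
move=> H au; have := rank_size H au; have := ltn_expl (rank h u)./2 (isT : 1 < 2).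
lia.
Qed.

(** Hence the least key of a root is the least key of the heap. *)
Lemma climb h al par x : heap_inv h al par -> al x ->
  exists y, [/\ al y, par y = 0 & (key h y <= key h x)%R].
Proof.
move=> H; have [n rn] := ubnP ((nnodes h).*2 - rank h x).
elim: n => // n IHn in x rn *; move=> ax.
have [p0|p0] := eqVneq (par x) 0; first by exists x.
have [ap rp kp _ _] := up H ax p0; have := rank_bound H ap => bp.
have [|y [ay py ky]] := IHn (par x) _ ap; first lia.
by exists y; split=> //; exact: le_trans ky kp.
Qed.

Lemma roots_perm h al par L L' tb : perm_eq L L' ->
  root_list h al par L tb -> root_list h al par L' tb.
Proof.
move=> LL' H; have E := perm_mem LL'; split.
- by rewrite -(perm_uniq LL'); exact: roots_uniq H.
- by move=> x; rewrite -E; exact: roots_L H _.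
- exact: roots_tb H.
- by move=> x; rewrite -E; exact: roots_disj H _.
- by move=> x; rewrite -E; exact: roots_all H _.
Qed.

Lemma al_neq0 h al par x : heap_inv h al par -> al x -> x != 0.
Proof. by move=> H /(al_nnodes H) /andP[]; rewrite lt0n. Qed.

Lemma roots_take h al par L tb i : heap_inv h al par -> tb i != 0 ->
  root_list h al par L tb -> root_list h al par (rcons L (tb i)) (set_at tb i 0).
Proof.
move=> H i0 Hr; have [ai pi ri fi] := roots_tb Hr i0.
have rootsL x : x \in rcons L (tb i) -> al x /\ par x = 0.
  by rewrite mem_rcons inE => /predU1P[->//|]; exact: (roots_L Hr).
split=> //.
- rewrite rcons_uniq (roots_uniq Hr) andbT; apply/negP => /(roots_disj Hr).
  by rewrite ri eqxx.
- move=> j; rewrite /set_at; case: (j =P i) => // _; exact: (roots_tb Hr).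
- move=> x xL; rewrite /set_at; case: (rank h x =P i) => [_|].
    by rewrite eq_sym (al_neq0 H) //; case: (rootsL _ xL).
  move: xL; rewrite mem_rcons inE => /predU1P[->//|xL _]; exact: roots_disj Hr _ xL.
- move=> x ax px; rewrite mem_rcons inE; case: (roots_all Hr ax px) => [->|E].
    by left; rewrite orbT.
  rewrite /set_at; case: (rank h x =P i) => [rx|_]; last by right.
  by left; rewrite -rx E eqxx.
Qed.

Lemma roots_store h al par L tb x : heap_inv h al par ->
  full h x -> tb (rank h x) = 0 ->
  root_list h al par (rcons L x) tb -> root_list h al par L (set_at tb (rank h x) x).
Proof.
move=> H fx t0 Hr; have xL : x \in rcons L x by rewrite mem_rcons mem_head.
have sub y : y \in L -> y \in rcons L x by rewrite mem_rcons inE orbC => ->.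
have [ax px] := roots_L Hr xL.
have := roots_uniq Hr; rewrite rcons_uniq => /andP[xNL uL].
split=> //.
- by move=> y /sub; exact: (roots_L Hr).
- move=> i; rewrite /set_at; case: (i =P rank h x) => [-> //|_]; exact: (roots_tb Hr).
- move=> y yL; rewrite /set_at; case: (rank h y =P rank h x) => _; last exact: roots_disj Hr _ (sub _ yL).
  by apply: contraNneq xNL => ->.
- move=> y ay py; case: (roots_all Hr ay py) => [|E].
    rewrite mem_rcons inE => /predU1P[->|->]; [right|by left].
    by rewrite set_at_eq.
  right; rewrite set_at_neq //; apply: contraTneq ay => ry.
  by rewrite -E ry t0; apply/negP => /(al_nnodes H).
Qed.

Definition unroot par x : nat -> nat := fun y => if par y == x then 0 else par y.

(** The children of the removed root become roots. *)
Lemma heap_inv_remove h al par x : heap_inv h al par -> al x -> par x = 0 ->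
  heap_inv h (set_at al x false) (unroot par x).
Proof.
move=> H ax px; have x0 := al_neq0 H ax.
split; try by case: H.
- by move=> y; rewrite /set_at; case: eqP => // _; exact: al_nnodes H _.
- move=> y; rewrite /set_at /unroot; case: eqP => // yx ay.
  by case: (par y =P x) => // pyx py; rewrite (introF eqP pyx); exact: (up H ay py).
- move=> u j; rewrite /set_at /unroot; case: eqP => // ux au jn.
  have [ak pk rk] := down H au jn; rewrite pk (introF eqP ux); split=> //.
  by case: eqP => // kx; move: pk; rewrite kx px => u0; rewrite -u0 in au;
    have := al_neq0 H au.
Qed.

Lemma uniq_kids h al par x : heap_inv h al par -> al x ->
  uniq (mkseq (kid h x) (nkids h x)).
Proof.
move=> H ax; rewrite map_inj_in_uniq ?iota_uniq // => i j.
rewrite !mem_iota !add0n => /andP[_ ii] /andP[_ jj] E.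
have [_ _ ri] := down H ax ii; have [_ _ rj] := down H ax jj.
by have := nkids_rank h x; rewrite E in ri; lia.
Qed.

Lemma roots_remove h al par L tb x : heap_inv h al par ->
  root_list h al par (rcons L x) tb ->
  root_list h (set_at al x false) (unroot par x)
    (L ++ mkseq (kid h x) (nkids h x)) tb.
Proof.
move=> H Hr; have xL : x \in rcons L x by rewrite mem_rcons mem_head.
have sub y : y \in L -> y \in rcons L x by rewrite mem_rcons inE orbC => ->.
have [ax px] := roots_L Hr xL; have x0 := al_neq0 H ax.
have := roots_uniq Hr; rewrite rcons_uniq => /andP[xNL uL].
have kidP y : y \in mkseq (kid h x) (nkids h x) -> al y /\ par y = x.
  case/mapP => j; rewrite mem_iota => /andP[_ jn] ->.
  by have [] := down H ax jn.
split.
- rewrite cat_uniq uL (uniq_kids H ax) andbT /=; apply/hasPn => y /kidP[_ py].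
  apply/negP => /sub /(roots_L Hr) [_ p0]; move: x0; by rewrite -py p0.
- move=> y; rewrite mem_cat /unroot => /orP[yL|/kidP[ay py]].
    have [ay py] := roots_L Hr (sub _ yL).
    rewrite py eq_sym (negbTE x0) set_at_neq //.
    by apply: contraNneq xNL => <-.
  rewrite py eqxx set_at_neq //; apply: contraNneq x0 => yx.
  by rewrite -py yx px.
- move=> i i0; have [ai pi ri fi] := roots_tb Hr i0; split=> //.
    rewrite set_at_neq //; apply: contraNneq (roots_disj Hr xL) => E.
    by rewrite -{1}E ri E.
  by rewrite /unroot pi eq_sym (negbTE x0).
- move=> y; rewrite mem_cat => /orP[yL|/kidP[ay py]].
    exact: roots_disj Hr _ (sub _ yL).
  apply: contraNneq x0 => E; have t0 : tb (rank h y) != 0.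
    by rewrite E (al_neq0 H).
  by have [_ p0 _ _] := roots_tb Hr t0; rewrite -py -E p0.
- move=> y; rewrite /set_at /unroot mem_cat; case: eqP => // yx ay; case: eqP => [py _|pyx p0].
    left; apply/orP; right; have p0 : par y != 0 by rewrite py.
    have [_ _ _ lt ->] := up H ay p0; rewrite py; apply/mapP.
    by exists (rank h x - (rank h y).+1); rewrite // mem_iota -py.
  case: (roots_all Hr ay p0) => [|->]; last by right.
  by rewrite mem_rcons inE => /predU1P[//|->]; left.
Qed.

Definition link h x y := Heap
  (set_at (rank h) x (rank h x).+1) (set_at (kid0 h) x y)
  (set_at (sib h) y (kid0 h x)) (item h) (cur h) (key h) (nnodes h).

Lemma iter_set_at (f : nat -> nat) y v a j :
  (forall i, i < j -> iter i f a != y) -> iter j (set_at f y v) a = iter j f a.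
Proof.
elim: j => //= j IHj Hj; rewrite IHj; last by move=> i ij; apply: Hj; lia.
by rewrite set_at_neq // Hj.
Qed.

Lemma kid_neq h al par u j y : heap_inv h al par -> al u -> par y = 0 ->
  j < nkids h u -> kid h u j != y.
Proof.
move=> H au py jn; have [_ pk _] := down H au jn.
by apply: contraNneq (al_neq0 H au) => E; rewrite -pk E py.
Qed.

Lemma kid_link h al par x y u j : heap_inv h al par ->
  par x = 0 -> par y = 0 -> al u -> u != x ->
  j < nkids h u -> kid (link h x y) u j = kid h u j.
Proof.
move=> H px py au ux jn; rewrite /kid /= set_at_neq // iter_set_at // => i ij.
by apply: (kid_neq H au py); lia.
Qed.

Lemma kid_linkS h al par x y j : heap_inv h al par ->
  par y = 0 -> al x ->
  j <= nkids h x -> kid (link h x y) x j.+1 = kid h x j.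
Proof.
move=> H py ax jn; rewrite /kid iterSr /= !set_at_eq.
by rewrite iter_set_at // => i ij; apply: (kid_neq H ax py); lia.
Qed.

(** The new child gets the highest rank among the children of [x], so it belongs
    at the head of the list. *)
Lemma heap_inv_link h al par x y : heap_inv h al par ->
  al x -> al y -> par x = 0 -> par y = 0 -> x != y -> full h x ->
  rank h x = rank h y -> (key h x <= key h y)%R ->
  heap_inv (link h x y) al (set_at par y x).
Proof.
move=> H ax ay px py xy fx rxy kxy; have x0 := al_neq0 H ax.
have nk u : nkids (link h x y) u = if u == x then (rank h x).+1 else nkids h u.
  rewrite /nkids /full /= /set_at; case: (u =P x) => // ->.
  by move: fx; rewrite /full => ->.
have nx : nkids h x = rank h x by rewrite /nkids fx.
split; try by case: H.
- by rewrite /= set_at_neq 1?eq_sym //; case: H.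
- move=> z az; have [->|zy] := eqVneq z y.
    rewrite set_at_eq /= nk eqxx set_at_eq set_at_neq 1?eq_sym // => _; split=> //.
    + by rewrite -rxy.
    + by lia.
    + by rewrite -rxy subSS subnn /kid /= set_at_eq.
  rewrite set_at_neq // => pz.
  have zx : z != x by apply: contraNneq pz => ->; rewrite px.
  have [ap rp kp lt E] := up H az pz.
  rewrite /= (set_at_neq _ _ zx) nk; case: eqVneq => [Ep|nE].
    rewrite Ep set_at_eq subSS in E *; rewrite Ep nx in lt rp kp *.
    split=> //; [lia|lia|].
    have -> : rank h x - rank h z = (rank h x - (rank h z).+1).+1 by lia.
    by rewrite (kid_linkS H) // nx; lia.
  by rewrite set_at_neq //; split=> //; rewrite (kid_link H).
- move=> u j au; rewrite nk; case: eqP => [->|/eqP ux] jn.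
    case: j jn => [|j] jn.
      rewrite /kid /= !set_at_eq set_at_neq 1?eq_sym //; split=> //.
      by rewrite subSS subn0.
    have [ak pk rk] := down H ax (j := j) ltac:(by rewrite nx).
    have ky : kid h x j != y by apply: kid_neq H ax py _; rewrite nx.
    have kx : kid h x j != x by apply: kid_neq H ax px _; rewrite nx.
    rewrite (kid_linkS H) // ?nx; last lia.
    by rewrite /= set_at_neq // set_at_neq // set_at_eq subSS.
  have [ak pk rk] := down H au jn; rewrite (kid_link H) //=.
  by rewrite !set_at_neq //; exact: kid_neq H au _ jn.
Qed.

Lemma roots_link h al par L tb x y : heap_inv h al par ->
  rank h x = rank h y ->
  root_list h al par (rcons (rcons L x) y) tb ->
  root_list (link h x y) al (set_at par y x) (rcons L x) tb.
Proof.
move=> H rxy Hr.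
have := roots_uniq Hr; rewrite rcons_uniq => /andP[yN uL].
have sub z : z \in rcons L x -> z \in rcons (rcons L x) y.
  by move=> zL; rewrite mem_rcons inE zL orbT.
have xL : x \in rcons L x by rewrite mem_rcons mem_head.
have yL : y \in rcons (rcons L x) y by rewrite mem_rcons mem_head.
have [ax px] := roots_L Hr (sub _ xL).
have x0 := al_neq0 H ax.
have NL z : z \in rcons L x -> z != y by move=> zL; apply: contraNneq yN => <-.
split=> //.
- move=> z zL; rewrite set_at_neq ?NL //; exact: roots_L Hr _ (sub _ zL).
- move=> i i0; have [ai pi ri fi] := roots_tb Hr i0.
  have iy : tb i != y by apply: contraNneq (roots_disj Hr yL) => <-; rewrite ri.
  have ix : tb i != x by apply: contraNneq (roots_disj Hr (sub _ xL)) => <-; rewrite ri.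
  by rewrite /= !set_at_neq.
- move=> z zL /=; rewrite /set_at; case: (z =P x) => [->|_]; last exact: roots_disj Hr _ (sub _ zL).
  apply/eqP => E; have : tb (rank h x).+1 != 0 by rewrite E.
  by move=> /(roots_tb Hr) [_ _]; rewrite E; lia.
- move=> z az; rewrite {1}/set_at; case: eqP => [_ xz|zy pz]; first by rewrite xz in x0.
  case: (roots_all Hr az pz) => [|E].
    by rewrite mem_rcons inE => /predU1P[//|]; left.
  rewrite /= /set_at; case: (z =P x) => [->|_]; last by right.
  by left.
Qed.

(** A new node for the item [v].  It inherits from the current node [c] of [v] the
    children beyond the first two.  If [v] has no node, then [c] is 0, whose rank
    is 0, and the new node has no children since subtraction is truncated. *)
Definition insert h v k := let x := (nnodes h).+1 in let c := cur h v in Heap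
  (set_at (rank h) x (rank h c - 2))
  (set_at (kid0 h) x (sib h (sib h (kid0 h c)))) (sib h)
  (set_at (item h) x v) (set_at (cur h) v x) (set_at (key h) x k) x.

(** The parents after an insertion. *)
Definition steal h al par v : nat -> nat := fun y =>
  if y == (nnodes h).+1 then 0
  else if [&& al y, par y == cur h v, cur h v != 0 & rank h y + 2 < rank h (cur h v)]
  then (nnodes h).+1 else par y.

(** The inherited children have larger keys than the superseded node, hence than
    the new one, and the ranks below q-2 are exactly what a node of rank q-2
    requires. *)
Lemma heap_inv_insert h al par v k : heap_inv h al par ->
  (cur h v != 0 -> al (cur h v) /\ (k <= key h (cur h v))%R) ->
  heap_inv (insert h v k) (set_at al (nnodes h).+1 true) (steal h al par v).
Proof.
move=> H Hc; set x := (nnodes h).+1; set c := cur h v in Hc *.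
have old y : al y -> y != x by move=> /(al_nnodes H); rewrite /x; lia.
have cx : c != x by have := cur_nnodes H v; rewrite -/c /x; lia.
have nx : nkids (insert h v k) x = rank h c - 2.
  by rewrite /nkids /full /= -/x !set_at_eq eqxx.
have nu u : al u -> nkids (insert h v k) u = if u == c then minn (rank h c) 2 else nkids h u.
  move=> au; rewrite /nkids /full /= -/x !(set_at_neq _ _ (old _ au)) /set_at.
  have [Ei|Ei] := eqVneq (item h u) v.
    rewrite Ei -/c [x == u]eq_sym (negbTE (old _ au)) [c == u]eq_sym.
    by case: (u =P c) => // ->.
  case: (u =P c) => [uc|//]; have c0 : c != 0 by rewrite -uc; exact: al_neq0 H au.
  by move: Ei; rewrite uc (item_cur H) // eqxx.
have nc : c != 0 -> nkids h c = rank h c.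
  by move=> c0; rewrite /nkids /full (item_cur H c0) eqxx.
have kx j : kid (insert h v k) x j = kid h c j.+2.
  by move=> *; rewrite /kid !iterSr /= -/x -/c set_at_eq.
have ku u j : al u -> kid (insert h v k) u j = kid h u j.
  by move=> au; rewrite /kid /= -/x set_at_neq ?old.
split.
- by rewrite /= -/x set_at_neq //; case: H.
- move=> y; rewrite /set_at /=; case: eqP => [->|_]; first by rewrite /x /=.
  by move=> /(al_nnodes H); lia.
- move=> y; rewrite {1}/set_at /steal -/x -/c; case: eqP => // /eqP yx ay.
  case: ifP => [/and4P[_ /eqP py c0 ry] _|ncond].
    have [ac kc] := Hc c0; have py0 : par y != 0 by rewrite py.
    have [ap rp kp lt E] := up H ay py0.
    rewrite py nc // in ap rp kp lt E.
    rewrite nx kx /= -/x -/c !set_at_eq (set_at_neq _ _ yx) set_at_neq //.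
    split=> //; [lia|exact: le_trans kp|lia|].
    by rewrite {1}E -[RHS]/(kid h c (rank h c - 2 - (rank h y).+1).+2); congr (kid h c _); lia.
  move=> py0; have [ap rp kp lt E] := up H ay py0.
  rewrite nu // ku //= -/x !set_at_neq ?old //; split=> //.
  case: (par y =P c) => // pc; have c0 : c != 0 by rewrite -pc (al_neq0 H).
  rewrite pc in rp lt *; move/negbT: ncond; rewrite ay pc eqxx c0 /= -leqNgt leq_min.
  by move: rp lt; rewrite (nc c0); move: (rank h c) (rank h y) => a b; lia.
- move=> u j; rewrite {1}/set_at; case: eqP => [-> _|/eqP ux au].
    rewrite nx kx => jn; have c0 : c != 0.
      by apply: contraTneq jn => ->; rewrite (rank0 H).
    have [ac kc] := Hc c0.
    have jn' : j.+2 < nkids h c by rewrite nc //; lia.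
    have [ak pk rk] := down H ac jn'.
    move: (kid h c j.+2) ak pk rk (old _ ak) => z az pz rz zx.
    rewrite /= -/x -/c !set_at_eq !(set_at_neq _ _ zx) /steal -/x -/c.
    rewrite (negbTE zx) az pz eqxx c0 rz /= ifT; last lia.
    by split=> //; lia.
  rewrite nu // ku // => jn.
  have jn' : j < nkids h u.
    move: jn; case: eqP => [uc|//]; rewrite leq_min uc nc; first by case/andP.
    by rewrite -uc (al_neq0 H).
  have [ak pk rk] := down H au jn'; have kx' := old _ ak.
  rewrite /= -/x !set_at_neq //; split=> //.
  rewrite /steal -/x (negbTE kx') ak pk /=; case: ifP => // /and3P[/eqP uc c0 rc].
  by move: jn; rewrite uc eqxx leq_min; move: rc; rewrite -uc; lia.
- move=> w; rewrite /= /set_at; case: eqP => // _; have := cur_nnodes H w; lia.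
- move=> w; rewrite /= -/x /set_at; case: (w =P v) => [->|_] w0; first by rewrite eqxx.
  case: eqP => [E|_]; last exact: (item_cur H).
  by have := cur_nnodes H w; rewrite E /x; lia.
Qed.

Lemma roots_insert h al par v k L tb : heap_inv h al par ->
  root_list h al par L tb -> (cur h v != 0 -> tb (rank h (cur h v)) != cur h v) ->
  root_list (insert h v k) (set_at al (nnodes h).+1 true) (steal h al par v)
    (rcons L (nnodes h).+1) tb.
Proof.
move=> H Hr Hc; set x := (nnodes h).+1; set c := cur h v in Hc *.
have old y : al y -> y != x by move=> /(al_nnodes H); rewrite /x; lia.
have oldp y : al y -> par y = 0 -> steal h al par v y = 0.
  move=> ay py; rewrite /steal -/x (negbTE (old _ ay)) py; case: ifP => //.
  by case/and4P => _ /eqP <-.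
have oldL y : y \in L -> y != x by move=> /(roots_L Hr) [/old].
split.
- rewrite rcons_uniq (roots_uniq Hr) andbT; apply/negP => /oldL; by rewrite eqxx.
- move=> y; rewrite mem_rcons inE => /predU1P[->|yL].
    by rewrite set_at_eq /steal eqxx.
  by have [ay py] := roots_L Hr yL; rewrite set_at_neq ?old // oldp.
- move=> i i0; have [ai pi ri fi] := roots_tb Hr i0.
  rewrite /full /= -/x !(set_at_neq _ _ (old _ ai)) (oldp _ ai pi); split=> //; rewrite set_at_neq //.
  apply: contraTneq fi => Ei; rewrite /full Ei; apply/negP => /eqP Ec.
  by have := Hc; rewrite /c Ec ri eqxx i0 => /(_ isT).
- move=> y; rewrite mem_rcons inE /= -/x => /predU1P[->|yL].
    rewrite set_at_eq; apply/eqP => E.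
    have t0 : tb (rank h c - 2) != 0 by rewrite E.
    by have [/old] := roots_tb Hr t0; rewrite E eqxx.
  by rewrite set_at_neq ?oldL //; exact: roots_disj Hr _ yL.
- move=> y; rewrite {1}/set_at mem_rcons inE /=; case: eqP => [-> //|/eqP yx] /=; first by left.
  move=> ay; rewrite set_at_neq // /steal -/x (negbTE yx).
  by case: ifP => // _ py; exact: (roots_all Hr ay py).
Qed.

End HollowHeap.

(** * Shortest paths from a new node *)

Section Potentials.
Context {R : realType} (m : nat) (row col : nat -> nat).
Implicit Types (v u : nat) (wt D E : nat -> R) (W vis al : nat -> bool) (h : @heap R).

Inductive walk wt W x : nat -> R -> Prop :=
| walk_nil : W x -> walk wt W x x 0
| walk_arc y l e : walk wt W x y l -> (e < m)%N -> row e = y -> W (col e) ->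
    walk wt W x (col e) (l + wt e).

Definition no_neg_cycle wt W := forall x l, walk wt W x x l -> 0 <= l.

Definition feasible wt W D := forall e, (e < m)%N -> W (row e) -> W (col e) ->
  D (col e) <= D (row e) + wt e.

Lemma walk_sub wt (W W' : nat -> bool) x y l : (forall z, W z -> W' z) ->
  walk wt W x y l -> walk wt W' x y l.
Proof.
move=> sW; elim=> {y l} [Wx|y l e _ IH em re We]; first by apply: walk_nil; exact: sW.
by apply: walk_arc IH em re _; exact: sW.
Qed.

(** The potential [D] is feasible except on the arcs leaving the new node [v], and
    [E] is [D] lowered so far.  [vis] is the set of visited nodes, [u] the last one
    and [rem] its arcs that have not been relaxed.  The key of a node [x] is
    E x - D x: it is the distance in reduced lengths, shifted so that only nodes
    with a negative key have to be visited. *)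
Record dijkstra_inv wt W v D vis u (rem : seq nat) E h al : Prop := DijkstraInv {
  dj_src : vis v /\ E v = D v;
  dj_vis : forall x, vis x -> W x;
  dj_le : forall x, W x -> E x <= D x;
  dj_walk : forall x, W x -> vis x \/ E x < D x ->
    exists l, walk wt W v x l /\ E x = D v + l;
  dj_scan : forall e, (e < m)%N -> vis (row e) -> W (col e) -> e \notin rem ->
    E (col e) <= E (row e) + wt e;
  dj_mono : forall x y, vis x -> x != v -> W y -> ~~ vis y -> E y < D y ->
    E x - D x <= E y - D y;
  dj_last : forall x, vis x -> x != v -> u != v /\ E x - D x <= E u - D u;
  dj_rem : forall e, e \in rem -> [/\ (e < m)%N, row e = u & vis u];
  dj_queue : forall y, W y -> ~~ vis y ->
    if E y < D y then al (cur h y) /\ key h (cur h y) = E y - D y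
    else cur h y = 0%N;
  dj_alive : forall x, al x -> full h x -> W (item h x) /\ ~~ vis (item h x) }.

Lemma dijkstra_skip wt W v D vis u e rem E h al :
  dijkstra_inv wt W v D vis u (e :: rem) E h al ->
  (W (col e) -> E (col e) <= E u + wt e) ->
  dijkstra_inv wt W v D vis u rem E h al.
Proof.
move=> H He; have [em re vu] := dj_rem H (mem_head _ _).
split; try by case: H.
- move=> f fm vf + fr; have [->|fe] := eqVneq f e; first by rewrite re.
  move=> Wf.
  by apply: (dj_scan H) => //; rewrite inE negb_or fe.
- by move=> f fr; apply: (dj_rem H); rewrite inE fr orbT.
Qed.

(** A relaxation that lowers E at [j] concerns an unvisited node other than [v].
    For [j] = [v] it would close a negative circuit; for a visited node, the key of
    [j] is at most the key of [u], and the reduced length of the arc is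
    nonnegative. *)
Lemma dijkstra_relax wt W v D vis u e rem E h al (j := col e) (c := E u + wt e) :
  (forall f, (f < m)%N -> W (row f) -> W (col f) -> row f != v ->
     D (col f) <= D (row f) + wt f) ->
  no_neg_cycle wt W -> (forall w, cur h w <= nnodes h)%N ->
  (forall x, al x -> x <= nnodes h)%N ->
  dijkstra_inv wt W v D vis u (e :: rem) E h al -> W j -> c < E j ->
  (cur h j != 0%N -> al (cur h j) /\ c - D j <= key h (cur h j)) /\
  dijkstra_inv wt W v D vis u rem (set_at E j c) (insert h j (c - D j))
    (set_at al (nnodes h).+1 true).
Proof.
move=> HD HN cl all H Wj cE; have [em re vu] := dj_rem H (mem_head _ _).
have [vv Ev] := dj_src H; have Wu := dj_vis H vu.
have [l [wl El]] := dj_walk H Wu (or_introl vu).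
have jv : j != v.
  apply/eqP => jv; have wj := walk_arc wl em re Wj; rewrite -/j jv in wj.
  by have := HN _ _ wj; move: cE; rewrite /c jv Ev El; lra.
have Dj : u != v -> D j <= D u + wt e.
  by move=> uv; rewrite -re; apply: HD => //; rewrite re.
have nvj : ~~ vis j.
  apply/negP => vj; have [uv le] := dj_last H vj jv.
  by have := Dj uv; move: cE; rewrite /c; lra.
have vj x : vis x -> x != j by apply: contraTneq => ->.
have cD : c < D j by apply: lt_le_trans cE (dj_le H Wj).
have xal x : al x -> x != (nnodes h).+1.
  by move=> /all xl; apply/eqP => E1; rewrite E1 ltnn in xl.
split.
  move=> c0; have := dj_queue H Wj nvj; case: ifP => [_ [ac ->]|_ E0]; last by rewrite E0 in c0.
  by split=> //; lra.
split.
- by split=> //; rewrite set_at_neq // eq_sym.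
- exact: dj_vis H.
- by move=> x Wx; rewrite /set_at; case: (x =P j) => [->|_]; [exact: ltW|exact: (dj_le H)].
- move=> x Wx; rewrite /set_at; case: (x =P j) => [->|_]; last exact: (dj_walk H).
  move=> _; exists (l + wt e); split; first exact: walk_arc wl em re Wj.
  by rewrite /c El addrA.
- move=> f fm vf Wf fr; rewrite (set_at_neq _ _ (vj _ vf)).
  have [fe|fe] := eqVneq f e; first by rewrite fe set_at_eq re.
  have := dj_scan H fm vf Wf; rewrite inE negb_or fe fr => /(_ isT) le.
  by rewrite /set_at; case: (col f =P j) => // E1; rewrite E1 in le; apply: le_trans le; exact: ltW.
- move=> x y vx xv Wy vy; rewrite (set_at_neq _ _ (vj _ vx)) /set_at.
  case: (y =P j) => [-> _|_]; last exact: (dj_mono H).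
  by have [uv le] := dj_last H vx xv; have := Dj uv; rewrite /c; lra.
- move=> x vx xv; rewrite (set_at_neq _ _ (vj _ vx)) (set_at_neq _ _ (vj _ vu)).
  exact: (dj_last H).
- by move=> f fr; apply: (dj_rem H); rewrite inE fr orbT.
- move=> y Wy vy; rewrite /= /set_at; case: (y =P j) => [->|_].
    by rewrite cD !eqxx.
  have := dj_queue H Wy vy; case: ifP => // _ [ac kc].
  by rewrite (negbTE (xal _ ac)).
- move=> x; rewrite {1}/set_at; case: (x =P _) => [-> _ _|/eqP xn ax].
    by rewrite /= set_at_eq.
  rewrite /full /= !(set_at_neq _ _ xn) /set_at; case: (item h x =P j) => [_ /eqP E1|_ fx].
    by rewrite E1 eqxx in xn.
  exact: (dj_alive H).
Qed.

(** The algorithm sees the heap only through its full nodes, so reorganizing the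
    forest is harmless. *)
Lemma dijkstra_heap wt W v D vis u rem E h h' al al' :
  cur h' = cur h -> item h' = item h -> key h' = key h ->
  (forall x, full h x -> al' x = al x) -> (forall x, al x -> x != 0%N) ->
  (forall w, cur h w != 0%N -> item h (cur h w) = w) ->
  dijkstra_inv wt W v D vis u rem E h al ->
  dijkstra_inv wt W v D vis u rem E h' al'.
Proof.
move=> Ec Ei Ek Ha al0 ic H; split; try by case: H.
- move=> y Wy vy; rewrite Ec Ek; have := dj_queue H Wy vy; case: ifP => // _ [ac ->].
  by split=> //; rewrite Ha // /full ic // al0.
- by move=> x; rewrite /full Ec Ei => ax fx; apply: (dj_alive H) => //; rewrite -Ha.
Qed.

(** The least key is not below the keys visited before, which keeps the visited
    keys below the others. *)
Lemma dijkstra_extract wt W v D vis u E h al b rem :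
  dijkstra_inv wt W v D vis u [::] E h al ->
  al b -> full h b -> (forall y, al y -> key h b <= key h y) ->
  (forall x, al x -> x != 0%N) ->
  (forall w, cur h w != 0%N -> item h (cur h w) = w) ->
  (forall e, e \in rem <-> (e < m)%N /\ row e = item h b) ->
  ~~ vis (item h b) /\
  dijkstra_inv wt W v D (set_at vis (item h b) true) (item h b) rem E h
    (set_at al b false).
Proof.
move=> H ab fb mb al0 ic Hrem; set x := item h b in Hrem *.
have [Wx nvx] := dj_alive H ab fb; rewrite -/x in Wx nvx; split=> //.
have [vv Ev] := dj_src H.
have cx : cur h x = b by apply/eqP.
have [Ex kb] : E x < D x /\ key h b = E x - D x.
  have := dj_queue H Wx nvx; rewrite cx; case: ifP => // [_ [_ ->] //|_ b0].
  by have := al0 _ ab; rewrite b0.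
have xv : x != v by apply: contraNneq nvx => ->.
split.
- by rewrite set_at_neq 1?eq_sym.
- by move=> y; rewrite /set_at; case: (y =P x) => [-> //|_]; exact: (dj_vis H).
- exact: (dj_le H).
- move=> y Wy; rewrite /set_at; case: (y =P x) => [->|_]; last exact: (dj_walk H).
  by move=> _; apply: (dj_walk H) => //; right.
- move=> e em; rewrite /set_at; case: (row e =P x) => [re _ _|_ ve We _].
    by case/negP; apply/Hrem.
  exact: (dj_scan H).
- move=> z y; rewrite /set_at; case: (y =P x) => // /eqP yx vz zv Wy vy Ey.
  move: vz; case: (z =P x) => [-> _|_ vz]; last exact: (dj_mono H).
  have := dj_queue H Wy vy; rewrite Ey => -[ac kc].
  by rewrite -kb -kc; exact: mb.
- move=> z; rewrite /set_at; case: (z =P x) => [->|_ vz zv] //; split=> //.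
  exact: (dj_mono H).
- by move=> e /Hrem [em re]; split=> //; rewrite set_at_eq.
- move=> y Wy; rewrite {1}/set_at; case: (y =P x) => // /eqP yx vy.
  have := dj_queue H Wy vy; case: ifP => // _ [ac kc]; split=> //.
  rewrite set_at_neq //; apply: contraNneq yx => E1.
  by rewrite -(ic y) ?E1 //; exact: al0.
- move=> y; rewrite {1}/set_at; case: (y =P b) => // /eqP yb ay fy.
  have [Wy vy] := dj_alive H ay fy; split=> //; rewrite set_at_neq //.
  by apply: contraNneq yb => E1; move: fy; rewrite /full E1 cx eq_sym.
Qed.

(** Nodes never visited have kept their value, while the values at the heads of
    their arcs have only decreased. *)
Lemma dijkstra_final wt W v D vis u E h al :
  (forall f, (f < m)%N -> W (row f) -> W (col f) -> row f != v ->
     D (col f) <= D (row f) + wt f) ->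
  dijkstra_inv wt W v D vis u [::] E h al -> (forall x, ~~ al x) ->
  feasible wt W E.
Proof.
move=> HD H nal e em Wr Wc; case vr: (vis (row e)); first exact: (dj_scan H).
have := dj_queue H Wr (negbT vr); case: ltP => [_ [ac _]|le _].
  by case/negP: (nal (cur h (row e))).
apply: le_trans (dj_le H Wc) _; apply: le_trans (HD _ em Wr Wc _) _.
  by apply: contraFneq vr => ->; case: (dj_src H).
by rewrite lerD2r.
Qed.

Lemma dijkstra_init wt W v D E h rem :
  W v -> (forall x, W x -> E x = D x) -> (forall x, W x -> cur h x = 0%N) ->
  (forall e, e \in rem <-> (e < m)%N /\ row e = v) ->
  dijkstra_inv wt W v D (pred1 v) v rem E h xpred0.
Proof.
move=> Wv ED c0 Hrem; split=> //=.
- by rewrite eqxx ED.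
- by move=> x /eqP ->.
- by move=> x /ED ->.
- move=> x Wx [/eqP ->|]; last by rewrite ED // ltxx.
  by exists 0; split; [exact: walk_nil|rewrite ED // addr0].
- by move=> e em /eqP re _ /negP[]; apply/Hrem.
- by move=> x y /eqP ->; rewrite eqxx.
- by move=> x /eqP ->; rewrite eqxx.
- by move=> e /Hrem [em re]; split.
- by move=> y Wy _; rewrite ED // ltxx c0.
Qed.

End Potentials.

(** * The program *)

(* Arrays of the machine; a scalar variable (x...) is cell 0 of its array.
   Inputs and outputs (aRow to oEnd, rVal to oVal) are numbered as in the
   specification.  Arcs leaving a node form a linked list: aHead, aNext, in
   which e + 1 stands for the arc e and 0 ends the list.  aIn flags the nodes
   added so far.  Heap nodes are numbered from 1, and 0 means none: rank, first
   child, next sibling, vertex, and for each vertex its current heap node.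
   aTodo is a stack of heap roots of height xT, aTab holds at most one root of
   each rank, at most xMax being in use.  rD is the committed potential, rE the
   potential being lowered, rKey the keys of the heap nodes. *)
Local Notation aRow := 1%N (only parsing).
Local Notation aCol := 2%N (only parsing).
Local Notation aPart := 3%N (only parsing).
Local Notation oRow := 4%N (only parsing).
Local Notation oCol := 5%N (only parsing).
Local Notation oBeg := 6%N (only parsing).
Local Notation oEnd := 7%N (only parsing).
Local Notation aHead := 8%N (only parsing).
Local Notation aNext := 9%N (only parsing).
Local Notation aIn := 10%N (only parsing).
Local Notation aRank := 11%N (only parsing).
Local Notation aKid := 12%N (only parsing).
Local Notation aSib := 13%N (only parsing).
Local Notation aItem := 14%N (only parsing).
Local Notation aCur := 15%N (only parsing).
Local Notation aTodo := 16%N (only parsing).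
Local Notation aTab := 17%N (only parsing).
Local Notation xN := 18%N (only parsing).
Local Notation xT := 19%N (only parsing).
Local Notation xMax := 20%N (only parsing).
Local Notation xS := 21%N (only parsing).
Local Notation xBase := 22%N (only parsing).
Local Notation xV := 23%N (only parsing).
Local Notation xE := 24%N (only parsing).
Local Notation xQ := 25%N (only parsing).
Local Notation xU := 26%N (only parsing).
Local Notation xJ := 27%N (only parsing).
Local Notation xI := 28%N (only parsing).
Local Notation xX := 29%N (only parsing).
Local Notation xY := 30%N (only parsing).
Local Notation xC := 31%N (only parsing).

Local Notation rVal := 0%N (only parsing).
Local Notation rLam := 1%N (only parsing).
Local Notation oVec := 2%N (only parsing).
Local Notation oVal := 3%N (only parsing).
Local Notation rD := 4%N (only parsing).
Local Notation rE := 5%N (only parsing).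
Local Notation rKey := 6%N (only parsing).

Local Notation "$ a" := (IGet a (IConst 0)) (at level 1, a at level 0).
Local Notation "a ~[ i ]" := (IGet a i) (at level 1, left associativity, i at level 200).
Local Notation "a ;; b" := (Seq a b) (at level 90, right associativity).
Local Notation "a ::= e" := (ISet a (IConst 0) e) (at level 85).
Local Notation pos e := (BLeI (IConst 1) e).
Local Notation ltI a b := (BNot (BLeI b a)).
Local Notation eqI a b := (BAnd (BLeI a b) (BLeI b a)).
Local Notation suc e := (IAdd e (IConst 1)).
Local Notation prd e := (ISub e (IConst 1)).
Local Notation cN := (IGet 0 (IConst 0)).
Local Notation cM := (IGet 0 (IConst 1)).
Local Notation cR := (IGet 0 (IConst 2)).
Lemma upd_same T (m : nat -> nat -> T) a i v : upd m a i v a = set_at (m a) i v.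
Proof. by apply: boolp.funext => j; rewrite /upd eqxx. Qed.

Local Notation push e := (ISet aTodo $xT e ;; xT ::= suc $xT).

(** A hollow root is replaced by its children; a full root enters the table or is
    linked with the root of the same rank found there. *)
Definition consolidate_body : cmd :=
  xT ::= prd $xT ;; xX ::= aTodo~[$xT] ;;
  If (eqI aCur~[aItem~[$xX]] $xX)
    (xY ::= aTab~[aRank~[$xX]] ;;
     If (pos $xY)
       (ISet aTab aRank~[$xX] (IConst 0) ;;
        If (BLeR (RGet rKey $xX) (RGet rKey $xY)) Skip
          (xI ::= $xX ;; xX ::= $xY ;; xY ::= $xI) ;;
        ISet aSib $xY aKid~[$xX] ;; ISet aKid $xX $xY ;;
        ISet aRank $xX (suc aRank~[$xX]) ;;
        push $xX)
       (ISet aTab aRank~[$xX] $xX ;;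
        If (BLeI $xMax aRank~[$xX]) (xMax ::= aRank~[$xX]) Skip))
    (If (pos aRank~[$xX])
       (push aKid~[$xX] ;;
        If (BLeI (IConst 2) aRank~[$xX]) (push aSib~[aKid~[$xX]]) Skip) Skip).

Definition consolidate : cmd := While (pos $xT) consolidate_body.

(** After [consolidate] all roots are in the table. *)
Definition find_min : cmd :=
  xX ::= IConst 0 ;; xI ::= IConst 0 ;;
  While (BLeI $xI $xMax)
    (xY ::= aTab~[$xI] ;;
     If (pos $xY)
       (If (pos $xX)
          (If (BLeR (RGet rKey $xX) (RGet rKey $xY)) Skip (xX ::= $xY))
          (xX ::= $xY))
       Skip ;;
     xI ::= suc $xI).

Definition pop_min : cmd :=
  If (pos $xX)
    (ISet aTab aRank~[$xX] (IConst 0) ;;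
     xU ::= suc aItem~[$xX] ;;
     xY ::= aKid~[$xX] ;; xI ::= aRank~[$xX] ;;
     While (pos $xI) (push $xY ;; xY ::= aSib~[$xY] ;; xI ::= prd $xI))
    (xU ::= IConst 0).

Local Notation arc_len := (RSub (RGet rLam $xS) (RGet rVal (prd $xE))).

(** A vertex whose value decreases gets a new heap node.  Its previous node, which
    becomes hollow, must first leave the table, reserved for full roots. *)
Definition relax_arc : cmd :=
  xJ ::= aCol~[prd $xE] ;;
  If (pos aIn~[$xJ])
    (If (BLeR (RGet rE $xJ) (RAdd (RGet rE (prd $xU)) arc_len)) Skip
       (RSet rE $xJ (RAdd (RGet rE (prd $xU)) arc_len) ;;
        xC ::= aCur~[$xJ] ;;
        If (BAnd (pos $xC) (eqI aTab~[aRank~[$xC]] $xC))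
          (ISet aTab aRank~[$xC] (IConst 0) ;; push $xC) Skip ;;
        xN ::= suc $xN ;;
        ISet aRank $xN (ISub aRank~[$xC] (IConst 2)) ;;
        ISet aKid $xN aSib~[aSib~[aKid~[$xC]]] ;;
        ISet aItem $xN $xJ ;;
        ISet aCur $xJ $xN ;;
        RSet rKey $xN (RSub (RGet rE $xJ) (RGet rD $xJ)) ;;
        push $xN))
    Skip ;;
  xE ::= aNext~[prd $xE].

Definition scan_arcs : cmd :=
  xE ::= aHead~[prd $xU] ;; While (pos $xE) relax_arc.

Definition dijkstra_step : cmd := scan_arcs ;; consolidate ;; find_min ;; pop_min.

Definition dijkstra : cmd := While (pos $xU) dijkstra_step.

Definition in_arcs_body : cmd :=
  If (BAnd (eqI aCol~[$xE] $xV) (pos aIn~[aRow~[$xE]]))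
    (If (BLeR (RGet rD $xV)
           (RAdd (RGet rD aRow~[$xE]) (RSub (RGet rLam $xS) (RGet rVal $xE)))) Skip
       (RSet rD $xV
          (RAdd (RGet rD aRow~[$xE]) (RSub (RGet rLam $xS) (RGet rVal $xE)))))
    Skip ;;
  xE ::= suc $xE.

(** The value of the new node [xV] is bounded by its incoming arcs, and by 0 in
    order to need no case distinction. *)
Definition in_arcs : cmd :=
  ISet aIn $xV (IConst 1) ;; RSet rD $xV RZero ;; xE ::= IConst 0 ;;
  While (ltI $xE cM) in_arcs_body.

Definition commit : cmd :=
  xI ::= IConst 0 ;;
  While (ltI $xI cN)
    (RSet rD $xI (RGet rE $xI) ;; ISet aCur $xI (IConst 0) ;; xI ::= suc $xI).

Definition add_node : cmd :=
  in_arcs ;;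
  RSet rE $xV (RGet rD $xV) ;; xN ::= IConst 0 ;; xU ::= suc $xV ;;
  dijkstra ;; commit.

Definition output_vector : cmd :=
  xI ::= IConst 0 ;;
  While (ltI $xI cN)
    (RSet oVec (IAdd $xBase $xI) (RGet rD $xI) ;; xI ::= suc $xI).

Definition output_body : cmd :=
  If (BAnd (BLeI $xS aPart~[aRow~[$xE]]) (BLeI $xS aPart~[aCol~[$xE]]))
    (ISet oRow $xQ aRow~[$xE] ;; ISet oCol $xQ aCol~[$xE] ;;
     RSet oVal $xQ (RSub (RAdd (RSub (RGet rVal $xE) (RGet rLam $xS))
                           (RGet rD aCol~[$xE])) (RGet rD aRow~[$xE])) ;;
     xQ ::= suc $xQ)
    Skip ;;
  xE ::= suc $xE.

Definition output_matrix : cmd :=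
  ISet oBeg $xS $xQ ;; xE ::= IConst 0 ;;
  While (ltI $xE cM) output_body ;;
  ISet oEnd $xS $xQ.

Definition add_part : cmd :=
  xV ::= IConst 0 ;;
  While (ltI $xV cN)
    (If (eqI aPart~[$xV] $xS) add_node Skip ;; xV ::= suc $xV).

Definition stage : cmd :=
  xS ::= prd $xS ;; xBase ::= ISub $xBase cN ;;
  add_part ;; output_vector ;; output_matrix.

Definition adjacency : cmd :=
  xE ::= IConst 0 ;;
  While (ltI $xE cM)
    (ISet aNext $xE aHead~[aRow~[$xE]] ;; ISet aHead aRow~[$xE] (suc $xE) ;;
     xE ::= suc $xE).

(** Stage s writes its vector at s * n; multiplication of integers being
    unavailable, the offset is maintained by additions. *)
Definition total_size : cmd :=
  xI ::= IConst 0 ;;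
  While (ltI $xI cR) (xBase ::= IAdd $xBase cN ;; xI ::= suc $xI).

Definition visualize : cmd :=
  adjacency ;; total_size ;; xS ::= cR ;; While (pos $xS) stage.

Ltac mem_simp :=
  cbn [imem rmem ieval reval beval];
  repeat match goal with |- context [upd ?m ?a ?i ?v ?b] =>
    first [rewrite (@upd_other _ m a i v b isT) | rewrite (@upd_same _ m a i v)]
  end;
  rewrite ?set_at_eq.

Ltac wp_assign :=
  match goal with
  | |- wp (ISet _ _ _) _ _ (_ - _) => apply: wp_iset_sub
  | |- wp (ISet _ _ _) _ _ _ => apply: wp_iset
  | |- wp (RSet _ _ _) _ _ (_ - _) => apply: wp_rset_sub
  | |- wp (RSet _ _ _) _ _ _ => apply: wp_rset
  end; [done | lia | mem_simp].

Ltac wp_run := repeat first [apply: wp_seq | wp_assign].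

Ltac wp_nop := first [apply: wp_skip_sub | apply: wp_skip]; [lia | idtac].

Ltac wp_test H :=
  wp_run; first [apply: wp_if_sub | apply: wp_if];
  [done | lia | mem_simp; move=> H | mem_simp; move=> H].

Ltac gen_sums :=
  repeat match goal with |- context [bigop ?a ?b ?c] => move: (bigop a b c) => ? end.

(** * Consolidation of the heap *)

Section HeapProgram.
Local Open Scope nat_scope.
Context {R : realType} (mm K : nat).
Context (HK : forall r, 2 ^ r./2 <= mm -> r <= K).
Implicit Type (st : store R) (al : nat -> bool) (par : nat -> nat).

Definition heap_of st : heap :=
  Heap (imem st aRank) (imem st aKid) (imem st aSib) (imem st aItem) (imem st aCur)
    (rmem st rKey) (imem st xN 0).

Definition todo st := mkseq (imem st aTodo) (imem st xT 0).

Record heap_state st al par : Prop := HeapState {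
  hs_inv : heap_inv (heap_of st) al par;
  hs_roots : root_list (heap_of st) al par (todo st) (imem st aTab);
  hs_nodes : imem st xN 0 <= mm;
  hs_tab : forall i, imem st aTab i != 0 -> i <= imem st xMax 0;
  hs_max : imem st xMax 0 <= K }.

(** Two units for each root of the stack, one for each root of the table and three
    for each node: storing a root in the table, linking two roots and replacing a
    hollow root by at most two children all lower this sum. *)
Definition heap_potential st al := 2 * imem st xT 0 + \sum_(i < K.+1) (imem st aTab i != 0)
  + 3 * \sum_(x < mm.+1) al x.

Lemma rank_K st al par x : heap_state st al par -> al x -> imem st aRank x <= K.
Proof.
move=> H ax; apply: HK; apply: leq_trans (hs_nodes H).
exact: (rank_size (hs_inv H) ax).
Qed.

Lemma alive_bound st al par x : heap_state st al par -> al x -> x < mm.+1.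
Proof. by move=> H /(al_nnodes (hs_inv H)) /= ; have := hs_nodes H; lia. Qed.

(** An iteration takes at most 20 steps and lowers the potential, which therefore
    pays for the loop. *)
Lemma wp_consolidate st0 al0 par0 Q k :
  heap_state st0 al0 par0 -> 20 * heap_potential st0 al0 + 1 <= k ->
  (forall st al par k', frame consolidate st0 st -> heap_state st al par ->
    (forall x, full (heap_of st0) x -> al x = al0 x) -> imem st xT 0 = 0 ->
    20 * heap_potential st al + (k - (20 * heap_potential st0 al0 + 1)) <= k' -> Q st k') ->
  wp consolidate Q st0 k.
Proof.
move=> H0 k0 HQ; pose rest := k - (20 * heap_potential st0 al0 + 1).
apply: (@wp_while _ (fun st k' => exists al par, [/\ heap_state st al par,
    (forall x, full (heap_of st0) x -> al x = al0 x) &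
    20 * heap_potential st al + 1 + rest <= k'])) => //.
- by exists al0, par0; split=> //; rewrite /rest; lia.
- move=> st k1 fr [al [par [H Hal kk]]]; mem_simp => T0; split; first lia.
  have Hfull x : full (heap_of st) x = full (heap_of st0) x.
    by rewrite /full /= !(proj1 fr).
  have [T ET] : exists T, imem st xT 0 = T.+1 by exists (imem st xT 0).-1; lia.
  have Er : todo st = rcons (mkseq (imem st aTodo) T) (imem st aTodo T).
    by rewrite /todo ET mkseqS.
  have Hphi : heap_potential st al = 2 * T.+1 + \sum_(i < K.+1) (imem st aTab i != 0)
      + 3 * \sum_(x < mm.+1) al x by rewrite /heap_potential ET.
  have [Hi Hr Hn Ht Hm] := H; rewrite Er in Hr.
  set x := imem st aTodo T in Er Hr.
  have xL : x \in rcons (mkseq (imem st aTodo) T) x by rewrite mem_rcons mem_head.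
  have [ax px] := roots_L Hr xL; have x0 := al_neq0 Hi ax.
  have xK := rank_K H ax; have xm := alive_bound H ax.

  have ET1 : T.+1 - 1 = T by lia.
  have sumT i v : i <= K -> \sum_(j < K.+1) (set_at (imem st aTab) i v j != 0) +
      (imem st aTab i != 0) = \sum_(j < K.+1) (imem st aTab j != 0) + (v != 0).
    by move=> iK; rewrite (sum_set_at (fun _ y => y != 0 : nat)).
  rewrite /consolidate_body; wp_run; rewrite ET ET1 -/x.
  wp_test fx.
    (* A full root: it is stored in the table, or linked if its slot is taken. *)
    have {}fx : full (heap_of st) x by rewrite /full eqn_leq.
    wp_run; wp_test ty.
      set y := imem st aTab (imem st aRank x) in ty *.
      have {}ty : imem st aTab (rank (heap_of st) x) != 0 by rewrite -lt0n.
      have Hr' := roots_take Hi ty Hr; rewrite -[imem st aTab _]/y in Hr'.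
      have yL : y \in rcons (rcons (mkseq (imem st aTodo) T) x) y.
        by rewrite mem_rcons mem_head.
      have [ay py] := roots_L Hr' yL.
      have [_ _ ry fy] := roots_tb Hr ty.
      rewrite -[imem st aTab _]/y in ry fy.
      have xy : x != y by apply: contraNneq (roots_disj Hr xL) => ->; rewrite ry.
      have tab1 : \sum_(j < K.+1) (set_at (imem st aTab) (imem st aRank x) 0 j != 0) + 1 =
          \sum_(j < K.+1) (imem st aTab j != 0).
        by have := sumT (imem st aRank x) 0 xK; rewrite (ty : _ = true) addn0.
      have finish a b st' k' : (a == x) && (b == y) || (a == y) && (b == x) ->
          (key (heap_of st) a <= key (heap_of st) b)%R -> 
          heap_of st' = link (heap_of st) a b ->
          todo st' = rcons (mkseq (imem st aTodo) T) a ->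
          imem st' xT 0 = T.+1 ->
          imem st' aTab = set_at (imem st aTab) (imem st aRank x) 0 ->
          imem st' xN 0 = imem st xN 0 ->
          imem st' xMax = imem st xMax -> k1 <= k' + 16 ->
          exists al' par', [/\ heap_state st' al' par',
            forall z, full (heap_of st0) z -> al' z = al0 z &
            20 * heap_potential st' al' + 1 + rest <= k'].
        move=> ab kab Eh Et ETt Etab EN EM k16.
        have [fa aa ab' [pa pb] [rab anb]] : [/\ full (heap_of st) a, al a, al b,
            par a = 0 /\ par b = 0 & rank (heap_of st) a = rank (heap_of st) b /\ a != b].
          by case/orP: ab => /andP[/eqP -> /eqP ->]; split=> //; split=> //; rewrite eq_sym.
        have Hab : root_list (heap_of st) al par
            (rcons (rcons (mkseq (imem st aTodo) T) a) b)
            (set_at (imem st aTab) (imem st aRank x) 0).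
          apply: roots_perm Hr'; case/orP: ab => /andP[/eqP -> /eqP ->] //.
          by rewrite -!cats1 -!catA perm_cat2l /= (perm_catC [:: x] [:: y]).
        exists al, (set_at par b a); split=> //.
          split.
          - by rewrite Eh; apply: heap_inv_link.
          - by rewrite Eh Et Etab; apply: roots_link.
          - by rewrite EN.
          - move=> i; rewrite Etab EM /set_at; case: (i =P _) => // _; exact: Ht.
          - by rewrite EM.
        by rewrite /heap_potential ETt Etab; move: Hphi kk k16 tab1; clear; gen_sums; lia.
      clear sumT Er xL ax Hr' yL Hfull tab1; wp_test kxy.
        wp_nop.
        wp_run; apply: (finish x y); rewrite ?eqxx /heap_of /todo; mem_simp => //;
          rewrite ?addn1 ?mkseq_set_at //; lia.
      wp_run; apply: (finish y x); rewrite ?eqxx ?orbT /heap_of /todo; mem_simp => //;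
        rewrite ?addn1 ?mkseq_set_at //; last lia.
      by apply: ltW; rewrite ltNge.
    have {}ty : imem st aTab (rank (heap_of st) x) = 0.
      by apply/eqP; rewrite -leqn0 leqNgt.
    have Hr' := roots_store Hi fx ty Hr.
    have st0' := sumT (imem st aRank x) x xK.
    have t1 : (imem st aTab (imem st aRank x) != 0) = false by apply/eqP.
    have finish st' k' : heap_of st' = heap_of st ->
        todo st' = mkseq (imem st aTodo) T -> imem st' xT 0 = T ->
        imem st' aTab = set_at (imem st aTab) (imem st aRank x) x ->
        imem st' xN 0 = imem st xN 0 ->
        imem st' xMax 0 = maxn (imem st xMax 0) (imem st aRank x) -> k1 <= k' + 16 ->
        exists al' par', [/\ heap_state st' al' par',
          forall z, full (heap_of st0) z -> al' z = al0 z &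
          20 * heap_potential st' al' + 1 + rest <= k'].
      move=> Eh Et ETt Etab EN EM k16; exists al, par; split=> //.
        split.
        - by rewrite Eh.
        - by rewrite Eh Et Etab.
        - by rewrite EN.
        - move=> i; rewrite Etab EM /set_at; case: (i =P _) => [-> _|_ /Ht]; lia.
        - by rewrite EM; lia.
      rewrite /heap_potential ETt Etab; rewrite t1 x0 in st0'; lia.
    wp_run; wp_test mx.
      wp_run; apply: finish; rewrite /todo /heap_of; mem_simp => //; lia.
    wp_nop.
    apply: finish; rewrite /todo /heap_of; mem_simp => //; lia.
  (* A hollow root: its children, at most two, replace it on the stack. *)
  have {}fx : full (heap_of st) x = false by rewrite /full eqn_leq; apply/negbTE.
  have nk : nkids (heap_of st) x = minn (imem st aRank x) 2 by rewrite /nkids fx.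
  have Hi' := heap_inv_remove Hi ax px; have Hr' := roots_remove Hi Hr.
  have Hs : \sum_(z < mm.+1) set_at al x false z + 1 = \sum_(z < mm.+1) al z.
    have := sum_set_at (fun _ b => nat_of_bool b) al false xm.
    by rewrite ax /= addn0.
  have finish st' k' : heap_of st' = heap_of st ->
      todo st' = mkseq (imem st aTodo) T ++
        mkseq (kid (heap_of st) x) (minn (imem st aRank x) 2) ->
      imem st' xT 0 = T + minn (imem st aRank x) 2 ->
      imem st' aTab = imem st aTab ->
      imem st' xN 0 = imem st xN 0 ->
      imem st' xMax = imem st xMax -> k1 <= k' + 16 ->
      exists al' par', [/\ heap_state st' al' par',
        forall z, full (heap_of st0) z -> al' z = al0 z &
        20 * heap_potential st' al' + 1 + rest <= k'].
    move=> Eh Et ETt Etab EN EM k16; exists (set_at al x false), (unroot par x).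
    split=> //.
    - split; rewrite ?Eh ?Et ?EN ?Etab ?EM //.
      by rewrite -nk.
    - move=> z fz; rewrite set_at_neq ?Hal //; apply: contraFneq fx => <-.
      by rewrite Hfull.
    - by rewrite /heap_potential ETt Etab; lia.
  wp_test r1; last first.
    wp_nop.
    rewrite (_ : minn (imem st aRank x) 2 = 0) in finish; last lia.
    by apply: finish; rewrite /todo /heap_of; mem_simp => //; rewrite ?cats0 //; lia.
  wp_run; rewrite addn1; wp_test r2.
    rewrite (_ : minn (imem st aRank x) 2 = 2) in finish; last lia.
    wp_run; apply: finish; rewrite /todo /heap_of; mem_simp => //; try lia.
    by rewrite !addn1 !mkseq_set_at -!cats1 -catA.
  rewrite (_ : minn (imem st aRank x) 2 = 1) in finish; last lia.
  wp_nop.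
  apply: finish; rewrite /todo /heap_of; mem_simp => //; try lia.
  by rewrite mkseq_set_at -cats1.
- move=> st k1 fr [al [par [H Hal kk]]]; mem_simp => T0; split; first lia.
  apply: (HQ _ al par) => //; rewrite -?/rest; lia.
Qed.

End HeapProgram.

(** * Extraction of a minimum *)

Section ExtractProgram.
Local Open Scope nat_scope.
Context {R : realType} (mm K : nat).
Context (HK : forall r, 2 ^ r./2 <= mm -> r <= K).
Implicit Type (st : store R) (al : nat -> bool) (par : nat -> nat).

(** [x] is a table entry with the least key among the ranks below [i], or 0 if there
    is none. *)
Definition best_below (tab : nat -> nat) (ky : nat -> R) x i := 
  (x != 0 -> exists j, tab j = x) /\
  (forall j, j < i -> tab j != 0 -> x != 0 /\ (ky x <= ky (tab j))%R).

Lemma wp_find_min st0 Q k : 7 * (imem st0 xMax 0) + 10 <= k ->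
  (forall st k', frame find_min st0 st ->
    best_below (imem st0 aTab) (rmem st0 rKey) (imem st xX 0) (imem st0 xMax 0).+1 ->
    k - (7 * imem st0 xMax 0 + 10) <= k' -> Q st k') ->
  wp find_min Q st0 k.
Proof.
move=> k0 HQ; apply: wp_frame; rewrite /find_min; wp_run.
set st1 := Store _ _; pose tab := imem st0 aTab; pose M := imem st0 xMax 0.
pose rest := k - (7 * M + 10).
pose Inv st k' := [/\ imem st xI 0 <= M.+1,
   best_below tab (rmem st0 rKey) (imem st xX 0) (imem st xI 0) &
   7 * (M.+1 - imem st xI 0) + 1 + rest <= k'].
apply: (@wp_while _ Inv) => //.
- by rewrite /Inv /st1; mem_simp; rewrite /rest -/M in k0 *; split=> //; lia.
- move=> st k1 fr [I1 Hb kk].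
  have Et : imem st aTab = tab by rewrite (proj1 fr) // /st1; mem_simp.
  have Em : imem st xMax = imem st0 xMax by rewrite (proj1 fr) // /st1; mem_simp.
  have Ek : rmem st rKey = rmem st0 rKey by rewrite (proj2 fr) // /st1; mem_simp.
  mem_simp; rewrite Em -/M => IM; split; first lia.
  set x := imem st xX 0 in Hb *; set i := imem st xI 0 in I1 Hb IM kk *.
  have [Hx Hj] := Hb.
  have finish st' k' : imem st' xI 0 = i.+1 -> k1 <= k' + 7 ->
      best_below tab (rmem st0 rKey) (imem st' xX 0) i.+1 -> Inv st' k'.
    by rewrite /Inv => -> k7 Hb'; split=> //; lia.
  have step x' : (x' != 0 -> exists j, tab j = x') ->
      (tab i != 0 -> x' != 0 /\ (rmem st0 rKey x' <= rmem st0 rKey (tab i))%R) ->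
      (x != 0 -> x' != 0 /\ (rmem st0 rKey x' <= rmem st0 rKey x)%R) ->
      best_below tab (rmem st0 rKey) x' i.+1.
    move=> H1 H2 H3; split=> // j; rewrite ltnS leq_eqVlt => /predU1P[->//|ji tj].
    have [x0 le1] := Hj _ ji tj; have [x0' le2] := H3 x0.
    by split=> //; exact: le_trans le1.
  wp_test y0.
    rewrite Et -/i in y0; wp_test X0.
      rewrite -/x in X0; wp_test kxy; rewrite Et Ek -/x -/i in kxy.
        wp_nop.
        wp_run; apply: finish; mem_simp; [lia|lia|].
        by apply: step => //; split=> //; rewrite -lt0n.
      wp_run; apply: finish; mem_simp; [lia|lia|rewrite Et -/i].
      apply: step; first by exists i.
        by rewrite -lt0n; split.
      by split; [rewrite -lt0n|apply: ltW; rewrite ltNge].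
    rewrite -/x in X0.
    wp_run; apply: finish; mem_simp; [lia|lia|rewrite Et -/i].
    apply: step; first by exists i.
      by rewrite -lt0n; split.
    by rewrite -lt0n (negbTE X0).
  rewrite Et -/i in y0; wp_nop.
  wp_run; apply: finish; mem_simp; [lia|lia|].
  by apply: step => //; rewrite -lt0n (negbTE y0).
- move=> st k1 fr [I1 Hb kk]; mem_simp.
  have Em : imem st xMax = imem st0 xMax by rewrite (proj1 fr) // /st1; mem_simp.
  rewrite Em -/M => IM; split; first lia.
  move=> fr'; apply: HQ => //; rewrite -/M -/tab; last by rewrite -/rest; lia.
  by have -> : M.+1 = imem st xI 0 by lia.
Qed.

Lemma wp_pop_min st0 al par Q k :
  heap_state mm K st0 al par -> imem st0 xT 0 = 0 ->
  best_below (imem st0 aTab) (rmem st0 rKey) (imem st0 xX 0) (imem st0 xMax 0).+1 ->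
  5 * K + 10 <= k ->
  (forall st k', frame pop_min st0 st -> (forall x, ~~ al x) ->
    heap_state mm K st al par -> imem st xU 0 = 0 -> imem st xT 0 = 0 ->
    heap_potential mm K st al = heap_potential mm K st0 al -> k - (5 * K + 10) <= k' -> Q st k') ->
  (forall st k' b, frame pop_min st0 st -> al b -> full (heap_of st0) b ->
    (forall y, al y -> key (heap_of st0) b <= key (heap_of st0) y)%R ->
    heap_state mm K st (set_at al b false) (unroot par b) ->
    imem st xU 0 = (imem st0 aItem b).+1 ->
    heap_potential mm K st (set_at al b false) <= heap_potential mm K st0 al + 2 * K ->
    k - (5 * K + 10) <= k' -> Q st k') ->
  wp pop_min Q st0 k.
Proof.
move=> H T0 [Hx Hmin] k0 Q0 Q1; apply: wp_frame.
have [Hi Hr Hn Ht Hm] := H.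
have Et : todo st0 = [::] by rewrite /todo T0.
rewrite Et in Hr.
set x := imem st0 xX 0 in Hx Hmin *.
have inTab y : al y -> par y = 0 -> imem st0 aTab (imem st0 aRank y) = y.
  by move=> ay py; have [//|] := roots_all Hr ay py.
have Hmin' y : al y -> x != 0 /\ (rmem st0 rKey x <= rmem st0 rKey y)%R.
  move=> ay; have [z [az pz kz]] := climb Hi ay.
  have Ez := inTab _ az pz; have z0 := al_neq0 Hi az.
  have t0 : imem st0 aTab (imem st0 aRank z) != 0 by rewrite Ez.
  have [|X0 le] := Hmin _ _ t0; first by rewrite ltnS; exact: Ht.
  by split=> //; apply: le_trans le _; rewrite Ez.
rewrite /pop_min; wp_test X0; last first.
  have nal y : ~~ al y.
    by apply/negP => /Hmin' []; rewrite -lt0n (negbTE X0).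
  wp_run => fr; apply: Q0 => //; try (by mem_simp); last lia.
  - split; try by mem_simp.
    by rewrite /todo /heap_of; mem_simp; rewrite -[mkseq _ _]/(todo st0) Et.
rewrite -/x in X0; have x0 : x != 0 by rewrite -lt0n.
have [i0 Ei0] := Hx x0.
have i0n : imem st0 aTab i0 != 0 by rewrite Ei0.
have [] := roots_tb Hr i0n; rewrite Ei0 => ax px rx fx.
have xK := rank_K HK H ax; have xm := alive_bound H ax.
have Er : imem st0 aRank x = i0 by [].
wp_run; set st1 := Store _ _; pose r := imem st0 aRank x.
have Hr1 : root_list (heap_of st0) al par [:: x] (set_at (imem st0 aTab) i0 0).
  by rewrite -Ei0; exact: roots_take Hi i0n Hr.
have Hr2 := roots_remove Hi (Hr1 : root_list _ _ _ (rcons [::] x) _).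
have Hi2 := heap_inv_remove Hi ax px.
have nk : nkids (heap_of st0) x = r by rewrite /nkids fx.
apply: (@wp_while _ (fun st k' => exists j, [/\ j <= r, imem st xI 0 = r - j,
   imem st xY 0 = kid (heap_of st0) x j, todo st = mkseq (kid (heap_of st0) x) j /\
   imem st xT 0 = j & 5 * (r - j) + 1 + (k - (5 * K + 10)) <= k'])) => //.
- exists 0; rewrite /st1 /todo; mem_simp; rewrite -/x T0 subn0 /kid /=.
  by split=> //; rewrite -/r in xK; lia.
- move=> st k1 fr [j [jr Ei Ey [Eto ET] kk]]; mem_simp; rewrite Ei => rj.
  split; first lia.
  have Es : imem st aSib = imem st0 aSib by rewrite (proj1 fr) // /st1; mem_simp.
  wp_run; exists j.+1; rewrite /todo; mem_simp; rewrite Ei Ey Es ET; split.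
  + lia.
  + lia.
  + by [].
  + by rewrite addn1 mkseq_set_at mkseqS; split=> //; rewrite -Eto /todo ET.
  + lia.
- move=> st k1 fr [j [jr Ei Ey [Eto ET] kk]]; mem_simp; rewrite Ei => rj.
  split; first lia.
  have Ej : j = r by lia.
  move=> fr'.
  have Etab : imem st aTab = set_at (imem st0 aTab) i0 0.
    by rewrite (proj1 fr) // /st1; mem_simp; rewrite -/x Er.
  have Eh : heap_of st = heap_of st0.
    by rewrite /heap_of !(proj1 fr) // (proj2 fr) // /st1; mem_simp.
  have EM : imem st xMax = imem st0 xMax by rewrite (proj1 fr) // /st1; mem_simp.
  have EN : imem st xN = imem st0 xN by rewrite (proj1 fr) // /st1; mem_simp.
  apply: (Q1 _ _ x) => //.
  + by move=> y /Hmin' [].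
  + split; rewrite ?Eh ?EN ?EM ?Etab //.
      by rewrite Eto Ej -nk.
    by move=> i; rewrite /set_at; case: (i =P _) => // _; exact: Ht.
  + by rewrite (proj1 fr) // /st1; mem_simp; rewrite -/x addn1.
  + have S1 := sum_set_at (fun _ b => nat_of_bool b) al false xm.
    have S2 := sum_set_at (fun _ y => y != 0 : nat) (imem st0 aTab) 0 (xK : _ < K.+1).
    rewrite /= Er i0n ax in S1 S2; rewrite /heap_potential Etab ET Ej T0 /r.
    move: S1 S2 xK; rewrite (erefl : nat_of_bool true = 1); gen_sums; lia.
  + lia.
Qed.

End ExtractProgram.

(** * The run of Dijkstra's algorithm *)

Section DijkstraProgram.
Local Open Scope nat_scope.
Context {R : realType} (n m K : nat) (row col : nat -> nat).
Context (HK : forall r, 2 ^ r./2 <= m -> r <= K).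
Implicit Type (st : store R) (al vis W : nat -> bool) (par : nat -> nat).
Implicit Types (wt D : nat -> R) (rem : seq nat).

Definition out_arcs w := rev [seq e <- iota 0 m | row e == w].

(** [l] is the list read from the pointer [h]. *)
Fixpoint chain (next : nat -> nat) h l :=
  if l is e :: l' then h = e.+1 /\ chain next (next e) l' else h = 0.

Record env st W wt D : Prop := Env {
  env_col : imem st aCol = col;
  env_in : forall x, (0 < imem st aIn x) = W x;
  env_wt : forall e, (rmem st rLam (imem st xS 0) - rmem st rVal e)%R = wt e;
  env_D : rmem st rD = D;
  env_adj : forall w, w < n -> chain (imem st aNext) (imem st aHead w) (out_arcs w) }.

Definition env_safe c := ~~ has (mem (int_writes c)) [:: aCol; aIn; xS; aNext; aHead]
  && ~~ has (mem (real_writes c)) [:: rLam; rVal; rD].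

Lemma env_frame c st st' W wt D : env_safe c -> frame c st st' ->
  env st W wt D -> env st' W wt D.
Proof.
rewrite /env_safe /= !negb_or => /andP[/andP[w1 /and5P[w2 w3 w4 w5 _]]].
move=> /and4P[v1 v2 v3 _] [Fi Fr] [E1 E2 E3 E4 E5].
by split=> *; rewrite ?Fi ?Fr //; apply: E5.
Qed.

(** Heap nodes are created by relaxations only, each arc being relaxed at most
    once: [ds_cnt] bounds their number by m. *)
Record dij_state W wt D v st vis u rem al par : Prop := DijState {
  ds_heap : heap_state m K st al par;
  ds_dij : dijkstra_inv m row col wt W v D vis u rem (rmem st rE) (heap_of st) al;
  ds_cur : forall w, n <= w -> imem st aCur w = 0;
  ds_cnt : imem st xN 0 + size rem +
             \sum_(w < n) (if vis w then 0 else size (out_arcs w)) <= m }.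

Section Run.
Context (W : nat -> bool) (wt D : nat -> R) (v : nat).
Context (HW : forall w, W w -> w < n).
Context (HD : forall f, f < m -> W (row f) -> W (col f) -> row f != v ->
     (D (col f) <= D (row f) + wt f)%R).
Context (HN : no_neg_cycle m row col wt W).

(** The 180 steps include the growth of the heap potential by at most seven units:
    one node, one root on the stack, and one root moved from the table to the
    stack. *)
Lemma wp_relax st vis u e rem al par Q k :
  env st W wt D -> dij_state W wt D v st vis u (e :: rem) al par ->
  imem st xU 0 = u.+1 -> imem st xE 0 = e.+1 -> 180 + 20 * heap_potential m K st al <= k ->
  (forall st' al' par' k', frame relax_arc st st' ->
     dij_state W wt D v st' vis u rem al' par' -> imem st' xE 0 = imem st aNext e ->
     20 * heap_potential m K st' al' + (k - (180 + 20 * heap_potential m K st al)) <= k' -> Q st' k') ->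
  wp relax_arc Q st k.
Proof.
move=> He Hs Eu Ee k0 HQ; apply: wp_frame.
have [H Hd Hc Hcnt] := Hs; have [Hi Hr Hn Ht Hm] := H.
have [em re vu] := dj_rem Hd (mem_head _ _).
rewrite /= in Hcnt.
pose j := col e; pose E := rmem st rE; pose c := (E u + wt e)%R.
have finish_skip st' k' : (W j -> E j <= c)%R ->
    heap_of st' = heap_of st -> todo st' = todo st -> imem st' aTab = imem st aTab ->
    imem st' xMax = imem st xMax -> imem st' xT = imem st xT ->
    rmem st' rE = E -> imem st' xE 0 = imem st aNext e -> k <= k' + 20 ->
    frame relax_arc st st' -> Q st' k'.
  move=> Hj Eh Et Etb EM ET EE Ex k20 fr; apply: (HQ _ al par) => //; last first.
    have -> : heap_potential m K st' al = heap_potential m K st al by rewrite /heap_potential Etb ET.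
    lia.
  have EN : imem st' xN 0 = imem st xN 0 by rewrite -[LHS]/(nnodes (heap_of st')) Eh.
  split.
  - by split; rewrite ?Eh ?Et ?Etb ?EM ?EN.
  - by rewrite EE Eh; apply: dijkstra_skip Hd _.
  - by move=> w wn; rewrite -[imem st' aCur]/(cur (heap_of st')) Eh; exact: Hc.
  - by rewrite EN; move: Hcnt; gen_sums; lia.
have U1 : u.+1 - 1 = u by lia.
have E1 : e.+1 - 1 = e by lia.
rewrite /relax_arc; wp_run; rewrite Ee E1 (env_col He) -/j; wp_test Wj; last first.
  rewrite (env_in He) in Wj.
  wp_nop.
  wp_run; apply: finish_skip; rewrite /todo /heap_of; mem_simp => //; last lia.
    by rewrite (negbTE Wj).
  by rewrite Ee E1.
rewrite (env_in He) in Wj.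
wp_test lec; rewrite Eu U1 Ee E1 (env_wt He) -/E -/c in lec.
  wp_nop.
  wp_run; apply: finish_skip; rewrite /todo /heap_of; mem_simp => //; last lia.
  by rewrite Ee E1.
have {}lec : (c < E j)%R by rewrite ltNge.
have cl w : cur (heap_of st) w <= nnodes (heap_of st) by exact: cur_nnodes Hi w.
have all x : al x -> x <= nnodes (heap_of st) by move=> /(al_nnodes Hi) /andP[].
have [Hcur Hd'] := dijkstra_relax HD HN cl all Hd Wj lec.
have Hi' := heap_inv_insert Hi Hcur.
rewrite -/j -/E -/c in Hi' Hd'.
set h := heap_of st in Hi Hr Hd Hi' Hd' Hcur cl all *.
set x := (nnodes h).+1 in Hi' Hd'.
have xm : x < m.+1 by rewrite /x /=; lia.
have alx : al x = false.
  by apply/negbTE/negP => /all; rewrite /x ltnn.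
have Sal : \sum_(z < m.+1) set_at al x true z = \sum_(z < m.+1) al z + 1.
  have := sum_set_at (fun _ b => nat_of_bool b) al true xm.
  by rewrite alx addn0.
have finish st' k' L tb : root_list h al par L tb ->
    (cur h j != 0 -> tb (rank h (cur h j)) != cur h j) ->
    2 * size L + \sum_(i < K.+1) (tb i != 0) <=
      2 * imem st xT 0 + \sum_(i < K.+1) (imem st aTab i != 0) + 1 ->
    (forall i, tb i != 0 -> imem st aTab i != 0) ->
    heap_of st' = insert h j (c - D j)%R -> todo st' = rcons L x ->
    imem st' aTab = tb -> imem st' xMax = imem st xMax ->
    imem st' xT 0 = (size L).+1 -> rmem st' rE = set_at E j c ->
    imem st' xE 0 = imem st aNext e -> k <= k' + 40 -> 
    frame relax_arc st st' -> Q st' k'.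
  move=> Hr' Htb Hsum Hsub Eh Et Etb EM ET EE Ex k40 fr.
  apply: (HQ _ (set_at al x true) (steal h al par j)) => //; last first.
    by rewrite /heap_potential Etb ET Sal; rewrite /heap_potential in k0 *; lia.
  have EN : imem st' xN 0 = x by rewrite -[LHS]/(nnodes (heap_of st')) Eh.
  split.
  - split; rewrite ?Eh ?Et ?Etb ?EM ?EN //.
      exact: roots_insert.
    by move=> i /Hsub /Ht.
  - by rewrite EE Eh.
  - move=> w wn; rewrite -[imem st' aCur]/(cur (heap_of st')) Eh /=.
    rewrite set_at_neq; first exact: Hc.
    by apply: contraTneq wn => ->; rewrite -ltnNge HW.
  - by rewrite EN /x /=; move: Hcnt; gen_sums; lia.
wp_run; rewrite Eu U1 Ee E1 (env_wt He) -/E -/c.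
wp_test tk.
  have [c0 tc] : cur h j != 0 /\ imem st aTab (rank h (cur h j)) = cur h j.
    by case/and3P: tk => c0 l1 l2; split; [rewrite -lt0n|apply/eqP; rewrite eqn_leq l1].
  have i0 : imem st aTab (rank h (cur h j)) != 0 by rewrite tc.
  have Hr' := roots_take Hi i0 Hr; rewrite tc in Hr'.
  wp_run; apply: (finish _ _ _ _ Hr'); rewrite /todo /heap_of; mem_simp => //.
  - by rewrite eq_sym.
  - have cK : rank h (cur h j) < K.+1.
      by rewrite ltnS; have [ac _] := Hcur c0; exact: (rank_K HK H ac).
    have := sum_set_at (fun _ y => y != 0 : nat) (imem st aTab) 0 cK.
    rewrite size_rcons size_mkseq i0 /= addn0; gen_sums; lia.
  - by move=> i; rewrite /set_at; case: (i =P _).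
  - by rewrite /insert /= !addn1 /c (env_D He).
  - by rewrite !addn1 !mkseq_set_at.
  - by rewrite size_rcons size_mkseq !addn1.
  - by rewrite Ee E1.
  - by lia.
have ntake : cur h j != 0 -> imem st aTab (rank h (cur h j)) != cur h j.
  move=> c0; apply: contra tk => /eqP tc; rewrite -[imem st 15 _]/(cur h j).
  by rewrite -[imem st 11 _]/(rank h (cur h j)) tc lt0n c0 leqnn.
wp_nop.
wp_run; apply: (finish _ _ _ _ Hr); rewrite /todo /heap_of; mem_simp => //.
- by rewrite size_mkseq addn1.
- by rewrite /insert /= !addn1 /c (env_D He).
- by rewrite !addn1 !mkseq_set_at.
- by rewrite size_mkseq !addn1.
- by rewrite Ee E1.
- by lia.
Qed.

Definition dij_safe c := ~~ has (mem (int_writes c))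
    [:: aRank; aKid; aSib; aItem; aCur; aTodo; aTab; xN; xT; xMax]
  && ~~ has (mem (real_writes c)) [:: rKey; rE].

Lemma heap_frame c st st' : dij_safe c -> frame c st st' ->
  [/\ heap_of st' = heap_of st, forall al par, heap_state m K st al par ->
    heap_state m K st' al par,
    forall al, heap_potential m K st' al = heap_potential m K st al & rmem st' rE = rmem st rE].
Proof.
rewrite /dij_safe /= !negb_or => /andP[].
do 10 (case/andP => ?); move=> _ /and3P[? ? _] [Fi Fr].
have Eh : heap_of st' = heap_of st by rewrite /heap_of !Fi // Fr.
split=> //.
- by move=> al par [? ? ? ? ?]; split; rewrite ?Eh /todo ?Fi.
- by move=> al; rewrite /heap_potential !Fi.
- exact: Fr.
Qed.

Lemma dij_frame c st st' vis u rem al par : dij_safe c -> frame c st st' ->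
  dij_state W wt D v st vis u rem al par -> dij_state W wt D v st' vis u rem al par.
Proof.
move=> sc fr; have [Eh Hh _ EE] := heap_frame sc fr; case=> [H Hd Hc Hcnt].
split; first exact: Hh.
- by rewrite EE Eh.
- by move=> w wn; rewrite -[imem st' aCur]/(cur (heap_of st')) Eh; exact: Hc.
- by rewrite -[imem st' xN 0]/(nnodes (heap_of st')) Eh.
Qed.

Lemma frame_iset a i e st x y :
  frame (ISet a i e) st (Store (upd (imem st) a x y) (rmem st)).
Proof. by split=> // b; rewrite inE /= => ba; rewrite upd_other. Qed.

Lemma mem_out_arcs w e : e \in out_arcs w <-> e < m /\ row e = w.
Proof.
rewrite /out_arcs mem_rev mem_filter mem_iota add0n.
by split=> [/andP[/eqP -> /andP[]]|[-> ->]] //; rewrite eqxx.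
Qed.

Lemma wp_scan st0 vis u al0 par0 Q k :
  env st0 W wt D -> dij_state W wt D v st0 vis u (out_arcs u) al0 par0 ->
  imem st0 xU 0 = u.+1 -> u < n ->
  200 * size (out_arcs u) + 20 * heap_potential m K st0 al0 + 2 <= k ->
  (forall st al par k', frame scan_arcs st0 st ->
     dij_state W wt D v st vis u [::] al par ->
     20 * heap_potential m K st al +
       (k - (200 * size (out_arcs u) + 20 * heap_potential m K st0 al0 + 2)) <= k' -> Q st k') ->
  wp scan_arcs Q st0 k.
Proof.
move=> He Hs Eu un k0 HQ; apply: wp_frame; rewrite /scan_arcs.
set rest := k - _ in HQ.
wp_run; rewrite Eu; have -> : u.+1 - 1 = u by lia.
set st1 := Store _ _.
have fr1 : frame (ISet xE (IConst 0) (IConst 0)) st0 st1 by exact: frame_iset.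
have He1 : env st1 W wt D by exact: env_frame fr1 He.
pose Inv st k' := exists al par rem, [/\ chain (imem st0 aNext) (imem st xE 0) rem,
  dij_state W wt D v st vis u rem al par &
  200 * size rem + 20 * heap_potential m K st al + 1 + rest <= k'].
apply: (@wp_while _ Inv) => //.
- exists al0, par0, (out_arcs u); split.
  + by rewrite /st1; mem_simp; exact: (env_adj He).
  + exact: dij_frame fr1 Hs.
  + by have [_ _ -> _] := @heap_frame (xE ::= IConst 0) _ _ isT fr1; rewrite /rest; lia.
- move=> st k1 fr [al [par [rem [Hch Hds kk]]]]; mem_simp => E0; split; first lia.
  case: rem Hch Hds kk => [|e rem] /= Hch Hds kk; first by rewrite Hch in E0.
  have [Ee Hch'] := Hch.
  have He2 : env st W wt D by exact: env_frame fr He1.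
  have Eu2 : imem st xU 0 = u.+1 by rewrite (proj1 fr) // /st1; mem_simp.
  apply: (wp_relax He2 Hds Eu2 Ee); first lia.
  move=> st' al' par' k' fr' Hds' Ee' kk'; exists al', par', rem; split=> //; last lia.
  have En : imem st aNext = imem st0 aNext by rewrite (proj1 fr) // /st1; mem_simp.
  by rewrite Ee' En.
- move=> st k1 fr [al [par [rem [Hch Hds kk]]]]; mem_simp => E0; split; first lia.
  move=> fr'; case: rem Hch Hds kk => [|e rem] /= Hch Hds kk; last first.
    by case: Hch => Ee; rewrite Ee in E0.
  by apply: (HQ _ al par) => //; lia.
Qed.

(** Steps for visiting a node, its arcs excepted: the search of the table and the
    release of the children of the minimum are bounded by the largest rank. *)
Definition vertex_cost := 60 * K + 60.
Definition unvisited_cost vis :=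
  \sum_(w < n) (if vis w then 0 else vertex_cost + 200 * size (out_arcs w)).

Lemma wp_dijkstra st0 u0 vis0 al0 par0 Q k :
  env st0 W wt D -> imem st0 xU 0 = u0.+1 -> u0 < n ->
  dij_state W wt D v st0 vis0 u0 (out_arcs u0) al0 par0 ->
  vertex_cost + 200 * size (out_arcs u0) + unvisited_cost vis0 +
    20 * heap_potential m K st0 al0 + 1 <= k ->
  (forall st al par k', frame dijkstra st0 st ->
     feasible m row col wt W (rmem st rE) -> heap_state m K st al par ->
     (forall x, ~~ al x) -> imem st xT 0 = 0 ->
     (forall w, n <= w -> imem st aCur w = 0) ->
     k - (vertex_cost + 200 * size (out_arcs u0) + unvisited_cost vis0 +
       20 * heap_potential m K st0 al0 + 1) <= k' -> Q st k') ->
  wp dijkstra Q st0 k.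
Proof.
move=> He0 Eu0 un0 Hs0 k0 HQ; set rest := k - _ in HQ.
pose Inv st k' := exists vis u al par,
  (imem st xU 0 = 0 /\ [/\ dij_state W wt D v st vis u [::] al par,
     forall x, ~~ al x, imem st xT 0 = 0 & 1 + rest <= k']) \/
  [/\ imem st xU 0 = u.+1, u < n, dij_state W wt D v st vis u (out_arcs u) al par &
     vertex_cost + 200 * size (out_arcs u) + unvisited_cost vis +
       20 * heap_potential m K st al + 1 + rest <= k'].
apply: (@wp_while _ Inv) => //.
- by exists vis0, u0, al0, par0; right; split=> //; rewrite /rest; lia.
- move=> st k1 fr [vis [u [al [par HI]]]]; mem_simp => U0.
  case: HI => [[E0]|[Eu un Hs kk]]; first by rewrite E0 in U0.
  split; first by lia.
  have He : env st W wt D by exact: env_frame fr He0.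
  rewrite /dijkstra_step; apply: wp_seq.
  apply: (wp_scan He Hs Eu un); first by rewrite /vertex_cost in kk; lia.
  set r1 := k1 - 1 - _ => st1 al1 par1 k2 fr1 Hs1 kk1.
  have He1 : env st1 W wt D by exact: env_frame fr1 He.
  have rr1 : vertex_cost + unvisited_cost vis + rest <= r1 + 2.
    by rewrite /r1; lia.
  have [H1 Hd1 Hc1 Hcnt1] := Hs1.
  apply: wp_seq; apply: (wp_consolidate HK H1); first by rewrite /vertex_cost in rr1; lia.
  move=> st2 al2 par2 k3 fr2 H2 Hal ET2 kk2.
  have He2 : env st2 W wt D by exact: env_frame fr2 He1.
  have Hd2 : dijkstra_inv m row col wt W v D vis u [::] (rmem st2 rE)
      (heap_of st2) al2.
    rewrite (proj2 fr2) //; apply: dijkstra_heap Hd1.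
    - by rewrite /= (proj1 fr2).
    - by rewrite /= (proj1 fr2).
    - by rewrite /= (proj2 fr2).
    - exact: Hal.
    - by move=> x; exact: al_neq0 (hs_inv H1).
    - exact: item_cur (hs_inv H1).
  have Hcur2 : imem st2 aCur = imem st1 aCur by rewrite (proj1 fr2).
  have HN2 : imem st2 xN = imem st1 xN by rewrite (proj1 fr2).
  have M2 := hs_max H2.
  apply: wp_seq; apply: wp_find_min; first by rewrite /vertex_cost in rr1; lia.
  move=> st3 k4 fr3 Hb kk3.
  have [Eh3 Hh3 Ephi3 EE3] := @heap_frame find_min _ _ isT fr3.
  have H3 := Hh3 _ _ H2.
  have He3 : env st3 W wt D by exact: env_frame fr3 He2.
  have Etab3 : imem st3 aTab = imem st2 aTab by rewrite (proj1 fr3).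
  have Ekey3 : rmem st3 rKey = rmem st2 rKey by rewrite (proj2 fr3).
  have EM3 : imem st3 xMax = imem st2 xMax by rewrite (proj1 fr3).
  have ET3 : imem st3 xT 0 = 0 by rewrite (proj1 fr3).
  rewrite -Etab3 -Ekey3 -EM3 in Hb.
  apply: (wp_pop_min HK H3 ET3 Hb); first by rewrite /vertex_cost in rr1; lia.
    move=> st4 k5 fr4 nal H4 EU4 ET4 Ephi4 kk4.
    have [Eh4 EE4] : heap_of st4 = heap_of st3 /\ rmem st4 rE = rmem st3 rE.
      by rewrite /heap_of !(proj1 fr4) // !(proj2 fr4).
    exists vis, u, al2, par2; left; split=> //; split=> //; last first.
      by rewrite /vertex_cost in rr1; lia.
    split=> //.
    - by rewrite EE4 Eh4 Eh3 EE3.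
    - by move=> w; rewrite (proj1 fr4) // (proj1 fr3) // Hcur2; exact: Hc1.
    - by rewrite (proj1 fr4) // (proj1 fr3) // HN2.
  move=> st4 k5 b fr4 ab fb mb H4 EU4 Ephi4 kk4.
  have [Eh4 EE4] : heap_of st4 = heap_of st3 /\ rmem st4 rE = rmem st3 rE.
    by rewrite /heap_of !(proj1 fr4) // !(proj2 fr4).
  rewrite Eh3 in fb mb.
  set w := imem st3 aItem b in EU4.
  have Ew : item (heap_of st2) b = w by rewrite -Eh3.
  have [nvw] := dijkstra_extract Hd2 ab fb mb (fun x => @al_neq0 _ _ _ _ x (hs_inv H2))
    (item_cur (hs_inv H2)) (mem_out_arcs (item (heap_of st2) b)).
  rewrite Ew => Hd4; rewrite Ew in nvw.
  have [Ww _] := dj_alive Hd2 ab fb; rewrite Ew in Ww; have wn := HW Ww.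
  exists (set_at vis w true), w, (set_at al2 b false), (unroot par2 b); right.
  split=> //.
    split=> //.
    - by rewrite EE4 Eh4 Eh3 EE3.
    - by move=> z; rewrite (proj1 fr4) // (proj1 fr3) // Hcur2; exact: Hc1.
    - rewrite (proj1 fr4) // (proj1 fr3) // HN2.
      have := sum_set_at (fun z (b : bool) => if b then 0 else size (out_arcs z)) vis true wn.
      by rewrite (negbTE nvw); move: Hcnt1; rewrite /=; gen_sums; lia.
  have := sum_set_at (fun z (b : bool) => if b then 0 else vertex_cost + 200 * size (out_arcs z))
    vis true wn.
  rewrite (negbTE nvw) -/(unvisited_cost vis) -/(unvisited_cost _) => S.
  move: (Ephi3 al2) rr1 kk4 S; rewrite /vertex_cost /=; lia.
- move=> st k1 fr [vis [u [al [par HI]]]]; mem_simp => U0.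
  case: HI => [[E0 [Hs nal T0 kk]]|[Eu]]; last by rewrite Eu in U0.
  split; first by lia.
  have [H Hd Hc _] := Hs.
  by apply: (HQ _ al par) => //; [exact: dijkstra_final Hd nal|lia].
Qed.

End Run.
End DijkstraProgram.

(** * Adding one node *)

Section AddNode.
Local Open Scope nat_scope.
Context {R : realType} (n m K : nat) (row col : nat -> nat).
Context (HK : forall r, 2 ^ r./2 <= m -> r <= K).
Implicit Type (st : store R) (W : nat -> bool).
Implicit Types (wt D : nat -> R).

(** Every arc is counted at its origin. *)
Lemma sum_out_arcs : \sum_(w < n) size (out_arcs m row w) <= m.
Proof.
rewrite (eq_bigr (fun w : 'I_n => \sum_(e <- iota 0 m) (row e == w))).
  rewrite exchange_big /= -[leqRHS](size_iota 0) -sum1_size leq_sum // => e _.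
  case: (ltnP (row e) n) => [rn|nr].
    rewrite (bigD1 (Ordinal rn)) //= eqxx big1 // => w /eqP wn.
    by apply/eqP; rewrite eqb0; apply/eqP => E; apply: wn; apply: val_inj.
  rewrite big1 // => w _; apply/eqP; rewrite eqb0; apply/eqP => E.
  by have := ltn_ord w; rewrite -E; lia.
by move=> w _; rewrite size_rev size_filter -sum1_count big_mkcond /=;
  apply: eq_bigr => e _; case: eqP.
Qed.

Lemma sum_but_one (F : nat -> nat) v : v < n ->
  \sum_(w < n) (if pred1 v (w : nat) then 0 else F w) + F v = \sum_(w < n) F w.
Proof.
move=> vn; rewrite (bigD1 (Ordinal vn)) //= eqxx [RHS](bigD1 (Ordinal vn)) //=.
rewrite (eq_bigr (fun w : 'I_n => F w)); first lia.
by move=> w wv; case: ifP => // /eqP E; case/eqP: wv; exact: val_inj.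
Qed.

Record graph st : Prop := Graph {
  g_n : imem st 0 0 = n;
  g_m : imem st 0 1 = m;
  g_row : imem st aRow = row;
  g_col : imem st aCol = col;
  g_adj : forall w, chain (imem st aNext) (imem st aHead w) (out_arcs m row w) }.

Definition graph_safe c :=
  ~~ has (mem (int_writes c)) [:: 0; aRow; aCol; aNext; aHead].

Lemma graph_frame c st st' : graph_safe c -> frame c st st' -> graph st -> graph st'.
Proof.
rewrite /graph_safe /= !negb_or => /and5P[? ? ? ? /andP[? _]] [Fi _] [? ? ? ? Ha].
by split=> *; rewrite ?Fi.
Qed.

(** What holds between two additions of nodes; the heap is empty. *)
Record ready st W : Prop := Ready {
  rd_in : forall x, (0 < imem st aIn x) = W x;
  rd_W : forall x, W x -> x < n;
  rd_E : forall x, x < n -> rmem st rE x = rmem st rD x;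
  rd_cur : forall w, imem st aCur w = 0;
  rd_tab : forall i, imem st aTab i = 0;
  rd_T : imem st xT 0 = 0;
  rd_rank : imem st aRank 0 = 0;
  rd_max : imem st xMax 0 <= K }.

(** The arcs leaving [v], loops included, are left to the run of Dijkstra's algorithm
    that starts from [v]. *)
Lemma wp_in_arcs st0 W wt v Q k : graph st0 -> ready st0 W ->
  (forall e, (rmem st0 rLam (imem st0 xS 0) - rmem st0 rVal e)%R = wt e) ->
  imem st0 xV 0 = v -> v < n -> ~~ W v -> 10 * m + 10 <= k ->
  feasible m row col wt W (rmem st0 rD) ->
  (forall st k' d, frame in_arcs st0 st ->
    imem st aIn = set_at (imem st0 aIn) v 1 ->
    rmem st rD = set_at (rmem st0 rD) v d ->
    (forall f, f < m -> set_at W v true (row f) -> set_at W v true (col f) ->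
      row f != v ->
      (set_at (rmem st0 rD) v d (col f) <= set_at (rmem st0 rD) v d (row f) + wt f)%R) ->
    k - (10 * m + 10) <= k' -> Q st k') ->
  wp in_arcs Q st0 k.
Proof.
move=> Hg Hr Hwt Ev vn nWv k0 Hf HQ; apply: wp_frame; rewrite /in_arcs; wp_run.
set st1 := Store _ _; set rest := k - _ in HQ; set D := rmem st0 rD in Hf HQ.
pose Inv st k' := exists d, [/\ rmem st rD = set_at D v d, imem st xE 0 <= m,
  forall e, e < imem st xE 0 -> col e = v -> W (row e) -> (d <= D (row e) + wt e)%R &
  10 * (m - imem st xE 0) + 1 + rest <= k'].
apply: (@wp_while _ Inv) => //.
- by exists 0%R; rewrite /st1; mem_simp; rewrite Ev; split=> //; rewrite /rest; lia.
- move=> st k1 fr [d [ED lem Hd kk]].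
  have Em : imem st 0 1 = m by rewrite (proj1 fr) // /st1; mem_simp; exact: g_m Hg.
  have Er : imem st aRow = row by rewrite (proj1 fr) // /st1; mem_simp; exact: g_row Hg.
  have Ec : imem st aCol = col by rewrite (proj1 fr) // /st1; mem_simp; exact: g_col Hg.
  have Ei : imem st aIn = set_at (imem st0 aIn) v 1.
    by rewrite (proj1 fr) // /st1; mem_simp; rewrite Ev.
  have EV : imem st xV 0 = v by rewrite (proj1 fr) // /st1; mem_simp.
  have Ew e : (rmem st rLam (imem st xS 0) - rmem st rVal e)%R = wt e.
    by rewrite (proj1 fr) // !(proj2 fr) // /st1; mem_simp.
  mem_simp; rewrite Em => eM; split; first lia.
  set e := imem st xE 0 in eM lem Hd kk.
  have finish st' k' d' : imem st' xE 0 = e.+1 -> rmem st' rD = set_at D v d' ->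
      (d' <= d)%R -> (col e = v -> W (row e) -> (d' <= D (row e) + wt e)%R) ->
      k1 <= k' + 10 -> Inv st' k'.
    move=> EE ED' dd He k10; exists d'; rewrite EE; split=> //; try lia.
    move=> f; rewrite ltnS leq_eqVlt => /predU1P[->|fe] cf Wf; first exact: He.
    by apply: le_trans dd _; exact: Hd.
  rewrite /in_arcs_body; wp_test Hce; rewrite -/e EV Er Ec Ei in Hce.
    have [ce Wr] : col e = v /\ 0 < set_at (imem st0 aIn) v 1 (row e).
      by case/andP: Hce => /andP[? ?] ?; split=> //; apply/eqP; rewrite eqn_leq; apply/andP.
    wp_test lec; rewrite EV -/e Ew Er ED set_at_eq in lec.
      wp_nop.
      wp_run; apply: (finish _ _ d); mem_simp => //; try lia.
      move=> _ We; move: lec; rewrite set_at_neq //.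
      by apply: contraNneq nWv => <-.
    wp_run; apply: (finish _ _ (set_at D v d (row e) + wt e)%R); mem_simp => //; try lia.
    - rewrite EV Ew Er ED /set_at; apply: boolp.funext => j.
      by rewrite -/e; case: (j == v).
    - by apply: ltW; rewrite ltNge.
    - by move=> _ We; rewrite set_at_neq //; apply: contraNneq nWv => <-.
  wp_nop.
  wp_run; apply: (finish _ _ d); mem_simp => //; try lia.
  move=> ce We; case/negP: Hce; rewrite ce leqnn set_at_neq /=.
    by rewrite (rd_in Hr).
  by apply: contraNneq nWv => <-.
- move=> st k1 fr [d [ED lem Hd kk]].
  have Em : imem st 0 1 = m by rewrite (proj1 fr) // /st1; mem_simp; exact: g_m Hg.
  mem_simp; rewrite Em negbK => eM; split; first lia.
  move=> fr'; apply: (HQ _ _ d) => //; last lia.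
    by rewrite (proj1 fr) // /st1; mem_simp; rewrite Ev.
  move=> f fm; rewrite ![set_at _ _ _ (row f)]/set_at => Wr Wc /negbTE rv.
  rewrite rv in Wr *; move: Wc; rewrite /set_at; case: (col f =P v) => [cf _|_ Wc].
    by apply: Hd => //; lia.
  exact: Hf.
Qed.

Lemma wp_commit st0 Q k : imem st0 0 0 = n -> 10 * n + 10 <= k ->
  (forall st k', frame commit st0 st ->
    (forall x, x < n -> rmem st rD x = rmem st0 rE x) ->
    (forall x, imem st aCur x = if x < n then 0 else imem st0 aCur x) ->
    k - (10 * n + 10) <= k' -> Q st k') ->
  wp commit Q st0 k.
Proof.
move=> En k0 HQ; apply: wp_frame; rewrite /commit; wp_run.
set st1 := Store _ _; set rest := k - _ in HQ.
pose Inv st k' := [/\ imem st xI 0 <= n,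
  forall x, x < imem st xI 0 -> rmem st rD x = rmem st0 rE x,
  forall x, imem st aCur x = if x < imem st xI 0 then 0 else imem st0 aCur x &
  10 * (n - imem st xI 0) + 1 + rest <= k'].
apply: (@wp_while _ Inv) => //.
- by rewrite /Inv /st1; mem_simp; split=> //; rewrite /rest; lia.
- move=> st k1 fr [lei HD HC kk].
  have En' : imem st 0 0 = n by rewrite (proj1 fr) // /st1; mem_simp.
  have EE : rmem st rE = rmem st0 rE by rewrite (proj2 fr) // /st1; mem_simp.
  mem_simp; rewrite En' => iN; split; first lia.
  wp_run; rewrite /Inv; mem_simp; rewrite addn1; split; try lia.
    move=> x; rewrite ltnS leq_eqVlt EE => /predU1P[->|xi]; first by rewrite set_at_eq.
    by rewrite set_at_neq ?HD //; lia.
  move=> x; rewrite ltnS leq_eqVlt /set_at; case: eqP => // _; exact: HC.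
- move=> st k1 fr [lei HD HC kk].
  have En' : imem st 0 0 = n by rewrite (proj1 fr) // /st1; mem_simp.
  mem_simp; rewrite En' negbK => iN; split; first lia.
  have Ei : imem st xI 0 = n by lia.
  by rewrite Ei in HD HC; move=> fr'; apply: HQ => //; lia.
Qed.

Definition add_cost := n * (60 * K + 100) + 300 * m + 100.

Lemma wp_add_node st0 W wt v Q k : graph st0 -> ready st0 W ->
  (forall e, (rmem st0 rLam (imem st0 xS 0) - rmem st0 rVal e)%R = wt e) ->
  imem st0 xV 0 = v -> v < n -> ~~ W v -> add_cost <= k ->
  feasible m row col wt W (rmem st0 rD) ->
  no_neg_cycle m row col wt (set_at W v true) ->
  (forall st k', frame add_node st0 st -> ready st (set_at W v true) ->
    feasible m row col wt (set_at W v true) (rmem st rD) ->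
    k - add_cost <= k' -> Q st k') ->
  wp add_node Q st0 k.
Proof.
move=> Hg Hr Hwt Ev vn nWv k0 Hf HN HQ; apply: wp_frame; rewrite /add_node.
set W' := set_at W v true in HN HQ.
have bound : vertex_cost K + 200 * size (out_arcs m row v) +
    unvisited_cost n m K row (pred1 v) <= n * (60 * K + 60) + 200 * m.
  have := sum_but_one (fun w => vertex_cost K + 200 * size (out_arcs m row w)) vn.
  rewrite -/(unvisited_cost n m K row (pred1 v)) /= big_split /= sum_nat_const card_ord.
  have := sum_out_arcs; rewrite -big_distrr /= /vertex_cost; gen_sums; lia.
apply: wp_seq; apply: (wp_in_arcs Hg Hr Hwt Ev vn nWv _ Hf).
  by rewrite /add_cost in k0; lia.
move=> st1 k1 d fr1 Ei1 ED1 HD1 kk1.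
have Hg1 : graph st1 by exact: graph_frame fr1 Hg.
have EV1 : imem st1 xV 0 = v by rewrite (proj1 fr1).
have k1' : n * (60 * K + 90) + 290 * m + 90 <= k1 by rewrite /add_cost in k0; lia.
wp_run; rewrite EV1; set st2 := Store _ _.
have EE2 : rmem st2 rE = set_at (rmem st0 rE) v d.
  by rewrite /st2; mem_simp; rewrite (proj2 fr1) // ED1 set_at_eq.
have ED2 : rmem st2 rD = set_at (rmem st0 rD) v d by rewrite /st2; mem_simp.
have W'n x : W' x -> x < n.
  by rewrite /W' /set_at; case: (x =P v) => [->|_] //; exact: rd_W Hr x.
have He2 : env n m row col st2 W' wt (set_at (rmem st0 rD) v d).
  split.
  - by rewrite /st2; mem_simp; exact: g_col Hg1.
  - move=> x; rewrite /st2; mem_simp; rewrite Ei1 /W' /set_at.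
    by case: (x =P v) => // _; exact: rd_in Hr x.
  - by move=> e; rewrite /st2; mem_simp; rewrite (proj1 fr1) // !(proj2 fr1).
  - by [].
  - by move=> w _; rewrite /st2; mem_simp; exact: g_adj Hg1 w.
have Eu2 : imem st2 xU 0 = v.+1 by rewrite /st2; mem_simp; rewrite addn1.
have cur2 w : imem st2 aCur w = 0.
  by rewrite /st2; mem_simp; rewrite (proj1 fr1) //; exact: rd_cur Hr w.
have EN2 : imem st2 xN 0 = 0 by rewrite /st2; mem_simp.
have tab2 i : imem st2 aTab i = 0.
  by rewrite /st2; mem_simp; rewrite (proj1 fr1) //; exact: rd_tab Hr i.
have T2 : imem st2 xT 0 = 0 by rewrite /st2; mem_simp; rewrite (proj1 fr1) //; exact: rd_T Hr.
have H2 : heap_state m K st2 xpred0 (fun=> 0).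
  split.
  - split=> //.
    + by rewrite /st2 /=; mem_simp; rewrite (proj1 fr1) //; exact: rd_rank Hr.
    + by move=> w; rewrite -[cur _ w]/(imem st2 aCur w) cur2.
    + by move=> w; rewrite -[cur _ w]/(imem st2 aCur w) cur2.
  - rewrite /todo T2; split=> //.
    by move=> i; rewrite tab2.
  - by rewrite EN2.
  - by move=> i; rewrite tab2.
  - by rewrite /st2; mem_simp; rewrite (proj1 fr1) //; exact: rd_max Hr.
have Hs2 : dij_state n m K row col W' wt (set_at (rmem st0 rD) v d) v st2 (pred1 v) v
    (out_arcs m row v) xpred0 (fun=> 0).
  split=> //.
  - apply: dijkstra_init.
    + by rewrite /W' set_at_eq.
    + move=> x /W'n xn; rewrite EE2 /set_at; case: (x =P v) => // _; exact: rd_E Hr x xn.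
    + by move=> x _; exact: cur2.
    + exact: mem_out_arcs.
  - rewrite EN2 add0n addnC.
    have -> := sum_but_one (fun w => size (out_arcs m row w)) vn; exact: sum_out_arcs.
have phi2 : heap_potential m K st2 xpred0 = 0.
  rewrite /heap_potential T2 !big1 // => i _; by rewrite tab2.
apply: (wp_dijkstra HK W'n HD1 HN He2 Eu2 vn Hs2).
  by rewrite phi2; lia.
rewrite phi2; move=> st3 al3 par3 k2 fr3 Hf3 H3 nal T3 cur3 kk2.
have En3 : imem st3 0 0 = n.
  by rewrite (proj1 fr3) // /st2; mem_simp; exact: g_n Hg1.
apply: wp_commit => //; first lia.
move=> st4 k3 fr4 ED4 EC4 kk3 fr; apply: HQ => //.
- split.
  + move=> x; rewrite (proj1 fr4) // (proj1 fr3) //; exact: env_in He2 x.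
  + exact: W'n.
  + by move=> x xn; rewrite ED4 // (proj2 fr4).
  + by move=> w; rewrite EC4; case: ltnP => // /cur3.
  + move=> i; rewrite (proj1 fr4) //; apply/eqP; apply: contraT => i0.
    by have [] := roots_tb (hs_roots H3) i0; rewrite (negbTE (nal _)).
  + by rewrite (proj1 fr4).
  + by rewrite (proj1 fr4) //; exact: rank0 (hs_inv H3).
  + by rewrite (proj1 fr4) //; exact: hs_max H3.
- move=> e em Wr Wc; rewrite !ED4 ?W'n //; exact: Hf3.
- by rewrite /add_cost; lia.
Qed.

End AddNode.

(** * The stages of the program *)

Section Visualize.
Local Open Scope nat_scope.
Context {R : realType} (n m r K : nat) (row col part : nat -> nat) (val lam : nat -> R).
Context (HK : forall r, 2 ^ r./2 <= m -> r <= K).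
Context (Hrow : forall e, e < m -> row e < n) (Hcol : forall e, e < m -> col e < n).
Implicit Type st : store R.

Definition arc_wt s e : R := (lam s - val e)%R.
Definition stage_set s x := [&& x < n, s <= part x & part x < r].

Context (Hpart : 0 < r -> forall x, x < n -> part x < r).
Context (Hlam : forall s, s.+1 < r -> (lam s.+1 <= lam s)%R).
Context (Hcyc : forall s, s < r -> no_neg_cycle m row col (arc_wt s) (stage_set s)).

Record input st : Prop := Input {
  in_graph : graph n m row col st;
  in_r : imem st 0 2 = r;
  in_part : imem st aPart = part;
  in_val : rmem st rVal = val;
  in_lam : rmem st rLam = lam }.

Definition input_safe c := graph_safe c && (aPart \notin int_writes c)
  && (rVal \notin real_writes c) && (rLam \notin real_writes c).

Lemma input_frame c st st' : input_safe c -> frame c st st' -> input st -> input st'.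
Proof.
move=> /andP[/andP[/andP[gs ?] ?] ?] fr [Hg ? ? ? ?]; have Hg' := graph_frame gs fr Hg.
move: gs; rewrite /graph_safe /= !negb_or => /andP[? _].
by case: fr => Fi Fr; split; rewrite ?Fi ?Fr.
Qed.

Definition matrix_entry s (d : nat -> R) e : nat * nat * R :=
  (row e, col e, val e - lam s + d (col e) - d (row e))%R.

Definition stage_arcs s : pred nat := fun e => (s <= part (row e)) && (s <= part (col e)).

Definition out_vec st s x := rmem st oVec (s * n + x).

(** The output of stage [s], with the matrix expressed by the stored vector. *)
Record stage_done st s : Prop := StageDone {
  sd_feas : feasible m row col (arc_wt s) (stage_set s) (out_vec st s);
  sd_out : output_entries st s =
    [seq matrix_entry s (out_vec st s) e | e <- iota 0 m & stage_arcs s e];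
  sd_end : imem st oBeg s <= imem st oEnd s <= imem st xQ 0 }.

Lemma wp_output_vector st0 Q k : input st0 -> 10 * n + 10 <= k ->
  (forall st k', frame output_vector st0 st ->
    (forall x, x < n -> rmem st oVec (imem st0 xBase 0 + x) = rmem st0 rD x) ->
    (forall i, (i < imem st0 xBase 0) || (imem st0 xBase 0 + n <= i) ->
      rmem st oVec i = rmem st0 oVec i) ->
    k - (10 * n + 10) <= k' -> Q st k') ->
  wp output_vector Q st0 k.
Proof.
move=> Hin k0 HQ; apply: wp_frame; rewrite /output_vector; wp_run.
have En := g_n (in_graph Hin).
set st1 := Store _ _; set rest := k - _ in HQ; set b := imem st0 xBase 0 in HQ.
pose Inv st k' := [/\ imem st xI 0 <= n,
  forall x, x < imem st xI 0 -> rmem st oVec (b + x) = rmem st0 rD x,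
  forall i, (i < b) || (b + n <= i) -> rmem st oVec i = rmem st0 oVec i &
  10 * (n - imem st xI 0) + 1 + rest <= k'].
apply: (@wp_while _ Inv) => //.
- by rewrite /Inv /st1; mem_simp; split=> //; rewrite /rest; lia.
- move=> st k1 fr [lei HD HC kk].
  have En' : imem st 0 0 = n by rewrite (proj1 fr) // /st1; mem_simp.
  have EE : rmem st rD = rmem st0 rD by rewrite (proj2 fr) // /st1; mem_simp.
  have Eb : imem st xBase 0 = b by rewrite (proj1 fr) // /st1; mem_simp.
  mem_simp; rewrite En' => iN; split; first lia.
  wp_run; rewrite /Inv; mem_simp; rewrite addn1 Eb; split; try lia.
    move=> x; rewrite ltnS leq_eqVlt EE => /predU1P[->|xi]; first by rewrite set_at_eq.
    by rewrite set_at_neq ?HD //; lia.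
  by move=> i ib; rewrite set_at_neq ?HC //; lia.
- move=> st k1 fr [lei HD HC kk].
  have En' : imem st 0 0 = n by rewrite (proj1 fr) // /st1; mem_simp.
  mem_simp; rewrite En' negbK => iN; split; first lia.
  have Ei : imem st xI 0 = n by lia.
  by rewrite Ei in HD; move=> fr'; apply: HQ => //; lia.
Qed.

Definition stored st q : nat * nat * R := (imem st oRow q, imem st oCol q, rmem st oVal q).

Lemma wp_output_matrix st0 s Q k : input st0 -> imem st0 xS 0 = s -> 10 * m + 10 <= k ->
  (forall st k', frame output_matrix st0 st ->
    imem st oBeg = set_at (imem st0 oBeg) s (imem st0 xQ 0) ->
    imem st oEnd = set_at (imem st0 oEnd) s (imem st xQ 0) ->
    imem st0 xQ 0 <= imem st xQ 0 ->
    (forall q, q < imem st0 xQ 0 -> stored st q = stored st0 q) ->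
    map (stored st) (index_iota (imem st0 xQ 0) (imem st xQ 0)) =
      [seq matrix_entry s (rmem st0 rD) e | e <- iota 0 m & stage_arcs s e] ->
    k - (10 * m + 10) <= k' -> Q st k') ->
  wp output_matrix Q st0 k.
Proof.
move=> Hin ES k0 HQ; apply: wp_frame; rewrite /output_matrix; wp_run.
set st1 := Store _ _; set rest := k - _ in HQ; set q0 := imem st0 xQ 0 in HQ.
have fr1 : frame output_matrix st0 st1 by split=> a ha; rewrite /st1; mem_simp; rewrite ?upd_other //; apply: contraNneq ha => ->.
pose Inv st k' := [/\ imem st xE 0 <= m, q0 <= imem st xQ 0,
  forall q, q < q0 -> stored st q = stored st0 q,
  map (stored st) (index_iota q0 (imem st xQ 0)) =
    [seq matrix_entry s (rmem st0 rD) e | e <- iota 0 (imem st xE 0) & stage_arcs s e] &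
  10 * (m - imem st xE 0) + 4 + rest <= k'].
apply: (@wp_while _ Inv) => //.
- rewrite /Inv /st1; mem_simp; split=> //; last by rewrite /rest; lia.
  by rewrite /index_iota -/q0 subnn.
- move=> st k1 fr [lei Hq HC HE kk].
  have Hin' : input st.
    by apply: input_frame fr _ => //; apply: input_frame fr1 Hin.
  have Em := g_m (in_graph Hin'); have Er := g_row (in_graph Hin').
  have Ec := g_col (in_graph Hin').
  have ED : rmem st rD = rmem st0 rD by rewrite (proj2 fr) // /st1; mem_simp.
  have ES' : imem st xS 0 = s by rewrite (proj1 fr) // /st1; mem_simp.
  mem_simp; rewrite Em => eM; split; first lia.
  set e := imem st xE 0 in eM lei HE kk; set q := imem st xQ 0 in Hq HE.
  have Ei : iota 0 e.+1 = iota 0 e ++ [:: e] by rewrite -addn1 iotaD.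
  rewrite /output_body; wp_test Hc; rewrite -/e ES' (in_part Hin') Er Ec in Hc.
    wp_run; rewrite /Inv; mem_simp; rewrite !addn1 -/q -/e; split; [lia|lia| | |lia].
      move=> p pq; rewrite -HC // /stored; mem_simp; rewrite -/q.
      have pq' : p != q by lia.
      by rewrite !(set_at_neq _ _ pq').
    rewrite Ei filter_cat map_cat /= /stage_arcs Hc /= -HE /index_iota.
    have -> : q.+1 - q0 = (q - q0) + 1 by lia.
    rewrite iotaD map_cat /= subnKC //; congr (_ ++ _).
      apply/eq_in_map => p; rewrite mem_iota subnKC // => /andP[_ pq].
      rewrite /stored; mem_simp; rewrite -/q.
      have pq' : p != q by lia.
      by rewrite !(set_at_neq _ _ pq').
    rewrite /stored; mem_simp; rewrite -/q -/e ?set_at_eq Er Ec ED ES'.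
    by rewrite (in_val Hin') (in_lam Hin').
  wp_nop.
  wp_run; rewrite /Inv; mem_simp; rewrite !addn1 -/q -/e; split; [lia|lia| | |lia].
    by move=> p pq; rewrite -HC // /stored; mem_simp.
  rewrite Ei filter_cat map_cat /= /stage_arcs (negbTE Hc) cats0 -HE.
  by apply: eq_map => p; rewrite /stored; mem_simp.
- move=> st k1 fr [lei Hq HC HE kk].
  have Hin' : input st.
    by apply: input_frame fr _ => //; apply: input_frame fr1 Hin.
  have Em := g_m (in_graph Hin').
  have ES' : imem st xS 0 = s by rewrite (proj1 fr) // /st1; mem_simp.
  mem_simp; rewrite Em negbK => eM; split; first lia.
  have Ee : imem st xE 0 = m by lia.
  wp_run => fr'; apply: HQ => //; mem_simp => //.
  - by rewrite (proj1 fr) // /st1; mem_simp; rewrite ES.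
  - by rewrite (proj1 fr) // /st1; mem_simp; rewrite ES'.
  - by rewrite -Ee -HE.
  - by lia.
Qed.

Definition ready_safe c :=
  ~~ has (mem (int_writes c)) [:: aIn; aCur; aTab; xT; aRank; xMax]
  && ~~ has (mem (real_writes c)) [:: rE; rD].

Lemma ready_frame c st st' W : ready_safe c -> frame c st st' ->
  ready n K st W -> ready n K st' W.
Proof.
rewrite /ready_safe /= !negb_or => /andP[].
do 6 (case/andP => ?); move=> _ /and3P[? ? _] [Fi Fr] [? ? ? ? ? ? ? ?].
by split=> *; rewrite ?Fi ?Fr //; auto.
Qed.

Lemma arc_wt_env st s W : input st -> imem st xS 0 = s -> ready n K st W ->
  forall e, (rmem st rLam (imem st xS 0) - rmem st rVal e)%R = arc_wt s e.
Proof. by move=> Hin -> _ e; rewrite (in_val Hin) (in_lam Hin). Qed.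

Definition part_set_below s v x :=
  [&& x < n, (s < part x) || (part x == s) && (x < v) & part x < r].

Definition node_cost s v := 10 + (if part v == s then add_cost n m K else 0).

(** The circuits of any set of nodes between V_(s+1) and V_s are circuits of V_s,
    so none of them is negative at stage [s]. *)
Lemma wp_add_part st0 s Q k : input st0 -> imem st0 xS 0 = s -> s < r ->
  ready n K st0 (stage_set s.+1) ->
  feasible m row col (arc_wt s) (stage_set s.+1) (rmem st0 rD) ->
  10 + \sum_(0 <= v < n) node_cost s v <= k ->
  (forall st k', frame add_part st0 st -> ready n K st (stage_set s) ->
    feasible m row col (arc_wt s) (stage_set s) (rmem st rD) ->
    k - (10 + \sum_(0 <= v < n) node_cost s v) <= k' -> Q st k') ->
  wp add_part Q st0 k.
Proof.
move=> Hin ES sr Hr Hf k0 HQ; apply: wp_frame; rewrite /add_part; wp_run.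
set st1 := Store _ _; set rest := k - _ in HQ.
have fr1 : frame (xV ::= IConst 0) st0 st1 by exact: frame_iset.
have Hin1 : input st1 by apply: input_frame fr1 Hin.
pose Inv st k' := [/\ imem st xV 0 <= n,
  ready n K st (part_set_below s (imem st xV 0)),
  feasible m row col (arc_wt s) (part_set_below s (imem st xV 0)) (rmem st rD) &
  \sum_(imem st xV 0 <= v < n) node_cost s v + 1 + rest <= k'].
have E0 : part_set_below s 0 = stage_set s.+1.
  by apply: boolp.funext => x; rewrite /part_set_below ltn0 andbF orbF.
have En : part_set_below s n = stage_set s.
  apply: boolp.funext => x; rewrite /part_set_below /stage_set.
  by case: (x < n) => //=; rewrite andbT [s <= _]leq_eqVlt (eq_sym s) orbC.
apply: (@wp_while _ Inv) => //.
- have EV : imem st1 xV 0 = 0 by rewrite /st1; mem_simp.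
  split; rewrite EV ?E0 //; last by rewrite /rest; lia.
  exact: ready_frame fr1 Hr.
- move=> st k1 fr [leV Hrv Hfv kk].
  have Hin' : input st by exact: input_frame fr Hin1.
  have ES' : imem st xS 0 = s by rewrite (proj1 fr) // /st1; mem_simp.
  mem_simp; rewrite (g_n (in_graph Hin')) => vn; split; first lia.
  set v := imem st xV 0 in vn leV Hrv Hfv kk.
  have vn' : v < n by lia.
  rewrite (big_ltn vn') {1}/node_cost in kk.
  have finish st' k' W : imem st' xV 0 = v.+1 -> ready n K st' W ->
      W = part_set_below s v.+1 -> feasible m row col (arc_wt s) W (rmem st' rD) ->
      \sum_(v.+1 <= i < n) node_cost s i + 1 + rest <= k' -> Inv st' k'.
    by move=> EV HrW EW HfW kk'; split; rewrite EV -?EW.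
  wp_test Hp; rewrite (in_part Hin') -/v ES' in Hp.
    have {}Hp : part v == s by rewrite eqn_leq.
    rewrite Hp in kk.
    have EW : set_at (part_set_below s v) v true = part_set_below s v.+1.
      apply: boolp.funext => x; rewrite /set_at /part_set_below ltnS.
      case: (x =P v) => [->|/eqP xv]; last by rewrite [x <= v]leq_eqVlt (negbTE xv).
      by rewrite vn' Hp leqnn orbT (eqP Hp) sr.
    have nWv : ~~ part_set_below s v v.
      by rewrite /part_set_below ltnn andbF orbF (eqP Hp) ltnn andbF.
    have HN : no_neg_cycle m row col (arc_wt s) (set_at (part_set_below s v) v true).
      move=> x l wl; apply: (Hcyc sr (x := x)); apply: walk_sub wl => z.
      rewrite EW /stage_set => /and3P[-> /orP[/ltnW ->|/andP[/eqP -> _]] ->] //.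
      by rewrite leqnn.
    apply: (wp_add_node HK (in_graph Hin') Hrv (arc_wt_env Hin' ES' Hrv) (erefl v)
      vn' nWv _ Hfv HN); first lia.
    move=> st2 k2 fr2 Hr2 Hf2 kk2.
    have EV2 : imem st2 xV 0 = v by rewrite (proj1 fr2).
    wp_run; rewrite EV2; apply: (finish _ _ _ _ _ EW) => //.
    + by mem_simp; rewrite addn1.
    + by apply: (@ready_frame (xV ::= IConst 0)) Hr2 => //; exact: frame_iset.
    + by lia.
  wp_nop.
  have {}Hp : part v == s = false by rewrite eqn_leq; apply/negbTE.
  rewrite Hp in kk.
  wp_run; apply: (finish _ _ (part_set_below s v)) => //.
  + by mem_simp; rewrite addn1.
  + by apply: (@ready_frame (xV ::= IConst 0)) Hrv => //; exact: frame_iset.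
  + apply: boolp.funext => x; rewrite /part_set_below ltnS [x <= v]leq_eqVlt.
    by case: (x =P v) => [->|//]; rewrite Hp.
  + by lia.
- move=> st k1 fr [leV Hrv Hfv kk].
  have Hin' : input st by exact: input_frame fr Hin1.
  mem_simp; rewrite (g_n (in_graph Hin')) negbK => vn; split; first lia.
  have Ev : imem st xV 0 = n by lia.
  rewrite Ev En in Hrv Hfv.
  by move=> fr'; apply: HQ => //; lia.
Qed.

(** Later stages write elsewhere, and leave the output of stage [s] intact. *)
Lemma stage_done_eq st st' s : s < r ->
  (forall x, x < n -> out_vec st' s x = out_vec st s x) ->
  imem st' oBeg s = imem st oBeg s -> imem st' oEnd s = imem st oEnd s ->
  imem st xQ 0 <= imem st' xQ 0 ->
  (forall q, q < imem st xQ 0 -> stored st' q = stored st q) ->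
  stage_done st s -> stage_done st' s.
Proof.
move=> sr Ev EB EE leQ Es [Hf Ho /andP[be eq]]; split.
- by move=> e em Wr Wc; rewrite !Ev ?Hrow ?Hcol //; exact: Hf.
- have -> : output_entries st' s = output_entries st s.
    rewrite /output_entries EB EE; apply/eq_in_map => q.
    by rewrite mem_index_iota => /andP[_ qe]; apply: Es; exact: leq_trans eq.
  rewrite Ho; apply/eq_in_map => e; rewrite mem_filter mem_iota add0n => /andP[_ /andP[_ em]].
  by rewrite /matrix_entry !Ev ?Hrow ?Hcol.
- by rewrite EB EE be (leq_trans eq).
Qed.

Definition stage_cost := 20 * n + 10 * m + 50.

(** Steps for adding all the nodes of the first [s] parts. *)
Definition add_costs s := \sum_(0 <= v < n) (if part v < s then add_cost n m K else 0).

Lemma add_costsS s :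
  add_costs s.+1 + 10 * n = add_costs s + \sum_(0 <= v < n) node_cost s v.
Proof.
rewrite /add_costs /node_cost.
have -> : 10 * n = \sum_(0 <= v < n) 10 by rewrite sum_nat_const_nat subn0 mulnC.
rewrite -!big_split /=; apply: eq_bigr => v _.
rewrite ltnS leq_eqVlt; case: eqP => [->|_] /=; first by rewrite ltnn; lia.
by case: ifP; lia.
Qed.

(** Passing from stage s+1 to stage s increases all the lengths, so the potential
    found before is still feasible. *)
Lemma wp_stages st0 Q k : input st0 -> imem st0 xS 0 = r -> imem st0 xBase 0 = r * n ->
  ready n K st0 (stage_set r) -> add_costs r + r * stage_cost + 1 <= k ->
  (forall st k', (forall s, s < r -> stage_done st s) -> Q st k') ->
  wp (While (pos $xS) stage) Q st0 k.
Proof.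
move=> Hin0 ES0 EB0 Hr0 k0 HQ.
pose Inv st k' := exists s, [/\ imem st xS 0 = s /\ imem st xBase 0 = s * n, s <= r,
  ready n K st (stage_set s) /\
    (s < r -> feasible m row col (arc_wt s) (stage_set s) (rmem st rD)),
  forall s', s <= s' < r -> stage_done st s' &
  add_costs s + s * stage_cost + 1 <= k'].
apply: (@wp_while _ Inv) => //.
- exists r; split=> //; first by rewrite ltnn.
  by move=> s'; rewrite ltnNge andbN.
- move=> st k1 fr [s1 [[ES EB] sr [Hrd Hf] Hdone kk]]; mem_simp; rewrite ES.
  case: s1 ES EB sr Hrd Hf Hdone kk => // s ES EB sr Hrd Hf Hdone kk _; split; first lia.
  have Hin : input st by exact: input_frame fr Hin0.
  have En := g_n (in_graph Hin).
  rewrite mulSn {1}/stage_cost in kk; rewrite /stage.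
  do 2 (apply: wp_seq; wp_assign); apply: wp_seq; rewrite ES EB En.
  have -> : s.+1 - 1 = s by lia.
  have -> : s.+1 * n - n = s * n by lia.
  set st1 := Store _ _.
  have fr1 : frame (xS ::= IConst 0 ;; xBase ::= IConst 0) st st1.
    split=> a ha //; rewrite /st1 /= !upd_other //; by apply: contraNneq ha => ->.
  have Hin1 : input st1 by exact: input_frame fr1 Hin.
  have Hrd1 : ready n K st1 (stage_set s.+1) by exact: ready_frame fr1 Hrd.
  have ES1 : imem st1 xS 0 = s by rewrite /st1; mem_simp.
  have Hf1 : feasible m row col (arc_wt s) (stage_set s.+1) (rmem st1 rD).
    move=> e em Wr Wc; rewrite /st1; mem_simp.
    have [s1r|rs1] := ltnP s.+1 r; last by case/and3P: Wr => _ /(leq_trans rs1); rewrite leqNgt => /negbTE ->.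
    apply: le_trans (Hf s1r e em Wr Wc) _; rewrite lerD2l /arc_wt lerD2r.
    exact: Hlam.
  have ac := add_costsS s.
  apply: (wp_add_part Hin1 ES1 sr Hrd1 Hf1); first lia.
  move=> st2 k2 fr2 Hrd2 Hf2 kk2.
  have Hin2 : input st2 by exact: input_frame fr2 Hin1.
  have ES2 : imem st2 xS 0 = s by rewrite (proj1 fr2).
  have EB2 : imem st2 xBase 0 = s * n by rewrite (proj1 fr2) // /st1; mem_simp.
  apply: wp_seq; apply: (wp_output_vector Hin2); first lia.
  rewrite EB2 => st3 k3 fr3 Hv3 Ho3 kk3.
  have Hin3 : input st3 by exact: input_frame fr3 Hin2.
  have ES3 : imem st3 xS 0 = s by rewrite (proj1 fr3).
  apply: (wp_output_matrix Hin3 ES3); first lia.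
  move=> st4 k4 fr4 Eb4 Ee4 lq4 Hs4 He4 kk4.
  have Eov s' x : out_vec st4 s' x = out_vec st3 s' x by rewrite /out_vec (proj2 fr4).
  have ED : rmem st4 rD = rmem st2 rD by rewrite (proj2 fr4) // (proj2 fr3).
  have Hov x : x < n -> out_vec st4 s x = rmem st4 rD x.
    by move=> xn; rewrite Eov /out_vec Hv3 // (proj2 fr4) // (proj2 fr3).
  exists s; split.
  + by rewrite !(proj1 fr4) // !(proj1 fr3).
  + exact: ltnW.
  + split; last by rewrite ED.
    by apply: ready_frame fr4 _ => //; exact: ready_frame fr3 Hrd2.
  + move=> s' /andP[]; rewrite leq_eqVlt => /predU1P[<- _|ss' s'r].
      split.
      * by move=> e em Wr Wc; rewrite !Hov ?Hrow ?Hcol // ED; exact: Hf2.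
      * rewrite /output_entries Eb4 Ee4 !set_at_eq -[LHS]/(map (stored st4) _) He4.
        apply/eq_in_map => e; rewrite mem_filter mem_iota add0n => /andP[_ /andP[_ em]].
        by rewrite /matrix_entry !Hov ?Hrow ?Hcol // (proj2 fr4).
      * by rewrite Eb4 Ee4 !set_at_eq lq4 leqnn.
    have EQ3 : imem st3 xQ = imem st xQ.
      by rewrite (proj1 fr3) // (proj1 fr2) // /st1; mem_simp.
    apply: (stage_done_eq s'r _ _ _ _ _ (Hdone s' _)); last by rewrite ss'.
    * move=> x xn; rewrite Eov /out_vec Ho3; last first.
        have : s.+1 * n <= s' * n by rewrite leq_mul2r ss' orbT.
        by rewrite mulSn; lia.
      by rewrite (proj2 fr2) // /st1; mem_simp.
    * rewrite Eb4 set_at_neq; last by lia.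
      by rewrite (proj1 fr3) // (proj1 fr2) // /st1; mem_simp.
    * rewrite Ee4 set_at_neq; last by lia.
      by rewrite (proj1 fr3) // (proj1 fr2) // /st1; mem_simp.
    * by rewrite -EQ3.
    * move=> q; rewrite -EQ3 => /Hs4 ->; rewrite /stored.
      by rewrite !(proj1 fr3) // !(proj2 fr3) // !(proj1 fr2) // !(proj2 fr2) // /st1; mem_simp.
  + by lia.
- move=> st k1 fr [s [[ES EB] sr _ Hdone kk]]; mem_simp; rewrite ES => s0.
  split; first lia.
  by apply: HQ => s' s'r; apply: Hdone; rewrite s'r andbT; lia.
Qed.

Lemma chain_eq (nx nx' : nat -> nat) h l : {in l, nx' =1 nx} ->
  chain nx h l -> chain nx' h l.
Proof.
elim: l h => //= e l IH h E [-> Hc]; split=> //; rewrite E ?mem_head //.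
by apply: IH => // f fl; apply: E; rewrite inE fl orbT.
Qed.

Lemma wp_adjacency st0 Q k : imem st0 0 1 = m -> imem st0 aRow = row ->
  (forall w, imem st0 aHead w = 0) -> 10 * m + 10 <= k ->
  (forall st k', frame adjacency st0 st ->
    (forall w, chain (imem st aNext) (imem st aHead w) (out_arcs m row w)) ->
    k - (10 * m + 10) <= k' -> Q st k') ->
  wp adjacency Q st0 k.
Proof.
move=> Em Er Eh k0 HQ; apply: wp_frame; rewrite /adjacency; wp_run.
set st1 := Store _ _; set rest := k - _ in HQ.
pose Inv st k' := [/\ imem st xE 0 <= m,
  forall w, chain (imem st aNext) (imem st aHead w)
    (rev [seq e <- iota 0 (imem st xE 0) | row e == w]) &
  10 * (m - imem st xE 0) + 1 + rest <= k'].
apply: (@wp_while _ Inv) => //.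
- by rewrite /Inv /st1; mem_simp; split=> //; rewrite /rest; lia.
- move=> st k1 fr [lei HD kk].
  have Em' : imem st 0 1 = m by rewrite (proj1 fr) // /st1; mem_simp.
  have Er' : imem st aRow = row by rewrite (proj1 fr) // /st1; mem_simp.
  mem_simp; rewrite Em' => iM; split; first lia.
  set e := imem st xE 0 in iM lei HD kk.
  wp_run; rewrite /Inv; mem_simp; rewrite -/e Er' !addn1; split; try lia.
  have Ei : iota 0 e.+1 = iota 0 e ++ [:: e] by rewrite -addn1 iotaD.
  move=> w; rewrite Ei filter_cat rev_cat /=.
  have old h : chain (imem st aNext) h (rev [seq f <- iota 0 e | row f == w]) ->
      chain (set_at (imem st aNext) e (imem st aHead (row e))) h
        (rev [seq f <- iota 0 e | row f == w]).
    apply: chain_eq => f; rewrite mem_rev mem_filter mem_iota => /andP[_ /andP[_ fe]].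
    by rewrite set_at_neq //; lia.
  rewrite {2}/set_at [w == _]eq_sym; case: (row e =P w) => [rw|_] /=; last exact: old.
  by split=> //; rewrite set_at_eq; apply: old; rewrite rw; exact: HD.
- move=> st k1 fr [lei HD kk].
  have Em' : imem st 0 1 = m by rewrite (proj1 fr) // /st1; mem_simp.
  mem_simp; rewrite Em' negbK => iM; split; first lia.
  have Ei : imem st xE 0 = m by lia.
  by rewrite Ei in HD; move=> fr'; apply: HQ => //; lia.
Qed.

Lemma wp_total_size st0 Q k : imem st0 0 2 = r -> imem st0 0 0 = n ->
  imem st0 xBase 0 = 0 -> 10 * r + 10 <= k ->
  (forall st k', frame total_size st0 st -> imem st xBase 0 = r * n ->
    k - (10 * r + 10) <= k' -> Q st k') ->
  wp total_size Q st0 k.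
Proof.
move=> Er En Eb k0 HQ; apply: wp_frame; rewrite /total_size; wp_run.
set st1 := Store _ _; set rest := k - _ in HQ.
pose Inv st k' := [/\ imem st xI 0 <= r, imem st xBase 0 = imem st xI 0 * n &
  10 * (r - imem st xI 0) + 1 + rest <= k'].
apply: (@wp_while _ Inv) => //.
- by rewrite /Inv /st1; mem_simp; split=> //; rewrite /rest; lia.
- move=> st k1 fr [lei HB kk].
  have En' : imem st 0 0 = n by rewrite (proj1 fr) // /st1; mem_simp.
  have Er' : imem st 0 2 = r by rewrite (proj1 fr) // /st1; mem_simp.
  mem_simp; rewrite Er' => iR; split; first lia.
  wp_run; rewrite /Inv; mem_simp; rewrite En' HB !addn1; split; try lia.

- move=> st k1 fr [lei HB kk].
  have Er' : imem st 0 2 = r by rewrite (proj1 fr) // /st1; mem_simp.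
  mem_simp; rewrite Er' negbK => iR; split; first lia.
  have Ei : imem st xI 0 = r by lia.
  by rewrite Ei in HB; move=> fr'; apply: HQ => //; lia.
Qed.

Definition total_cost := 10 * m + 10 * r + 30 + (add_costs r + r * stage_cost).

Lemma visualize_correct st0 :
  imem st0 0 0 = n -> imem st0 0 1 = m -> imem st0 0 2 = r ->
  imem st0 aRow = row -> imem st0 aCol = col -> imem st0 aPart = part ->
  rmem st0 rVal = val -> rmem st0 rLam = lam ->
  (forall a i, 3 < a -> imem st0 a i = 0) -> (forall a i, 1 < a -> rmem st0 a i = 0%R) ->
  exists t st, [/\ exec visualize st0 t st, t <= step_cost * total_cost &
    forall s, s < r -> stage_done st s].
Proof.
move=> En Em Er Erow Ecol Epart Eval Elam Ei Err.
have [t [j [st [ex tj jk HQ]]]] : wp visualize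
    (fun st _ => forall s, s < r -> stage_done st s) st0 total_cost; last first.
  exists t, st; split=> //; apply: leq_trans tj _; by rewrite leq_mul2l jk orbT.
rewrite /visualize /total_cost; apply: wp_seq; apply: wp_adjacency => //.
- by move=> w; rewrite Ei.
- by lia.
move=> st1 k1 fr1 Hadj kk1; apply: wp_seq; apply: wp_total_size; try by rewrite (proj1 fr1).
- by rewrite (proj1 fr1) // Ei.
- by lia.
move=> st2 k2 fr2 EB2 kk2; apply: wp_seq; wp_assign.
set st3 := Store _ _.
have fr3 : frame (xS ::= IConst 0) st2 st3 by exact: frame_iset.
have Eim a : a \notin [:: aHead; aNext; xE; xBase; xI; xS] -> imem st3 a = imem st0 a.
  rewrite !inE !negb_or => /and5P[a1 a2 a3 a4 /andP[a5 a6]].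
  rewrite (proj1 fr3) ?inE // (proj1 fr2) ?(proj1 fr1) //.
    by rewrite /= !inE !negb_or a3 a2 a1.
  by rewrite /= !inE !negb_or a4 a5.
have Erm a : rmem st3 a = rmem st0 a by rewrite (proj2 fr3) // (proj2 fr2) // (proj2 fr1).
have ES3 : imem st3 xS 0 = r by rewrite /st3; mem_simp; rewrite (proj1 fr2) // (proj1 fr1).
have EB3 : imem st3 xBase 0 = r * n by rewrite /st3; mem_simp.
have Hin3 : input st3.
  split; rewrite ?Eim ?Erm //; split; try by rewrite Eim.
  by move=> w; rewrite !(proj1 fr3) // !(proj1 fr2).
have Hrd3 : ready n K st3 (stage_set r).
  split; try by move=> *; rewrite ?Eim ?Erm // ?Ei // ?Err.
    move=> x; rewrite Eim // Ei //; symmetry; apply/negbTE/negP => /and3P[_ rx].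
    by rewrite ltnNge rx.
  by move=> x /and3P[].
apply: (wp_stages Hin3 ES3 EB3 Hrd3); first lia.
by move=> st k' H.
Qed.

End Visualize.

(** * Order and products in the max-plus semiring *)

Section MaxPlus.
Context {R : realType}.
Implicit Types x y z t : Rmax R.

(** The order in which the max-plus sum is the maximum. *)
Definition mp_le x y := (to_ereal x <= to_ereal y)%E.

Lemma mp_le_refl x : mp_le x x.
Proof. exact: lexx. Qed.

Lemma mp_le_trans y x z : mp_le x y -> mp_le y z -> mp_le x z.
Proof. exact: le_trans. Qed.

Lemma mp_leSS (a b : R) : mp_le (Some a) (Some b) = (a <= b).
Proof. by rewrite /mp_le lee_fin. Qed.

Lemma mp_addl x y : mp_le x (x + y).
Proof.
case: x y => [a|] [b|]; rewrite ?/mp_le /= ?lee_fin ?leNye //.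
by rewrite le_max lexx.
Qed.

Lemma mp_mul_mono x x' y y' : mp_le x x' -> mp_le y y' -> mp_le (x * y) (x' * y').
Proof.
case: x x' y y' => [a|] [a'|] [b|] [b'|]; rewrite /mp_le /= ?lee_fin ?leNye ?leeNy_eq //.
exact: lerD.
Qed.

Lemma mp_sum_ge (I : finType) (F : I -> Rmax R) i : mp_le (F i) (\sum_j F j).
Proof. by rewrite (bigD1 i) //; exact: mp_addl. Qed.

Lemma mp_prod_mono (I : Type) (s : seq I) (P : pred I) (F G : I -> Rmax R) :
  (forall i, P i -> mp_le (F i) (G i)) ->
  mp_le (\prod_(i <- s | P i) F i) (\prod_(i <- s | P i) G i).
Proof. by move=> FG; elim/big_ind2: _ => // *; [exact: mp_le_refl|exact: mp_mul_mono]. Qed.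

Lemma mp_exp (l : R) k : (Some l : Rmax R) ^+ k = Some (l *+ k).
Proof.
elim: k => [|k IH]; first by rewrite expr0 mulr0n.
by rewrite exprS IH mulrS.
Qed.

Lemma mp_prod_fin (I : Type) (s : seq I) (F : I -> Rmax R) :
  all (fun i => F i != 0) s ->
  \prod_(i <- s) F i = Some (\sum_(i <- s) odflt 0 (F i)).
Proof.
elim: s => [|i s IH] /=; first by rewrite !big_nil.
move=> /andP[Fi /IH E]; rewrite !big_cons E.
by case: (F i) Fi.
Qed.

End MaxPlus.

(** * Multi-circuits and the node partition *)

Section Circuits.
Context {R : realType} {n : nat}.
Implicit Types (A : 'M[Rmax R]_n) (c : seq 'I_n) (M : seq (seq 'I_n)).

Definition arc_weight A (e : 'I_n * 'I_n) : R := odflt 0 (A e.1 e.2).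
Definition circuit_weight A c := \sum_(e <- zip c (rot 1 c)) arc_weight A e.

Lemma path_all (T : eqType) (e : rel T) x y p :
  path.path e x (rcons p y) = all (fun a => e a.1 a.2) (zip (x :: p) (rcons p y)).
Proof. by elim: p x => //= z p IH x; rewrite IH. Qed.

Lemma cycle_all (T : eqType) (e : rel T) (c : seq T) :
  path.cycle e c = all (fun a => e a.1 a.2) (zip c (rot 1 c)).
Proof. by case: c => //= x p; rewrite rot1_cons -path_all. Qed.

Lemma circuit_weightE A c : circuit A c -> weight A c = Some (circuit_weight A c).
Proof. by move=> /andP[_]; rewrite cycle_all => /mp_prod_fin. Qed.

Lemma map_next (T : eqType) (c : seq T) : uniq c -> map (next c) c = rot 1 c.
Proof.
case: c => //= x p up; rewrite rot1_cons; apply: (@eq_from_nth _ x).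
  by rewrite /= size_map size_rcons.
move=> i; rewrite /= size_map => ip.
have -> : nth x (next (x :: p) x :: map (next (x :: p)) p) i =
    next (x :: p) (nth x (x :: p) i) by rewrite -(nth_map x x (next (x :: p)) (s := x :: p)).
rewrite next_nth mem_nth // index_uniq // nth_rcons.
move: ip; rewrite ltnS leq_eqVlt => /predU1P[->|ip]; last by rewrite ip.
by rewrite ltnn eqxx nth_default.
Qed.

Lemma weight_next A c : uniq c -> weight A c = \prod_(i <- c) A i (next c i).
Proof.
move=> uc; rewrite /weight -map_next //.
have -> : zip c (map (next c) c) = [seq (i, next c i) | i <- c].
  by rewrite -[X in zip X _]map_id zip_map.
by rewrite big_map.
Qed.

(** The permutation whose nontrivial cycles are the circuits of [M]. *)
Fixpoint mc_next M : 'I_n -> 'I_n :=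
  if M is c :: M' then fun i => if i \in c then next c i else mc_next M' i else id.

Lemma mc_next_out M i : i \notin flatten M -> mc_next M i = i.
Proof.
elim: M => //= c M IH; rewrite mem_cat negb_or => /andP[ic iM].
by rewrite (negbTE ic) IH.
Qed.

Lemma mc_next_in M i : i \in flatten M -> mc_next M i \in flatten M.
Proof.
elim: M => //= c M IH; rewrite !mem_cat; case: ifP => [ic _|_ /= iM].
  by rewrite mem_next ic.
by rewrite IH ?orbT.
Qed.

Lemma mc_next_inj M : uniq (flatten M) -> injective (mc_next M).
Proof.
elim: M => [|c M IH] /=; first by move=> _ i j.
rewrite cat_uniq => /and3P[uc /hasPn dis uM].
have out i : i \notin c -> mc_next M i \notin c.
  move=> ic; have [iM|iM] := boolP (i \in flatten M); last by rewrite mc_next_out.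
  exact: dis (mc_next_in iM).
move=> i j; case: ifP => [ic|/negbT ic]; case: ifP => [jc|/negbT jc] E.
- by rewrite -(prev_next uc i) E prev_next.
- by have := out _ jc; rewrite -E mem_next ic.
- by have := out _ ic; rewrite E mem_next jc.
- exact: IH.
Qed.

(** [mc_next] is one of the permutations in the determinant; the nodes outside the
    circuits contribute the diagonal entry lambda. *)
Lemma char_fun_ge A M (l : R) : multicircuit A M ->
  mp_le (mc_weight A M * (Some l : Rmax R) ^+ (n - mc_length M)) (char_fun A (Some l)).
Proof.
move=> /andP[_ uM].
pose s := perm (mc_next_inj uM).
apply: mp_le_trans (mp_sum_ge _ s).
rewrite (bigID (mem (flatten M))) /=; apply: mp_mul_mono.
  have -> : mc_weight A M = \prod_(i in flatten M) A i (s i).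
    rewrite -big_uniq //= (eq_bigr (fun i => A i (mc_next M i))); last first.
      by move=> i _; rewrite permE.
    rewrite {s}; elim: M uM => [|c M IH]; first by rewrite /mc_weight !big_nil.
    rewrite /= cat_uniq => /and3P[uc /hasPn dis uM].
    rewrite /mc_weight big_cons big_cat -/(mc_weight A M) IH //= weight_next //.
    congr (_ * _); first by apply: eq_big_seq => i ->.
    by apply: eq_big_seq => i /dis /negbTE ->.
  by apply: mp_prod_mono => i _; rewrite !mxE; exact: mp_addl.
have -> : (Some l : Rmax R) ^+ (n - mc_length M) =
    \prod_(i | i \notin flatten M) (Some l : Rmax R).
  rewrite prodr_const; congr (_ ^+ _).
  have -> : mc_length M = #|[pred i in flatten M]|.
    rewrite (card_uniqP uM) size_flatten /mc_length /shape.
    by elim: M {uM s} => [|c M IH]; rewrite ?big_nil // big_cons IH.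
  by move: (cardC [pred i in flatten M]); rewrite card_ord; set a := #|_|; set b := #|_|; lia.
apply: mp_prod_mono => i iM; rewrite !mxE permE mc_next_out // eqxx.
by rewrite addrC mulr1; exact: mp_addl.
Qed.

(** Positive if and only if the mean weight of [c] is above [l]. *)
Definition excess A (l : R) c : R := circuit_weight A c - l *+ size c.

Lemma mc_weightE A M : multicircuit A M ->
  mc_weight A M = Some (\sum_(c <- M) circuit_weight A c).
Proof.
move=> /andP[/allP HM _]; rewrite /mc_weight.
have E : {in M, forall c, weight A c = Some (circuit_weight A c)}.
  by move=> c /HM /andP[Hc _]; exact: circuit_weightE.
rewrite (eq_big_seq _ E) mp_prod_fin //.
by apply/allP.
Qed.

Lemma mc_length_le M : uniq (flatten M) -> (mc_length M <= n)%N.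
Proof.
move=> uM; have -> : mc_length M = size (flatten M).
  rewrite size_flatten /mc_length /shape.
  by elim: M {uM} => [|c M IH]; rewrite ?big_nil // big_cons IH.
by rewrite -(card_uniqP uM) -[leqRHS]card_ord max_card.
Qed.

Lemma mc_value A M (l : R) : multicircuit A M ->
  mc_weight A M * (Some l : Rmax R) ^+ (n - mc_length M) =
  Some (\sum_(c <- M) excess A l c + l *+ n).
Proof.
move=> HM; rewrite mc_weightE // mp_exp; congr Some.
rewrite /excess sumrB mulrnBr; last by apply: mc_length_le; case/andP: HM.
have -> : \sum_(c <- M) l *+ size c = l *+ mc_length M by rewrite /mc_length -sumrMnr.
by rewrite addrAC addrA.
Qed.

Lemma MMC_max A l M M' : is_MMC A l M -> multicircuit A M' ->
  \sum_(c <- M') excess A l c <= \sum_(c <- M) excess A l c.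
Proof.
move=> [HM E] HM'; have := char_fun_ge l HM'.
by rewrite E !mc_value // mp_leSS lerD2r.
Qed.

Lemma multicircuit_cons A M c : elementary_circuit A c ->
  (forall v, v \in c -> v \notin flatten M) ->
  multicircuit A M -> multicircuit A (c :: M).
Proof.
move=> Hc dis /andP[HM uM]; rewrite /multicircuit /= Hc HM /= cat_uniq uM andbT.
case/andP: Hc => _ ->; apply/hasPn => v vM; apply/negP => /dis; by rewrite vM.
Qed.

(** Otherwise adding [c] would improve a maximal multi-circuit. *)
Lemma excess_disjoint A l M c : is_MMC A l M -> elementary_circuit A c ->
  (forall v, v \in c -> v \notin flatten M) -> excess A l c <= 0.
Proof.
move=> HM Hc dis; have := MMC_max HM (multicircuit_cons Hc dis (proj1 HM)).
by rewrite big_cons gerDr.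
Qed.

Lemma uniq_flatten_rem (M : seq (seq 'I_n)) c : c \in M -> uniq (flatten M) ->
  uniq (flatten (rem c M)).
Proof.
move=> cM; have /perm_flatten pM := perm_to_rem cM.
by rewrite (perm_uniq pM) /= cat_uniq => /and3P[].
Qed.

(** Otherwise removing [c] would improve a maximal multi-circuit. *)
Lemma excess_member A l M c : is_MMC A l M -> c \in M -> 0 <= excess A l c.
Proof.
move=> HM cM; have /andP[HA uM] := proj1 HM.
have HM' : multicircuit A (rem c M).
  rewrite /multicircuit uniq_flatten_rem // andbT; apply/allP => d /mem_rem.
  exact: (allP HA).
have := MMC_max HM HM'.
by rewrite [leRHS](perm_big _ (perm_to_rem cM)) big_cons lerDr.
Qed.

Definition covered (P : seq ({set 'I_n} * nat)) (v : 'I_n) :=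
  has (fun Nk : {set 'I_n} * nat => v \in Nk.1) P.

(** In the list of parts, latest first: a part is created by a circuit avoiding the
    earlier parts, at a time when all the circuits of smaller index have been
    absorbed by them. *)
Fixpoint well_formed (cs : seq (nat * seq 'I_n)) (P : seq ({set 'I_n} * nat)) : Prop :=
  if P is (N, k) :: P' then
    [/\ exists c, (k, c) \in cs /\ (forall v, v \in c -> ~~ covered P' v),
        forall j c, (j, c) \in cs -> (j < k)%N -> forall v, v \in c -> covered P' v,
        {in P', forall Nk, (Nk.2 <= k)%N} & well_formed cs P']
  else True.

Lemma well_formed_last cs P S : well_formed cs P -> well_formed cs (add_to_last P S).
Proof. by case: P => [|[N k] P]. Qed.

Lemma covered_last P S v : P != [::] ->
  covered (add_to_last P S) v = covered P v || (v \in S).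
Proof. by case: P => [|[N k] P] //= _; rewrite inE -orbA orbCA [RHS]orbC orbCA orbA. Qed.

Lemma size_last (P : seq ({set 'I_n} * nat)) S : size (add_to_last P S) = size P.
Proof. by case: P => [|[N k] P]. Qed.

Definition partition_inv (all done : seq (nat * seq 'I_n)) (st : seq ({set 'I_n} * nat) * {set 'I_n}) :=
  [/\ forall v, (v \in st.2) = covered st.1 v,
      forall j c, (j, c) \in done -> forall v, v \in c -> v \in st.2,
      well_formed all st.1,
      (size st.1 <= #|st.2|)%N &
      {in st.1, forall Nk : {set 'I_n} * nat, exists2 c, (Nk.2, c) \in done & True}].

Lemma partition_foldl all done todo st :
  all = done ++ todo -> sorted (fun a b : nat * seq 'I_n => (a.1 <= b.1)%N) all ->
  (forall k c, (k, c) \in all -> c != [::]) ->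
  partition_inv all done st ->
  partition_inv all all (foldl partition_step st todo).
Proof.
move=> + so ne; elim: todo done st => [|[k c] todo IH] done st.
  by rewrite cats0 => ->.
rewrite -cat_rcons => E Hst; rewrite [foldl _ _ _]/=; apply: (IH _ _ E).
case: st Hst => P U [/= HU Hd Hw Hs Hi].
have kcall : (k, c) \in all by rewrite E mem_cat mem_rcons mem_head.
have tr : transitive (fun a b : nat * seq 'I_n => (a.1 <= b.1)%N).
  by move=> b a d; exact: leq_trans.
have dk j d : (j, d) \in done -> (j <= k)%N.
  move=> jd; move: so; rewrite E -cats1 -catA.
  rewrite (sorted_pairwise tr) pairwise_cat => /and3P[/allrelP H _ _].
  by apply: (H (j, d) (k, c)) => //=; rewrite mem_head.
rewrite /partition_step; case: ifP => [|/negbT]; rewrite ?negbK => hUc.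
  have P0 : P != [::].
    case/set0Pn: hUc => v; rewrite !inE => /andP[_]; rewrite HU.
    by case: (P).
  split=> /=.
  - move=> v; rewrite covered_last // !inE HU.
    by case: covered.
  - move=> j d; rewrite mem_rcons inE => /predU1P[[_ ->]|jd] v vd; rewrite !inE.
      by rewrite vd orbT.
    by rewrite (Hd _ _ jd).
  - exact: well_formed_last.
  - rewrite size_last; apply: leq_trans Hs _; apply: subset_leq_card.
    exact: subsetUl.
  - case: P P0 Hi {HU Hw Hs} => // -[N j] P _ Hi Nk /=.
    rewrite inE => /predU1P[->|NkP] /=.
      have [|d jd _] := Hi (N, j); first exact: mem_head.
      by exists d => //; rewrite mem_rcons inE jd orbT.
    have [|d jd _] := Hi Nk; first by rewrite inE NkP orbT.
    by exists d => //; rewrite mem_rcons inE jd orbT.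
have dis v : v \in c -> v \notin U.
  move=> vc; apply/negP => vU; move/eqP/setP/(_ v): hUc.
  by rewrite !inE vc vU.
split=> /=.
- by move=> v; rewrite !inE HU orbC.
- move=> j d; rewrite mem_rcons inE => /predU1P[[_ ->]|jd] v vd; rewrite !inE.
    by rewrite vd orbT.
  by rewrite (Hd _ _ jd).
- split=> //.
  + by exists c; split=> // v /dis; rewrite HU.
  + move=> j d jd jk v vd; rewrite -HU; apply: (Hd j d) => //.
    move: jd; rewrite E cat_rcons mem_cat inE => /or3P[//|/eqP[Ej _]|jt].
      by rewrite Ej ltnn in jk.
    move: so; rewrite E cat_rcons.
    rewrite (sorted_pairwise tr) pairwise_cat /= => /and3P[_ _ /andP[/allP H _]].
    by have := H _ jt; rewrite /= leqNgt jk.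
  + by move=> Nk /Hi [d /dk].
- rewrite cardsU; have -> : U :&: [set v in c] = set0.
    by rewrite setIC; apply/eqP.
  rewrite cards0 subn0; have : (0 < #|[set v in c]|)%N.
    have : c != [::] by apply: (ne k).
    by case: (c) => // x p _; apply/card_gt0P; exists x; rewrite inE mem_head.
  by move=> c0; rewrite -addn1 leq_add.
- move=> Nk; rewrite inE => /predU1P[->|/Hi [d jd _]].
    by exists c => //; rewrite mem_rcons mem_head.
  by exists d => //; rewrite mem_rcons inE jd orbT.
Qed.

Lemma pairwise_indexed (F : nat -> seq (seq 'I_n)) a b :
  pairwise (fun x y : nat * seq 'I_n => (x.1 <= y.1)%N)
    (flatten [seq [seq (k, c) | c <- F k] | k <- iota a b]).
Proof.
elim: b a => //= b IH a; rewrite pairwise_cat IH andbT; apply/andP; split.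
  apply/allrelP => x y /mapP[c _ ->] /flatten_mapP[k]; rewrite mem_iota => /andP[ak _].
  by move=> /mapP[d _ ->]; exact: ltnW.
by elim: (F a) => //= c l ->; rewrite andbT; apply/allP => x /mapP[d _ ->] /=.
Qed.

Lemma well_formed_cat cs P1 P2 : well_formed cs (P1 ++ P2) -> well_formed cs P2.
Proof. by elim: P1 => //= -[N k] P1 IH [_ _ _ /IH]. Qed.

Lemma mem_part_rest (P : seq ({set 'I_n} * nat)) s v : (s <= size P)%N ->
  (v \in part_rest P s) = (s <= part_index P v)%N.
Proof.
move=> sP; rewrite leqNgt /part_index -has_take_leq // inE; congr (~~ _).
apply/bigcupP/hasP => [[i _ vi]|[Nk NkP vN]].
  exists (nth (set0, 0%N) P i) => //.
  rewrite -(@nth_take s) // mem_nth // size_take.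
  by case: ifP => _ //; exact: leq_trans (ltn_ord i) sP.
have [i iP Ei] := nthP (set0, 0%N) NkP.
have si : (i < s)%N by apply: leq_trans iP _; rewrite size_take; case: ifP => // /negbT; rewrite -leqNgt.
by exists (Ordinal si) => //; rewrite /part_set /= -(@nth_take s) // Ei.
Qed.

(** For [s] created at index k, compare at lambda_k the sets C_(k-1) and C_k, which are
    both maximal there: no circuit avoiding the parts before [s] meets C_(k-1). *)
Lemma partition_spec A (lams : seq R) (Cs : seq (seq (seq 'I_n)))
    (P := node_partition Cs) :
  sorted (fun x y => y < x) lams -> is_MMCS A lams Cs ->
  [/\ (size P <= n)%N,
      forall v, (0 < size P)%N -> (part_index P v < size P)%N,
      forall s, (s.+1 < size P)%N -> part_lam lams P s.+1 <= part_lam lams P s,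
      forall s, (s < size P)%N -> exists c, [/\ elementary_circuit A c,
        {subset c <= part_rest P s} & excess A (part_lam lams P s) c = 0] &
      forall s c, (s < size P)%N -> elementary_circuit A c ->
        {subset c <= part_rest P s} -> excess A (part_lam lams P s) c <= 0].
Proof.
move=> so [sz C0 HM HL].
pose cs := flatten [seq [seq (k, c) | c <- nth [::] Cs k] | k <- iota 1 (size Cs).-1].
have mem_cs k c : ((k, c) \in cs) <-> (0 < k <= size lams)%N /\ c \in nth [::] Cs k.
  split=> [/flatten_mapP[j]|[kp cC]].
    rewrite mem_iota sz /= => jp /mapP[d dC [-> ->]]; split=> //; lia.
  apply/flatten_mapP; exists k; last exact: map_f.
  by rewrite mem_iota sz /=; lia.
have tr : transitive (fun a b : nat * seq 'I_n => (a.1 <= b.1)%N).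
  by move=> b a d; exact: leq_trans.
have scs : sorted (fun a b : nat * seq 'I_n => (a.1 <= b.1)%N) cs.
  by rewrite (sorted_pairwise tr); exact: pairwise_indexed.
have elem k c : (k, c) \in cs -> elementary_circuit A c.
  move=> /mem_cs[/andP[_ kp] cC]; have /andP[/allP H _] := HM k kp; exact: H.
have ne k c : (k, c) \in cs -> c != [::].
  by move=> /elem /andP[/andP[]].
have I0 : partition_inv cs [::] ([::], set0).
  by split=> // v; rewrite inE.
have := @partition_foldl cs [::] cs _ (erefl cs) scs ne I0.
rewrite /P /node_partition -/cs; case: (foldl _ _ _) => Q0 U [/= HU Hd Hw Hs Hi].
pose Q := add_to_last Q0 (~: U); rewrite -/Q.
have wQ : well_formed cs Q by exact: well_formed_last.
have cQ v : Q != [::] -> covered Q v.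
  move=> Qn; rewrite /Q covered_last; last by move: Qn; rewrite /Q; case: (Q0).
  by rewrite inE HU; case: covered.
have split_at s : (s < size Q)%N -> exists Q1 N k Q', Q = Q1 ++ (N, k) :: Q' /\ size Q' = s.
  move=> sQ; exists (take (size Q - s.+1) Q).
  case E : (drop (size Q - s.+1) Q) => [|[N k] Q'].
    by move/(congr1 size): E; rewrite size_drop /=; lia.
  exists N, k, Q'; split; first by rewrite -E cat_take_drop.
  by move/(congr1 size): E; rewrite size_drop /=; lia.
have part_at Q1 N k Q' : Q = Q1 ++ (N, k) :: Q' ->
    nth (set0, 0%N) (rev Q) (size Q') = (N, k).
  by move=> ->; rewrite rev_cat rev_cons cat_rcons nth_cat size_rev ltnn subnn.
have rest_at Q1 N k Q' v : Q = Q1 ++ (N, k) :: Q' ->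
    (v \in part_rest (rev Q) (size Q')) = ~~ covered Q' v.
  move=> EQ; rewrite mem_part_rest; last by rewrite size_rev EQ size_cat /=; lia.
  rewrite leqNgt /part_index -has_take_leq; last by rewrite size_rev EQ size_cat /=; lia.
  by rewrite EQ rev_cat rev_cons cat_rcons take_size_cat ?size_rev // has_rev.
have lamk k : (0 < k <= size lams)%N -> (lam_ext lams k = (lams`_k.-1)%:E).
  by case: k => // k; rewrite /lam_ext => /= ->.
have trR : transitive (fun x y : R => y < x) by move=> b a d ab bd; exact: lt_trans ab.
have decr i j : (i < j < size lams)%N -> lams`_j < lams`_i.
  by move=> /andP[ij js]; apply: (sorted_ltn_nth trR 0 so) => //; rewrite inE; lia.
have MMC1 k : (0 < k <= size lams)%N -> is_MMC A lams`_k.-1 (nth [::] Cs k).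
  move=> kp; apply: HL; first by case/andP: kp.
  rewrite (lamk k) // lexx andbT /lam_ext; case: ifP => [ks|_]; last exact: leNye.
  by rewrite lee_fin; apply/ltW/decr; lia.
have MMC0 k : (0 < k <= size lams)%N -> is_MMC A lams`_k.-1 (nth [::] Cs k.-1).
  move=> kp; apply: HL; first by lia.
  rewrite prednK; last by case/andP: kp.
  rewrite lamk // lexx /=; case: k kp => // -[|k] kp; first exact: leey.
  by rewrite lamk /=; [rewrite lee_fin; apply/ltW/decr; lia|lia].
have before k Q' N : well_formed cs ((N, k) :: Q') -> (0 < k <= size lams)%N ->
    forall v, ~~ covered Q' v -> v \notin flatten (nth [::] Cs k.-1).
  move=> [_ Hb _ _] kp v; apply: contra => /flattenP[c cC vc].
  case: k kp Hb cC => // -[|k] kp Hb cC /=; first by rewrite C0 in cC.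
  by apply: (Hb k.+1 c) => //; apply/mem_cs; split=> //; lia.
split.
- rewrite size_rev size_last; apply: leq_trans Hs _.
  by rewrite -[leqRHS]card_ord max_card.
- move=> v; rewrite /part_index -has_find size_rev => Q0'.
  by rewrite has_rev; apply: cQ; rewrite -size_eq0 -lt0n.
- move=> s; rewrite size_rev => s1; have [Q1 [N [k [Q' [EQ sQ']]]]] := split_at _ s1.
  case: Q' EQ sQ' => [//|[N' k'] Q'] EQ [sQ'].
  have EQ' : Q = (Q1 ++ [:: (N, k)]) ++ (N', k') :: Q' by rewrite -catA.
  rewrite /part_lam -sQ' (part_at _ _ _ _ EQ').
  rewrite -[(size Q').+1]/(size ((N', k') :: Q')) (part_at _ _ _ _ EQ) /=.
  have := well_formed_cat (P1 := Q1) (P2 := (N, k) :: (N', k') :: Q').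
  rewrite -EQ => /(_ _ wQ) [[c [kc _]] _ Hk [[c' [kc' _]] _ _ _]].
  have [/andP[k0 ks] _] := (mem_cs k c).1 kc; have [/andP[k0' ks'] _] := (mem_cs k' c').1 kc'.
  have := Hk (N', k') (mem_head _ _); rewrite /= leq_eqVlt => /predU1P[->//|k'k].
  by apply/ltW/decr; lia.
- move=> s; rewrite size_rev => s1; have [Q1 [N [k [Q' [EQ <-]]]]] := split_at _ s1.
  have wQ' : well_formed cs ((N, k) :: Q').
    by apply: (@well_formed_cat _ Q1); rewrite -EQ.
  have [[c [kc cQ']] _ _ _] := wQ'; have [kp cC] := (mem_cs k c).1 kc.
  exists c; split; first exact: elem kc.
    by move=> v vc; rewrite (rest_at _ _ _ _ _ EQ); exact: cQ'.
  rewrite /part_lam (part_at _ _ _ _ EQ) /=; apply/eqP; rewrite eq_le.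
  rewrite (excess_member (MMC1 _ kp) cC) andbT.
  apply: (excess_disjoint (MMC0 _ kp) (elem _ _ kc)) => v vc.
  exact: (before _ _ _ wQ' kp v (cQ' v vc)).
- move=> s c; rewrite size_rev => s1; have [Q1 [N [k [Q' [EQ <-]]]]] := split_at _ s1.
  have wQ' : well_formed cs ((N, k) :: Q').
    by apply: (@well_formed_cat _ Q1); rewrite -EQ.
  have [[d [kd _]] _ _ _] := wQ'; have [kp _] := (mem_cs k d).1 kd.
  move=> Hc cV; rewrite /part_lam (part_at _ _ _ _ EQ) /=.
  apply: (excess_disjoint (MMC0 _ kp) Hc) => v /cV; rewrite (rest_at _ _ _ _ _ EQ).
  exact: (before _ _ _ wQ' kp v).
Qed.

End Circuits.

(** * Closed paths and visualization *)

Section Cycles.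
Context {R : realType} {n : nat}.
Implicit Types (A : 'M[Rmax R]_n) (c p : seq 'I_n).

Lemma sum_const_seq (I : Type) (s : seq I) (x : R) : \sum_(i <- s) x = x *+ size s.
Proof. by rewrite big_const_seq count_predT iter_addr_0. Qed.

Fixpoint path_sum (f : 'I_n -> 'I_n -> R) x p : R :=
  if p is y :: p' then f x y + path_sum f y p' else 0.

Lemma path_sum_cat f x p q :
  path_sum f x (p ++ q) = path_sum f x p + path_sum f (seq.last x p) q.
Proof. by elim: p x => [|y p IH] x /=; rewrite ?add0r // IH addrA. Qed.

Lemma path_sum_zip f x p y : path_sum f x (rcons p y) =
  \sum_(e <- zip (x :: p) (rcons p y)) f e.1 e.2.
Proof.
elim: p x => [|z p IH] x /=; first by rewrite big_seq1 addr0.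
by rewrite IH [RHS]big_cons.
Qed.

(** Entry of the matrix A minus [l], as a real number. *)
Definition reduced A (l : R) (i j : 'I_n) := arc_weight A (i, j) - l.

Lemma excess_path_sum A l x p :
  excess A l (x :: p) = path_sum (reduced A l) x (rcons p x).
Proof.
rewrite path_sum_zip /excess /circuit_weight rot1_cons /reduced sumrB.
rewrite [in RHS](eq_bigr (arc_weight A)); last by case.
by congr (_ - _); rewrite sum_const_seq size_zip size_rcons minnn.
Qed.

Lemma not_uniq_split (T : eqType) (s : seq T) : ~~ uniq s ->
  exists s1 z s2 s3, s = s1 ++ z :: s2 ++ z :: s3.
Proof.
elim: s => //= y s IH; rewrite negb_and negbK => /orP[ys|/IH].
  by case/splitPr: ys => s2 s3; exists [::], y, s2, s3.
by move=> [s1 [z [s2 [s3 ->]]]]; exists (y :: s1), z, s2, s3.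
Qed.

(** A closed path that repeats a node splits there into two shorter ones. *)
Lemma closed_path_sum A l (V : {set 'I_n}) x p :
  (forall c, elementary_circuit A c -> {subset c <= V} -> excess A l c <= 0) ->
  path.path (fun i j => A i j != 0) x p -> seq.last x p = x -> {subset p <= V} ->
  path_sum (reduced A l) x p <= 0.
Proof.
move=> Hel; have [k pk] := ubnP (size p); elim: k => // k IH in x p pk *.
move=> Hp Hl Hs; have [up|/not_uniq_split [p1 [z [p2 [p3 E]]]]] := boolP (uniq p).
  case: p pk Hp Hl Hs up => // y q pk Hp Hl Hs up.
  have -> : path_sum (reduced A l) x (y :: q) = excess A l (y :: q).
    rewrite excess_path_sum -cats1 path_sum_cat /= addr0 addrC.
    by move: Hl => /= ->.
  apply: Hel => //; rewrite /elementary_circuit /circuit up andbT /=.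
  by rewrite rcons_path; move: Hp Hl => /= /andP[exy ->] ->.
have Ep : p = (p1 ++ [:: z]) ++ (p2 ++ [:: z]) ++ p3 by rewrite E -!catA.
move: Hp Hl Hs pk; rewrite {}Ep {E} !cat_path !last_cat /=.
move=> /andP[/andP[h1 /andP[h2 _]] /andP[/andP[h3 /andP[h4 _]] h5]] Hl Hs.
rewrite !size_cat /= => pk.
have S1 : path_sum (reduced A l) z (p2 ++ [:: z]) <= 0.
  apply: IH; [by rewrite size_cat /=; lia|by rewrite cat_path h3 /= h4|by rewrite last_cat|].
  by move=> v vp; apply: Hs; rewrite !mem_cat in vp *; case/orP: vp => ->; rewrite ?orbT.
have S2 : path_sum (reduced A l) x ((p1 ++ [:: z]) ++ p3) <= 0.
  apply: IH; [by rewrite !size_cat /=; lia|by rewrite !cat_path h1 /= h2 last_cat|by rewrite !last_cat|].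
  by move=> v vp; apply: Hs; rewrite !mem_cat in vp *; case/orP: vp => ->; rewrite ?orbT.
move: S1 S2; rewrite !path_sum_cat !last_cat /=; lra.
Qed.

Lemma potential_cycle (d : 'I_n -> R) c :
  \sum_(e <- zip c (rot 1 c)) (d e.2 - d e.1) = 0.
Proof.
have E1 : \sum_(e <- zip c (rot 1 c)) d e.1 = \sum_(v <- c) d v.
  by rewrite -(big_map fst xpredT d) -/(unzip1 _) unzip1_zip ?size_rot.
have E2 : \sum_(e <- zip c (rot 1 c)) d e.2 = \sum_(v <- rot 1 c) d v.
  by rewrite -(big_map snd xpredT d) -/(unzip2 _) unzip2_zip ?size_rot.
by rewrite sumrB E1 E2 (perm_big _ (permEl (perm_rot 1 c))) subrr.
Qed.

Lemma scaledE k (B : 'M[Rmax R]_k) l (d : 'rV[R]_k) i j :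
  scaled B l d i j =
  if B i j is Some b then Some (b - l + d 0 j - d 0 i) else None.
Proof.
rewrite /scaled mul_mx_diag mul_diag_mx !mxE.
case: (B i j) => [b|//]; congr Some => /=.
by rewrite -[LHS]/(- l + (- d 0 i + b + d 0 j)); ring.
Qed.

Lemma zip_map_map (S T : Type) (f : S -> T) s t :
  zip (map f s) (map f t) = [seq (f e.1, f e.2) | e <- zip s t].
Proof. by elim: s t => [|x s IH] [|y t] //=; rewrite IH. Qed.

(** Along a circuit the terms of the potential cancel, so a circuit of mean [l] in A
    has mean 0 after scaling; no mean is positive since no entry is. *)
Lemma visualized_scaled A (V : {set 'I_n}) l (d : 'rV[R]_#|V|) :
  (forall i j, (to_ereal (scaled (restrict A V) l d i j) <= 0%:E)%E) ->
  (exists c, [/\ elementary_circuit A c, {subset c <= V} & excess A l c = 0]) ->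
  visualized (scaled (restrict A V) l d).
Proof.
set A' := scaled _ _ _ => le0 [c [/andP[/andP[c0 Hc] uc] cV exc]].
exists 0; split=> //; split; last first.
  move=> c' w Hc'; rewrite circuit_weightE // => -[<-].
  have [s0|s0] := leqP (size c') 0; first by case: c' Hc' s0 => // /andP[].
  rewrite pmulr_lle0 ?invr_gt0 ?ltr0n //; apply: sumr_le0 => -[i j] _.
  have := le0 i j; rewrite /arc_weight /=; case: (A' i j) => [a|] //=.
case: c c0 Hc uc cV exc => // x p _ Hc uc cV exc.
have xV : x \in V by apply: cV; exact: mem_head.
pose f := enum_rank_in xV; pose c := x :: p.
have fK v : v \in V -> enum_val (f v) = v by move=> vV; rewrite enum_rankK_in.
have A'E u v : u \in V -> v \in V -> A' (f u) (f v) =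
    if A u v is Some a then Some (a - l + d 0 (f v) - d 0 (f u)) else None.
  by move=> uV vV; rewrite /A' scaledE /restrict mxE !fK.
have Hc' : circuit A' (map f c).
  rewrite /circuit cycle_map; apply/andP; split=> //.
  move: Hc; rewrite -/c !cycle_all => /allP H; apply/allP => -[u v] uv /=.
  have uV : u \in V by apply: cV; move: uv => /(map_f fst); rewrite -/(unzip1 _) unzip1_zip ?size_rot.
  have vV : v \in V.
    by apply: cV; move: uv => /(map_f snd); rewrite -/(unzip2 _) unzip2_zip ?size_rot // mem_rot.
  by rewrite A'E //; have := H _ uv => /=; case: (A u v).
exists (map f c), 0; split=> //; last by rewrite mul0r.
rewrite circuit_weightE //; congr Some.
rewrite /circuit_weight -map_rot zip_map_map big_map.
rewrite -[RHS]exc /excess /circuit_weight -[x :: p]/c.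
have -> : l *+ size c = \sum_(e <- zip c (rot 1 c)) l.
  by rewrite sum_const_seq ?size_zip ?size_rot ?minnn.
rewrite -sumrB -[RHS]addr0 -[X in _ = _ + X](potential_cycle (fun v => d 0 (f v)) c) -big_split /=.
apply: eq_big_seq => -[u v] uv /=.
have uV : u \in V by apply: cV; move: uv => /(map_f fst); rewrite -/(unzip1 _) unzip1_zip ?size_rot.
have vV : v \in V.
  by apply: cV; move: uv => /(map_f snd); rewrite -/(unzip2 _) unzip2_zip ?size_rot // mem_rot.
rewrite /arc_weight /= A'E //.
move: Hc; rewrite -/c cycle_all => /allP /(_ _ uv) /=.
by case: (A u v) => //= a _; rewrite addrA.
Qed.

End Cycles.

(** * The arc list of a matrix *)

Section Bridge.
Context {R : realType} {n : nat} (A : 'M[Rmax R]_n) (es : seq (nat * nat * R)).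
Context (Hes : perm_eq es (entries (@nat_of_ord n) A)).

Definition row_at e := nth 0%N [seq a.1.1 | a <- es] e.
Definition col_at e := nth 0%N [seq a.1.2 | a <- es] e.
Definition val_at e := nth 0 [seq a.2 | a <- es] e.

Lemma size_entries : size es = nb_finite A.
Proof.
rewrite (perm_size Hes) size_map size_filter /nb_finite cardE size_filter -enumT.
by apply: eq_count => e; rewrite ?inE.
Qed.

Lemma arc_at e : (e < size es)%N ->
  exists i j : 'I_n, [/\ row_at e = i, col_at e = j & A i j = Some (val_at e)].
Proof.
move=> em; have := mem_nth (0%N, 0%N, 0) em.
rewrite (perm_mem Hes) => /mapP[[i j]]; rewrite mem_filter /= => /andP[Aij _] E.
exists i, j; rewrite /row_at /col_at /val_at !(nth_map (0%N, 0%N, 0)) // E /=.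
by split=> //; case: (A i j) Aij.
Qed.

Lemma arc_of i j a : A i j = Some a -> exists e,
  [/\ (e < size es)%N, row_at e = i, col_at e = j & val_at e = a].
Proof.
move=> Aij; have : (nat_of_ord i, nat_of_ord j, a) \in es.
  rewrite (perm_mem Hes); apply/mapP; exists (i, j); last by rewrite /= Aij.
  by rewrite mem_filter /= Aij mem_enum.
move=> /(nthP (0%N, 0%N, 0)) [e em E]; exists e.
by rewrite /row_at /col_at /val_at !(nth_map (0%N, 0%N, 0)) // E.
Qed.

Lemma uniq_positions : uniq [seq a.1 | a <- es].
Proof.
rewrite (perm_uniq (perm_map _ Hes)) -map_comp map_inj_uniq.
  by apply: filter_uniq; exact: enum_uniq.
by move=> [i j] [i' j'] /= [/val_inj -> /val_inj ->].
Qed.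

Lemma position_inj e f : (e < size es)%N -> (f < size es)%N ->
  row_at e = row_at f -> col_at e = col_at f -> e = f.
Proof.
move=> em fm; rewrite /row_at /col_at !(nth_map (0%N, 0%N, 0)) // => Er Ec.
apply/eqP; rewrite -(nth_uniq (0%N, 0%N) _ _ uniq_positions) ?size_map //.
rewrite !(nth_map (0%N, 0%N, 0)) //; move: Er Ec.
by case: (nth _ es e) => -[a b] x; case: (nth _ es f) => -[c d] y /= -> ->.
Qed.

(** Walks along the arc list are paths of the graph of the matrix. *)
Lemma walk_path (l : R) (W : nat -> bool) x y t :
  (forall z, W z -> (z < n)%N) ->
  walk (size es) row_at col_at (fun e => l - val_at e) W x y t ->
  exists (i : 'I_n) p, [/\ i = x :> nat, seq.last i p = y :> nat,
    path.path (fun i j => A i j != 0) i p, {in i :: p, forall v : 'I_n, W v} &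
    t = - path_sum (reduced A l) i p].
Proof.
move=> Wn; elim=> {y t} [Wx|y t e _ [i [p [ix py Hp Hs ->]]] em re Wc].
  exists (Ordinal (Wn x Wx)), [::]; split=> //=; last by rewrite oppr0.
  by move=> v; rewrite inE => /eqP ->.
have [i' [j [ri cj Aij]]] := arc_at em.
have Ei : seq.last i p = i' by apply: val_inj; rewrite /= py -re ri.
exists i, (rcons p j); split=> //.
- by rewrite last_rcons.
- by rewrite rcons_path Hp Ei /= Aij.
- move=> v; rewrite -rcons_cons mem_rcons inE => /predU1P[->|]; last exact: Hs.
  by rewrite -cj.
- rewrite -cats1 path_sum_cat /= Ei /reduced /arc_weight /= Aij /=; ring.
Qed.

Lemma no_neg_cycle_excess (l : R) (W : nat -> bool) (V : {set 'I_n}) :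
  (forall z, W z -> (z < n)%N) -> (forall v : 'I_n, W v -> v \in V) ->
  (forall c, elementary_circuit A c -> {subset c <= V} -> excess A l c <= 0) ->
  no_neg_cycle (size es) row_at col_at (fun e => l - val_at e) W.
Proof.
move=> Wn WV Hel x t /(walk_path Wn) [i [p [ix px Hp Hs ->]]].
rewrite oppr_ge0; apply: (closed_path_sum Hel Hp).
  by apply: val_inj; rewrite /= px ix.
by move=> v vp; apply: WV; apply: Hs; rewrite inE vp orbT.
Qed.

(** Both lists have no repetition, because an arc is determined by its two ends. *)
Lemma entries_scaled (V : {set 'I_n}) (l : R) (d : 'rV[R]_#|V|) (dv : nat -> R)
    (stays : pred nat) (out : seq (nat * nat * R)) :
  (forall j : 'I_#|V|, d 0 j = dv (enum_val j)) ->
  (forall e (i j : 'I_n), (e < size es)%N -> row_at e = i :> nat -> col_at e = j :> nat ->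
     stays e = (i \in V) && (j \in V)) ->
  out = [seq (row_at e, col_at e, val_at e - l + dv (col_at e) - dv (row_at e))
        | e <- iota 0 (size es) & stays e] ->
  perm_eq out (entries (fun j : 'I_#|V| => nat_of_ord (enum_val j))
                 (scaled (restrict A V) l d)).
Proof.
move=> Hd Hst ->; apply: uniq_perm.
- rewrite map_inj_in_uniq; first by apply: filter_uniq; exact: iota_uniq.
  move=> e f.
  rewrite !mem_filter !mem_iota !add0n => /andP[_ /andP[_ em]] /andP[_ /andP[_ fm]].
  by move=> [Er Ec _]; exact: position_inj.
- rewrite map_inj_in_uniq; first by apply: filter_uniq; exact: enum_uniq.
  move=> [i j] [i' j'] _ _ /=.
  by move=> [/val_inj/enum_val_inj -> /val_inj/enum_val_inj -> _].
move=> x; apply/mapP/mapP => [[e]|[[i j]]].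
  rewrite mem_filter mem_iota add0n => /andP[se /andP[_ em]] ->.
  have [i [j [ri cj Aij]]] := arc_at em.
  move: se; rewrite (Hst e i j em ri cj) => /andP[iV jV].
  have Ei := enum_rankK_in iV iV; have Ej := enum_rankK_in iV jV.
  exists (enum_rank_in iV i, enum_rank_in iV j).
    by rewrite mem_filter mem_enum andbT /= scaledE /restrict mxE Ei Ej Aij.
  by rewrite /= scaledE /restrict mxE !Hd Ei Ej Aij ri cj.
rewrite mem_filter mem_enum andbT /= scaledE /restrict mxE.
case Aij : (A (enum_val i) (enum_val j)) => [a|] // _ ->.
have [e [em re ce ve]] := arc_of Aij; exists e; last by rewrite re ce ve !Hd.
by rewrite mem_filter mem_iota em (Hst e _ _ em re ce) !enum_valP.
Qed.

Lemma nb_finite_le : (nb_finite A <= n * n)%N.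
Proof. by apply: leq_trans (max_card _) _; rewrite card_prod !card_ord. Qed.

End Bridge.

(** * The time bound *)

(** By [rank_size], a bound on the ranks when there are at most [m] heap nodes. *)
Definition rank_limit m := (trunc_log 2 m).*2.+1.

Lemma rank_limitP m r : (2 ^ r./2 <= m)%N -> (r <= rank_limit m)%N.
Proof. by move=> /(trunc_log_max (isT : 1 < 2)%N); rewrite /rank_limit; lia. Qed.

Lemma total_cost_le n m r K part : (r <= n)%N ->
  (total_cost n m r K part <= 10 * m + 10 * n + 30 +
     (n * (n * (60 * K + 100) + 300 * m + 100) + n * (20 * n + 10 * m + 50)))%N.
Proof.
move=> rn; rewrite /total_cost /stage_cost.
have : (add_costs n m K part r <= n * add_cost n m K)%N.
  rewrite /add_costs -[X in (_ <= X * _)%N]subn0 -sum_nat_const_nat.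
  by apply: leq_sum => v _; case: ifP.
have : (r * (20 * n + 10 * m + 50) <= n * (20 * n + 10 * m + 50))%N by rewrite leq_mul2r rn orbT.
rewrite /add_cost; lia.
Qed.

(** The numbers of steps are compared with n m + n^2 L for L = log_2 n, at least 1 when
    n > 1, where the ranks are at most 5 L because m <= n^2.  For n <= 1 the cost is
    bounded by a constant, covered by the term 1. *)
Lemma time_bound (R : realType) n m r part t :
  (m <= n * n)%N -> (r <= n)%N -> (t <= step_cost * total_cost n m r (rank_limit m) part)%N ->
  t%:R <= (64 * 700 * (1 + (ln 2)^-1)) * (n%:R * (m%:R + n%:R * ln n%:R) + 1) :> R.
Proof.
move=> mn rn ht.
have ln2 : 0 < ln 2 :> R by apply: ln_gt0; rewrite ltr1n.
have := leq_trans ht (leq_mul (leqnn _) (total_cost_le m (rank_limit m) part rn)).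
move=> {}ht; set x := ln n%:R; set c := (ln 2)^-1.
have c0 : 0 < c by rewrite invr_gt0.
have [n2|n2] := ltnP 1 n; last first.
  have : (t <= 64 * 700)%N.
    by apply: leq_trans ht _; rewrite /step_cost /rank_limit; move: mn; case: n n2 {rn x} => [|[|//]] _; case: m => [|[|//]].
  rewrite -(ler_nat R) => /le_trans; apply.
  have x0 : 0 <= x.
    by rewrite /x; case: (n) n2 => [|[|]] // _; rewrite ?ln1 // ln0.
  have : 0 <= n%:R * (m%:R + n%:R * x) by rewrite mulr_ge0 // addr_ge0 // mulr_ge0.
  move: (n%:R * _) => y y0; nra.
have ln2n : ln 2 <= x by rewrite ler_ln ?posrE ?ltr0n ?ler_nat //; lia.
pose L := x * c.
have L1 : 1 <= L by rewrite /L -(mulfV (lt0r_neq0 ln2)) ler_wpM2r // ltW.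
have logm : (trunc_log 2 m)%:R <= 2 * L.
  have [->|m0] := posnP m; first by rewrite trunc_log0 mulr_ge0 // (le_trans _ L1).
  have : (2 ^ trunc_log 2 m <= n ^ 2)%N.
    by rewrite -mulnn; apply: leq_trans mn; exact: trunc_logP.
  rewrite -(ler_nat R) !natrX -ler_ln ?posrE ?exprn_gt0 ?ltr0n //; last lia.
  rewrite !lnXn ?ltr0n //; last lia.
  rewrite -[ln 2 *+ _]mulr_natl -[ln n%:R *+ 2]mulr_natl -/x => lnle.
  by rewrite /L /c mulrA ler_pdivlMr.
have K5 : (rank_limit m)%:R <= 5 * L.
  by rewrite /rank_limit -addn1 natrD -muln2 natrM; lra.
have a2 : 2 <= n%:R :> R by rewrite ler_nat.
have b0 : 0 <= m%:R :> R by [].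
move: ht; rewrite -(ler_nat R) => /le_trans; apply.
rewrite /step_cost !(natrM, natrD).
move: K5 a2 b0; set a := n%:R; set b := m%:R; set k := (rank_limit m)%:R => K5 a2 b0.
have aa : 0 <= a * (a - 2) by apply: mulr_ge0; lra.
have ab : 0 <= b * (a - 2) by apply: mulr_ge0; lra.
have aL : 0 <= a * a * (L - 1) by apply: mulr_ge0; [apply: mulr_ge0; lra|lra].
have ak : 0 <= a * a * (5 * L - k) by apply: mulr_ge0; [apply: mulr_ge0; lra|lra].
have xa : 0 <= a * a * x by apply: mulr_ge0; [apply: mulr_ge0; lra|lra].
have cab : 0 <= c * (a * b) by apply: mulr_ge0; [lra|apply: mulr_ge0; lra].
have EL : a * a * L = a * a * x * c by rewrite /L mulrA.
apply: (@le_trans _ _ (64 * (700 * (a * b + a * a * L)))); first by rewrite ler_pM2l //; nra.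
rewrite EL; nra.
Qed.

(** * Visualization of all the matrices A(V_s) *)

Theorem mainTheorem3 (R : realType) :
  exists (prog : cmd) (C : R),
    forall (n : nat) (A : 'M[Rmax R]_n) (rs : n.-tuple (Rmax R))
      (lams : seq R) (Cs : seq (seq (seq 'I_n))) (es : seq (nat * nat * R)),
    char_roots A rs ->
    distinct_finite_roots rs lams ->
    is_MMCS A lams Cs ->
    perm_eq es (entries (@nat_of_ord n) A) ->
    let P := node_partition Cs in
    let m := nb_finite A in
    exists (t : nat) (st : store R),
      [/\ exec prog (input_store es P lams) t st,
          t%:R <= C * (n%:R * (m%:R + n%:R * ln n%:R) + 1) &
          forall s : nat, (s < size P)%N ->
            let V := part_rest P s in
            let d := output_vec st s V in
            let A' := scaled (restrict A V) (part_lam lams P s) d in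
            [/\ perm_eq (output_entries st s)
                  (entries (fun j : 'I_#|V| => nat_of_ord (enum_val j)) A'),
                forall i j, (to_ereal (A' i j) <= 0%:E)%E &
                visualized A']].
Proof.
exists visualize, (64 * 700 * (1 + (ln 2)^-1)) => n A rs lams Cs es _ [so _] HM Hes P m.
have [Pn Pidx Pmono Pcirc Pmax] := partition_spec so HM.
have ms : size es = m := size_entries Hes.
rewrite -/P in Pn Pidx Pmono Pcirc Pmax.
set st0 := input_store es P lams.
pose part := imem st0 aPart; pose lam := rmem st0 rLam.
have partE (v : 'I_n) : part v = part_index P v.
  by rewrite /part /= (nth_map v) ?size_enum_ord // nth_ord_enum.
have lamE s : (s < size P)%N -> lam s = part_lam lams P s.
  by move=> sP; rewrite /lam /= (nth_map 0%N) ?size_iota // nth_iota.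
have Hrow e : (e < m)%N -> (row_at es e < n)%N.
  by rewrite -ms => /(arc_at Hes) [i [j [-> _ _]]].
have Hcol e : (e < m)%N -> (col_at es e < n)%N.
  by rewrite -ms => /(arc_at Hes) [i [j [_ -> _]]].
have Hpart : (0 < size P)%N -> forall x, (x < n)%N -> (part x < size P)%N.
  by move=> P0 x xn; have := Pidx (Ordinal xn) P0; rewrite -partE.
have inV s (v : 'I_n) : (s < size P)%N -> (v \in part_rest P s) = (s <= part v)%N.
  by move=> sP; rewrite (mem_part_rest _ (ltnW sP)) partE.
have Hlam s : (s.+1 < size P)%N -> lam s.+1 <= lam s.
  by move=> sP; rewrite !lamE ?Pmono // ltnW.
have Hcyc s : (s < size P)%N -> no_neg_cycle m (row_at es) (col_at es)
    (arc_wt (val_at es) lam s) (stage_set n (size P) part s).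
  move=> sP; rewrite /arc_wt lamE // -ms.
  apply: (no_neg_cycle_excess Hes (V := part_rest P s)).
  - by move=> z /and3P[].
  - by move=> v /and3P[_ + _]; rewrite inV.
  - by move=> c; exact: Pmax.
have [t [st [ex tle done]]] := visualize_correct (rank_limitP (m := m)) Hrow Hcol
  Hpart Hlam Hcyc (erefl _ : imem st0 0 0 = n) (ms : imem st0 0 1 = m)
  (erefl _ : imem st0 0 2 = size P) (erefl _) (erefl _) (erefl _) (erefl _) (erefl _)
  ltac:(by case=> [|[|[|[|a]]]]) ltac:(by case=> [|[|a]]).
exists t, st; split=> //.
  exact: time_bound (nb_finite_le A) Pn tle.
move=> s sP V d A'; have [feas out _] := done s sP.
have dE (j : 'I_#|V|) : d 0 j = out_vec n st s (enum_val j) by rewrite mxE.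
have le0 i j : (to_ereal (A' i j) <= 0%:E)%E.
  rewrite /A' scaledE /restrict mxE.
  case Aij : (A (enum_val i) (enum_val j)) => [a|]; last exact: leNye.
  have [e [em re ce ve]] := arc_of Hes Aij.
  have inS (k : 'I_#|V|) : stage_set n (size P) part s (enum_val k).
    by rewrite /stage_set ltn_ord -inV ?enum_valP // Hpart // (leq_ltn_trans _ sP).
  have := feas e; rewrite -ms re ce => /(_ em (inS i) (inS j)).
  rewrite /arc_wt ve lamE // !dE /= lee_fin; lra.
split=> //; last exact: visualized_scaled le0 (Pcirc s sP).
apply: (entries_scaled Hes (stays := stage_arcs (row_at es) (col_at es) part s) dE).
  by move=> e i j em re ce; rewrite /stage_arcs re ce !inV.
by rewrite out /matrix_entry lamE // ms.
Qed.
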